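(* Let $p$ be a prime. If $p=2$, there are exactly $2$ isomorphism classes of indecomposable irretractable cycle sets of size $p^2=4$. If $p$ is odd, write $p-1=2^k l$ with $l$ odd. Then the number of isomorphism classes of indecomposable irretractable cycle sets of size $p^2$ equals $$p^{\frac{p-1}{2}} -1 + \sum_{d\mid l} \psi\left(\frac{l}{d}\right)\frac{p^{2^{k-1}d}-1}{p-1},$$ where $\psi(n)=\sum_{d\mid n} d\,\varphi(d)\,\varphi(n/d)$ with $\varphi$ the Euler totient function; explicitly, if $n=\prod_i q_i^{\nu_i}$ is the prime factorization of $n$, then $\psi(n)=\prod_i (q_i^2-1)q_i^{2\nu_i-2}$.
   Context: A (non-degenerate) cycle set is a set $X$, here always finite, with a binary operation $\cdot$ such that $(x\cdot y)\cdot(x\cdot z)=(y\cdot x)\cdot(y\cdot z)$ for all $x,y,z\in X$; each map $\sigma_x: X\to X$, $\sigma_x(y)=x\cdot y$, is bijective; and the square map $x\mapsto x\cdot x$ is bijective. Isomorphisms are bijections preserving the operation. The permutation group of $X$ is $\mathcal{G}(X)=\langle \sigma_x\mid x\in X\rangle\leq \mathrm{Sym}_X$. $X$ is indecomposable if $\mathcal{G}(X)$ acts transitively on $X$, and irretractable if $\sigma_x=\sigma_y$ implies $x=y$. *)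

(* Defs.v *)
From mathcomp Require Import all_boot all_fingroup.

Set Implicit Arguments.
Unset Strict Implicit.
Unset Printing Implicit Defensive.

Record cycleSet := CycleSet {
  cs_carrier :> finType;
  cs_op : cs_carrier -> cs_carrier -> cs_carrier;
  cs_law : forall x y z,
    cs_op (cs_op x y) (cs_op x z) = cs_op (cs_op y x) (cs_op y z);
  cs_op_bij : forall x, bijective (cs_op x);
  cs_sq_bij : bijective (fun x => cs_op x x)
}.

Definition sigma (X : cycleSet) (x : X) : {perm X} :=
  perm (bij_inj (cs_op_bij x)).

Definition permGroup (X : cycleSet) : {group {perm X}} :=
  <<[set sigma x | x : X]>>%G.

Definition indecomposable (X : cycleSet) : Prop :=
  [transitive permGroup X, on [set: X] | 'P].

Definition irretractable (X : cycleSet) : Prop := injective (@sigma X).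

Definition isomorphic (X Y : cycleSet) : Prop :=
  exists2 f : X -> Y, bijective f & {morph f : x y / cs_op x y}.

(* There are exactly N isomorphism classes of cycle sets satisfying P:
   r is a complete irredundant system of representatives indexed by 'I_N. *)
Definition isoClassCount (P : cycleSet -> Prop) (N : nat) : Prop :=
  exists r : 'I_N -> cycleSet,
    [/\ forall i, P (r i),
        forall i j, isomorphic (r i) (r j) -> i = j
      & forall X, P X -> exists i, isomorphic X (r i)].

Definition indecIrretrOfSize (n : nat) (X : cycleSet) : Prop :=
  [/\ #|X| = n, indecomposable X & irretractable X].

Definition psi (n : nat) : nat :=
  \sum_(d <- divisors n) d * totient d * totient (n %/ d).

(* Main.v *)
(** The group [G = permGroup X] carries a commutative addition with
    [val (a + b) = val a * val (lam (val a) b)] (a brace), generated by the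
    permutations [sigma x = val (elt x)], on which [G] acts additively by
    [lam g (elt x) = elt (g x)].

    Suppose first that [G] is a p-group. A central element [k] of order p cuts [X]
    into p blocks, and [G] acts on the blocks through a homomorphism
    [u : G -> F_p]. Counting fixed points of p-groups shows that [u (sigma x)] is
    not constant and yields a [lam]-fixed [z] such that [f = val z] permutes the
    blocks cyclically; as [sigma (f x)] is the conjugate of [sigma x] by [f], the
    powers of [f] and [k] give coordinates on [F_p^2] in which
    [(a, x) . (b, y) = (b + x, y + Phi (b - a))].

    In general, replace each [sigma x] by the p-primary part of [elt x]: this
    "cabling" of [X] is again indecomposable and irretractable, with a p-group as
    permutation group, hence of the form above. A transitive p-group of degree a
    power of p normalizing a p'-group makes the latter act trivially, which forces
    the p'-parts of all [elt x] to be one and the same element; its permutation is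
    an automorphism of the cabling. Altogether
    [(a, x) . (b, y) = (al b + x, al y + Phi (b - a))] with [al <> 0] and [Phi]
    even, nonconstant and [Phi (al t) = al Phi t]. Two such cycle sets are
    isomorphic iff they have the same [al] and [Phi' (s t) = s Phi t] for some
    [s <> 0].

    Burnside's lemma for this action of [F_p^*] asks for the number of even [Phi]
    that are equivariant under the group generated by a pair [(s, al)]. It depends
    only on the order of that group, and [psi e] pairs generate the subgroup of
    order [e], because [\sum_(d | e) psi d = e ^ 2]. *)

From HB Require Import structures.
Require Import Defs.
From mathcomp Require Import all_boot all_fingroup all_algebra all_solvable all_field.
From mathcomp Require Import ring zify.

Set Implicit Arguments.
Unset Strict Implicit.
Unset Printing Implicit Defensive.
Import GRing.Theory.

(** * The brace of a cycle set *)

Section Words.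
Variable X : cycleSet.
Implicit Types (x y : X) (g : {perm X}) (s t : seq X).
Local Open Scope group_scope.

Lemma sigmaE x y : sigma x y = cs_op x y.
Proof. by rewrite permE. Qed.

Lemma sigma_law x y : sigma x * sigma (sigma x y) = sigma y * sigma (sigma y x).
Proof. by apply/permP=> z; rewrite !permM !sigmaE cs_law. Qed.

Lemma sigma_permGroup x : sigma x \in permGroup X.
Proof. by apply: mem_gen; apply: imset_f. Qed.

(** Each letter is first moved by the permutation read so far; this is the rule that turns the value
    of a word into the brace sum of its letters. *)
Definition wordStep g x := g * sigma (g x).
Definition wordPerm s := foldl wordStep 1 s.

Lemma foldl_wordStep g s : foldl wordStep g s = g * wordPerm (map g s).
Proof.
have shift h : foldl wordStep (g * h) s = g * foldl wordStep h (map g s).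
  elim: s h => [|x s IHs] h //=.
  by rewrite -IHs /wordStep permM mulgA.
by rewrite -{1}[g]mulg1 shift.
Qed.

Lemma wordPerm_cons x s : wordPerm (x :: s) = sigma x * wordPerm (map (sigma x) s).
Proof. by rewrite /wordPerm /= foldl_wordStep /wordStep mul1g perm1. Qed.

Lemma wordPerm_cat s t :
  wordPerm (s ++ t) = wordPerm s * wordPerm (map (wordPerm s) t).
Proof. by rewrite {1}/wordPerm foldl_cat foldl_wordStep. Qed.

Lemma wordStepAC g x y :
  wordStep (wordStep g x) y = wordStep (wordStep g y) x.
Proof. by rewrite /wordStep -!mulgA !permM sigma_law. Qed.

(** The cycle set law lets two adjacent letters be exchanged, so the order of the letters of a word
    does not affect its value. *)
Lemma wordPerm_catC s t : wordPerm (s ++ t) = wordPerm (t ++ s).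
Proof.
have rotate g x u : foldl wordStep g (x :: u) = foldl wordStep g (rcons u x).
  elim: u g => [|y u IHu] g //=.
  by rewrite wordStepAC -IHu.
elim: s t => [|x s IHs] t; first by rewrite cats0.
rewrite -cat1s -catA cat1s /wordPerm rotate -cats1 -catA -/(wordPerm _) IHs.
by rewrite -catA.
Qed.

Lemma wordPerm_permGroup s : wordPerm s \in permGroup X.
Proof.
elim/last_ind: s => [|s x IHs]; first exact: group1.
by rewrite -cats1 wordPerm_cat groupM //= wordPerm_cons groupM ?group1 ?sigma_permGroup.
Qed.

Lemma permGroup_wordPerm g : g \in permGroup X -> exists s, wordPerm s == g.
Proof.
case/gen_prodgP=> n [c cX ->]; elim: n c cX => [|n IHn] c cX.
  by exists [::]; rewrite big_ord0.
rewrite big_ord_recr /=.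
have [|s /eqP <-] := IHn (fun i => c (widen_ord (leqnSn n) i)) => [i|]; first exact: cX.
have /imsetP[x _ ->] := cX ord_max.
(* The new letter is moved back by [wordPerm s], so that appending it multiplies by exactly
   [sigma x]. *)
exists (s ++ [:: (wordPerm s)^-1 x]).
by rewrite wordPerm_cat /= wordPerm_cons /= permKV mulg1.
Qed.

(** This makes [lam] well defined. If [g] is the value of [u], then [g * wordPerm (map g s)] is the
    value of [u ++ s], hence of [s ++ u], which depends on [s] only through [wordPerm s]. *)
Lemma wordPerm_map g s t : g \in permGroup X ->
  wordPerm s = wordPerm t -> wordPerm (map g s) = wordPerm (map g t).
Proof.
move=> /permGroup_wordPerm[u /eqP <-] est.
apply: (mulgI (wordPerm u)); rewrite -!wordPerm_cat.
by rewrite wordPerm_catC [RHS]wordPerm_catC !wordPerm_cat est.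
Qed.

End Words.

Definition brace (X : cycleSet) := {g : {perm X} | g \in permGroup X}.

HB.instance Definition _ X := [Finite of brace X by <:].

(* The locks keep conversion from unfolding [xchoose] and [invF]. *)
HB.lock Definition wordBrace (X : cycleSet) (s : seq X) : brace X :=
  Sub (wordPerm s) (wordPerm_permGroup s).

HB.lock Definition braceWord (X : cycleSet) (a : brace X) : seq X :=
  xchoose (permGroup_wordPerm (valP a)).

(** Permutations outside the group act as the identity, so that additivity holds without a
    membership hypothesis. *)
HB.lock Definition lam (X : cycleSet) (g : {perm X}) (a : brace X) : brace X :=
  if g \in permGroup X then wordBrace (map g (braceWord a)) else a.

Arguments wordBrace [X] s.
Arguments braceWord [X] a.
Arguments lam [X] g a.

(** * The additive group of the brace *)

Section BraceZmodule.
Variable X : cycleSet.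
Implicit Types (x y : X) (g h : {perm X}) (s t : seq X) (a b c : brace X).

Lemma val_wordBrace s : val (wordBrace s) = wordPerm s.
Proof. by rewrite wordBrace.unlock. Qed.

Lemma wordPerm_braceWord a : wordPerm (braceWord a) = val a.
Proof. by rewrite braceWord.unlock; apply/eqP/(xchooseP (permGroup_wordPerm (valP a))). Qed.

Lemma braceWordK : cancel (@braceWord X) (@wordBrace X).
Proof. by move=> a; apply: val_inj; rewrite val_wordBrace wordPerm_braceWord. Qed.

Definition braceAdd a b := wordBrace (braceWord a ++ braceWord b).

Lemma wordBrace_cat s t : wordBrace (s ++ t) = braceAdd (wordBrace s) (wordBrace t).
Proof.
apply: val_inj; rewrite !val_wordBrace !wordPerm_cat !wordPerm_braceWord !val_wordBrace.
congr (_ * _)%g; apply: wordPerm_map; first exact: wordPerm_permGroup.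
by rewrite wordPerm_braceWord val_wordBrace.
Qed.

Lemma braceAddC : commutative braceAdd.
Proof. by move=> a b; apply: val_inj; rewrite !val_wordBrace wordPerm_catC. Qed.

Lemma braceAddA : associative braceAdd.
Proof.
move=> a b c; rewrite -[a]braceWordK -[b]braceWordK -[c]braceWordK.
by rewrite -!wordBrace_cat catA.
Qed.

Lemma braceAdd0 : left_id (wordBrace [::]) braceAdd.
Proof. by move=> a; rewrite -[a]braceWordK -wordBrace_cat. Qed.

Lemma braceAddI : right_injective braceAdd.
Proof.
move=> a b c /(congr1 val); rewrite !val_wordBrace !wordPerm_cat => /mulgI.
rewrite wordPerm_braceWord => /(wordPerm_map (groupVr (valP a))).
by rewrite !mapK; [rewrite !wordPerm_braceWord => /val_inj | exact: permK..].
Qed.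

End BraceZmodule.

HB.lock Definition braceOpp (X : cycleSet) (a : brace X) : brace X :=
  invF (@braceAddI X a) (wordBrace [::]).

Lemma braceAddN X : left_inverse (wordBrace [::]) (@braceOpp X) (@braceAdd X).
Proof. by move=> a; rewrite braceOpp.unlock braceAddC (f_invF (@braceAddI X a)). Qed.

HB.instance Definition _ X :=
  GRing.isZmodule.Build (brace X) (@braceAddA X) (@braceAddC X) (@braceAdd0 X) (@braceAddN X).

Section BraceTheory.
Variable X : cycleSet.
Implicit Types (x y : X) (g h : {perm X}) (s t : seq X) (a b c : brace X).
Local Open Scope ring_scope.
Notation G := (permGroup X).

Definition elt x : brace X := Sub (sigma x) (sigma_permGroup x).

Lemma val_permGroup a : val a \in G.
Proof. exact: valP. Qed.

Lemma wordBrace_sum s : wordBrace s = \sum_(x <- s) elt x.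
Proof.
elim: s => [|x s IHs]; first by rewrite big_nil.
rewrite big_cons -IHs -cat1s wordBrace_cat; congr (_ + _).
by apply: val_inj; rewrite val_wordBrace wordPerm_cons mulg1.
Qed.

Lemma brace_sum a : exists s, a = \sum_(x <- s) elt x.
Proof. by exists (braceWord a); rewrite -wordBrace_sum braceWordK. Qed.

Lemma brace_ind (P : brace X -> Prop) :
  P 0 -> (forall x a, P a -> P (elt x + a)) -> forall a, P a.
Proof.
move=> P0 PD a; have [s ->] := brace_sum a.
by elim: s => [|x s IHs]; rewrite ?big_nil // big_cons; apply: PD.
Qed.

Lemma lam_wordBrace g s : g \in G -> lam g (wordBrace s) = wordBrace (map g s).
Proof.
move=> gG; rewrite lam.unlock gG; apply: val_inj; rewrite !val_wordBrace; apply: wordPerm_map => //.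
by rewrite wordPerm_braceWord val_wordBrace.
Qed.

Lemma lam_notin g a : g \notin G -> lam g a = a.
Proof. by rewrite lam.unlock => /negPf->. Qed.

Lemma lamD g a b : lam g (a + b) = lam g a + lam g b.
Proof.
have [gG|/negPf g'G] := boolP (g \in G); last by rewrite !lam_notin ?g'G.
rewrite -[a]braceWordK -[b]braceWordK -[_ + _]wordBrace_cat !lam_wordBrace //.
by rewrite map_cat wordBrace_cat.
Qed.

Lemma lamB g a b : lam g (a - b) = lam g a - lam g b.
Proof. by apply: (addIr (lam g b)); rewrite subrK -lamD subrK. Qed.

Lemma lam0 g : lam g 0 = 0.
Proof. by rewrite -{1}(subrr 0) lamB subrr. Qed.

Lemma lamMn g a n : lam g (a *+ n) = lam g a *+ n.
Proof. by elim: n => [|n IHn]; rewrite ?lam0 // !mulrS lamD IHn. Qed.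

Lemma lam_elt g x : g \in G -> lam g (elt x) = elt (g x).
Proof.
move=> gG; have eltE y : elt y = wordBrace [:: y] by rewrite wordBrace_sum big_seq1.
by rewrite !eltE lam_wordBrace.
Qed.

Lemma val_braceD a b : val (a + b) = (val a * val (lam (val a) b))%g.
Proof.
rewrite -[a]braceWordK -[b]braceWordK lam_wordBrace ?val_permGroup //.
by rewrite -[_ + _]wordBrace_cat !val_wordBrace wordPerm_cat.
Qed.

Lemma val_brace0 : val (0 : brace X) = 1%g.
Proof. exact: val_wordBrace. Qed.

Lemma lam1 a : lam 1 a = a.
Proof.
rewrite -[a]braceWordK lam_wordBrace ?group1 //; congr wordBrace.
by rewrite (eq_map (@perm1 X)) map_id.
Qed.

Lemma lamM g h a : g \in G -> h \in G -> lam (g * h) a = lam h (lam g a).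
Proof.
move=> gG hG; rewrite -[a]braceWordK !lam_wordBrace ?groupM // -map_comp.
by congr wordBrace; apply: eq_map => x; rewrite /= permM.
Qed.

Lemma lamK g : g \in G -> cancel (lam g) (lam g^-1).
Proof. by move=> gG a; rewrite -lamM ?groupV // mulgV lam1. Qed.

Lemma lamKV g : g \in G -> cancel (lam g^-1) (lam g).
Proof. by move=> gG a; rewrite -lamM ?groupV // mulVg lam1. Qed.

Lemma brace_permGroup g : g \in G -> exists a, val a = g.
Proof. by move=> gG; exists (Sub g gG). Qed.

Lemma card_brace : #|{: brace X}| = #|G|.
Proof. by rewrite card_sig; apply: eq_card. Qed.

Fact lam_is_action : is_action G (fun a g => lam g a).
Proof.
split=> [g a b|a g h gG hG /=]; last exact: lamM.
have [gG|g'G] := boolP (g \in G); first exact: (can_inj (lamK gG)).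
by rewrite !lam_notin // => ->.
Qed.

Definition lamAction := Action lam_is_action.

End BraceTheory.

(** * Exponents and multiples indexed by F_p *)

Section PrimeField.
Variable p : nat.
Hypothesis p_pr : prime p.
Local Open Scope ring_scope.

Lemma natr_Fp_mod m n : (m%:R = n%:R :> 'F_p) <-> m = n %[mod p].
Proof.
split=> [/(congr1 val)|eq_mn]; first by rewrite /= !val_Fp_nat.
by rewrite -(Fp_nat_mod p_pr m) eq_mn Fp_nat_mod.
Qed.

Lemma natr_Fp_val (c : 'F_p) : (c : nat)%:R = c.
Proof. exact: natr_Zp. Qed.

Lemma Fp_pow p' n (c : 'F_p) : p' = p -> c ^+ (p' ^ n) = c.
Proof.
move=> ->; have fp d : d ^+ p = d :> 'F_p.
  by have := expf_card d; rewrite card_Fp.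
by elim: n => [|n IHn]; rewrite ?expr1 // expnS exprM fp.
Qed.

Lemma expg_FpD (gT : finGroupType) (g : gT) (c d : 'F_p) :
  (g ^+ p = 1)%g -> (g ^+ (c + d)%R = g ^+ c * g ^+ d)%g.
Proof.
move=> gp; rewrite -expgD -(expg_mod _ gp) -[in RHS](expg_mod _ gp).
by congr (_ ^+ _)%g; apply/natr_Fp_mod; rewrite natrD !natr_Fp_val.
Qed.

Lemma expg_FpM (gT : finGroupType) (g : gT) (c d : 'F_p) :
  (g ^+ p = 1)%g -> (g ^+ (c * d)%R = g ^+ c ^+ d)%g.
Proof.
move=> gp; rewrite -expgM -(expg_mod _ gp) -[in RHS](expg_mod _ gp).
by congr (_ ^+ _)%g; apply/natr_Fp_mod; rewrite natrM !natr_Fp_val.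
Qed.

Lemma expg_Fp_nat (gT : finGroupType) (g : gT) n :
  (g ^+ p = 1)%g -> (g ^+ (n%:R : 'F_p)%R = g ^+ n)%g.
Proof.
by move=> gp; rewrite /= val_Fp_nat ?expg_mod.
Qed.

Lemma mulrn_FpD (V : zmodType) (a : V) (c d : 'F_p) :
  a *+ p = 0 -> a *+ (c + d)%R = a *+ c + a *+ d.
Proof.
move=> ap; rewrite -mulrnDr.
have modE n : a *+ n = a *+ (n %% p).
  by rewrite {1}(divn_eq n p) mulrnDr mulnC mulrnA ap mul0rn add0r.
rewrite modE [RHS]modE; congr (_ *+ _).
by apply/natr_Fp_mod; rewrite natrD !natr_Fp_val.
Qed.

Lemma mulrn_FpM (V : zmodType) (a : V) (c d : 'F_p) :
  a *+ p = 0 -> a *+ (c * d)%R = a *+ c *+ d.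
Proof.
move=> ap; rewrite -mulrnA.
have modE n : a *+ n = a *+ (n %% p).
  by rewrite {1}(divn_eq n p) mulrnDr mulnC mulrnA ap mul0rn add0r.
rewrite modE [RHS]modE; congr (_ *+ _).
by apply/natr_Fp_mod; rewrite natrM !natr_Fp_val.
Qed.

Lemma mulrn_Fp_nat (V : zmodType) (a : V) n :
  a *+ p = 0 -> a *+ (n%:R : 'F_p)%R = a *+ n.
Proof.
move=> ap; rewrite /= val_Fp_nat // [in RHS](divn_eq n p).
by rewrite mulrnDr mulnC mulrnA ap mul0rn add0r.
Qed.

(** The quotient is cyclic of order p, and [u] is the discrete logarithm with respect to a
    generator. *)
Lemma normal_index_prime_hom (gT : finGroupType) (G N : {group gT}) :
  (N <| G)%g -> #|G : N|%g = p ->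
  exists u : gT -> 'F_p,
    {in G &, {morph u : g h / (g * h)%g >-> g + h}} /\
    {in G, forall g, (u g == 0) = (g \in N)}.
Proof.
move=> nNG iNG; have oQ : #|G / N|%g = p by rewrite card_quotient ?normal_norm.
have /cyclicP[y defQ] : cyclic (G / N)%g by rewrite prime_cyclic ?oQ.
have oy : #[y]%g = p by rewrite orderE -defQ.
pose lg c := if [pick i : 'I_p | c == (y ^+ i)%g] is Some i then i : nat else 0%N.
have lgP c : c \in (G / N)%g -> c = (y ^+ lg c)%g.
  rewrite defQ => /cyclePmin[i]; rewrite oy => ltip ->; rewrite /lg.
  case: pickP => [j /eqP-> //|/(_ (Ordinal ltip))]; by rewrite eqxx.
have NG := subsetP (normal_norm nNG).
exists (fun g => (lg (coset N g))%:R); split=> [g h gG hG|g gG] /=.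
  rewrite -natrD; apply/natr_Fp_mod/eqP.
  by rewrite -{1 2}oy -eq_expg_mod_order expgD -!lgP ?mem_quotient ?groupM // morphM ?NG.
have -> : ((lg (coset N g))%:R == 0 :> 'F_p) = (y ^+ lg (coset N g) == y ^+ 0)%g.
  by rewrite eq_expg_mod_order oy; apply/eqP/eqP => /(natr_Fp_mod _ 0).
rewrite -lgP ?mem_quotient // expg0.
apply/eqP/idP => [|gN]; last exact: coset_id.
by move/coset_idr=> ->; rewrite ?NG.
Qed.

End PrimeField.

Section Eigen.
Variables (p : nat) (V : zmodType) (H : V -> Prop) (f : V -> V).
Local Open Scope ring_scope.
Hypothesis p_pr : prime p.
Hypothesis H0 : H 0.
Hypothesis HB : forall a b, H a -> H b -> H (a - b).
Hypothesis fD : {morph f : a b / a + b}.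
Hypothesis fH : forall a, H a -> H (f a).

(* An eigenvalue in [F_p] of an operator of [p]-power order is 1. *)
Lemma p_order_eigen n v c : iter (p ^ n) f v = v -> H (v *+ p) ->
  H (f v - v *+ c) -> H (f v - v).
Proof.
have HN a : H a -> H (- a) by rewrite -sub0r; apply: HB.
have HD a b : H a -> H b -> H (a + b) by move=> Ha Hb; rewrite -[b]opprK; apply/HB/HN.
have HM a m : H a -> H (a *+ m).
  by move=> Ha; elim: m => [|m IHm]; rewrite ?mulr0n ?mulrS //; apply: (HD _ _).
have f0 : f 0 = 0 by apply: (addIr (f 0)); rewrite -fD !add0r.
have fM a m : f (a *+ m) = f a *+ m by elim: m => [|m IHm]; rewrite ?f0 // !mulrS fD IHm.
have fN a : f (- a) = - f a by apply: (addrI (f a)); rewrite -fD !subrr f0.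
move=> it pv fv.
have modH m m' : m = m' %[mod p] -> H (v *+ m - v *+ m').
  have modp k : H (v *+ k - v *+ (k %% p)).
    by rewrite {1}(divn_eq k p) mulrnDr addrK mulnC mulrnA; apply: (HM _ _).
  move=> e; rewrite -[v *+ m](subrK (v *+ (m %% p))) {2}e -addrA; apply: (HD _ _) => //.
  by rewrite -opprB; apply: (HN _).
have itP k : H (iter k f v - v *+ (c ^ k)).
  elim: k => [|k IHk] /=; first by rewrite subrr.
  have := fH IHk; rewrite fD fN fM => h1.
  have -> : f (iter k f v) - v *+ c ^ k.+1 =
    (f (iter k f v) - f v *+ c ^ k) + (f v - v *+ c) *+ c ^ k.
    by rewrite mulrnBl -mulrnA -expnS addrA subrK.
  by apply: (HD _ _) => //; apply: (HM _ _).
(* After [p ^ n] iterations the operator is back at [v], while [c ^ (p ^ n)] is [c] in ['F_p] by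
   Fermat; so [v] and [v *+ c] agree modulo [H]. *)
have := itP (p ^ n)%N; rewrite it => h1.
have h2 : H (v *+ c - v *+ (c ^ (p ^ n))).
  by apply: (modH _ _); apply/(natr_Fp_mod p_pr); rewrite natrX Fp_pow.
rewrite -[f v](subrK (v *+ c)) -addrA; apply: (HD _ _) => //.
rewrite -[v *+ c](subrK (v *+ (c ^ (p ^ n)))) -addrA; apply: (HD _ _) => //.
by rewrite -opprB; apply: (HN _).
Qed.

End Eigen.

Lemma indecomposableP (X : cycleSet) :
  indecomposable X -> forall x y, exists2 g, g \in permGroup X & g x = y.
Proof.
move=> trX x y; have := atransP2 trX (in_setT x) (in_setT y).
by case=> g gG ->; exists g.
Qed.

(** * Cycle sets with a p-group as permutation group *)

Section HomConst.
Variables (p : nat) (X : cycleSet) (u : {perm X} -> 'F_p).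
Notation G := (permGroup X).
Hypothesis p_pr : prime p.
Hypothesis pG : (p.-group G)%g.
Hypothesis uM : {in G &, {morph u : g h / (g * h)%g >-> (g + h)%R}}.
Local Open Scope ring_scope.

Lemma hom1 : u 1%g = 0.
Proof. by apply: (addIr (u 1%g)); rewrite -uM ?group1 // mulg1 add0r. Qed.

Lemma homV g : g \in G -> u g^-1%g = - u g.
Proof. by move=> gG; apply: (addIr (u g)); rewrite -uM ?groupV // mulVg addNr hom1. Qed.

Lemma homX g n : g \in G -> u (g ^+ n)%g = u g *+ n.
Proof.
by move=> gG; elim: n => [|n IHn]; rewrite ?hom1 // expgS uM ?groupX // IHn mulrS.
Qed.

Hypothesis uN : {in G, forall n x, u n = 0 -> u (sigma (n x)) = u (sigma x)}.

Let U (a : brace X) := u (val a).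

Let UD a b : U (a + b) = U a + U (lam (val a) b).
Proof. by rewrite /U val_braceD uM ?val_permGroup. Qed.

(** A kernel element can be pushed through a sum of [elt x] term by term; past each term it becomes
    another kernel element, called [m] below. *)
Let U_ker a g n : g \in G -> n \in G -> u n = 0 -> U (lam n (lam g a)) = U (lam g a).
Proof.
elim/brace_ind: a g n => [|x a IHa] g n gG nG un; first by rewrite !lam0.
rewrite !lamD !lam_elt //= !UD /= /U /= -/(U _) -/(U _) uN //; congr (_ + _).
set y := g x; pose m := ((sigma y)^-1 * n * sigma (n y))%g.
have sG z : sigma z \in G by apply: sigma_permGroup.
have mG : m \in G by rewrite !groupM ?groupV.
have -> : lam (sigma (n y)) (lam n (lam g a)) = lam m (lam (g * sigma y)%g a).
  by rewrite -!lamM ?groupM ?groupV // /m !mulgA mulgK.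
rewrite IHa ?groupM ?groupV // ?lamM // /m !uM ?groupM ?groupV // homV // un addr0 uN //.
  by rewrite addNr.
Qed.

(** With [g = val c], commutativity of [c + a] expresses [U (lam g a)] through [U a] and
    [U (lam (val a) c)], and the latter depends on [val a] only modulo the kernel. *)
Let U_eq a b g : g \in G -> U a = U b -> U (lam g a) = U (lam g b).
Proof.
move=> gG; have [c <-] := brace_permGroup gG => Uab.
have key z : U c + U (lam (val c) z) = U z + U (lam (val z) c) by rewrite -!UD addrC.
suff e : U (lam (val a) c) = U (lam (val b) c) by apply: (addrI (U c)); rewrite !key Uab e.
pose m := ((val b)^-1 * val a)%g.
have mG : m \in G by rewrite groupM ?groupV ?val_permGroup.
rewrite -(mulKVg (val b) (val a)) lamM ?val_permGroup // U_ker ?val_permGroup //.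
by rewrite uM ?groupV ?val_permGroup // homV ?val_permGroup // -/(U _) -/(U _) Uab addNr.
Qed.

(** When [u] is not zero, [U_eq] makes [G] act on the p values of [U]. The number of fixed points of
    this p-group is divisible by p, and 0 is one of them, so all values are fixed. *)
Lemma hom_lam a g : g \in G -> u (val (lam g a)) = u (val a).
Proof.
case: (boolP [forall h in G, u h == 0]) => [/forall_inP u0|].
  by move=> _; rewrite !(eqP (u0 _ (val_permGroup _))).
case/forall_inPn => g0 g0G ug0 gG.
have repP c : exists b, U b == c.
  have [b bE] := brace_permGroup (groupX (c / u g0 : 'F_p)%R g0G).
  by exists b; rewrite /U bE homX // -mulr_natr natr_Fp_val mulrC divfK.
pose rep c := xchoose (repP c).
have UrepK c : U (rep c) = c by apply/eqP/(xchooseP (repP c)).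
have act_to : is_action G (fun c h => U (lam h (rep c))).
  split=> [h c d /= e|c h k hG kG /=]; last first.
    by rewrite lamM //; apply: U_eq => //; rewrite UrepK.
  have [hG|h'G] := boolP (h \in G).
    have := U_eq (groupVr hG) e.
    by rewrite !lamK // !UrepK.
  by move: e; rewrite !lam_notin // !UrepK.
pose to := Action act_to.
have toT : [acts G, on [set: 'F_p] | to].
  by apply/subsetP=> h hG; rewrite !inE hG; apply/subsetP=> c; rewrite !inE.
have := pgroup_fix_mod pG toT; rewrite cardsT card_Fp // modnn => /esym fixp.
have fix0 : 0 \in 'Fix_([set: 'F_p] | to)(G)%g.
  rewrite !inE; apply/subsetP=> h hG; rewrite !inE /=; apply/eqP.
  have e : U (rep 0) = U 0 by rewrite UrepK /U val_brace0 hom1.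
  by rewrite (U_eq hG e) lam0 /U val_brace0 hom1.
have fixT : 'Fix_([set: 'F_p] | to)(G)%g = [set: 'F_p].
  apply/eqP; rewrite eqEcard subsetIl cardsT card_Fp //=.
  by apply: dvdn_leq; [apply/card_gt0P; exists 0 | rewrite /dvdn fixp].
have /setIP[_ /afixP/(_ g gG) /= e] : U a \in 'Fix_([set: 'F_p] | to)(G)%g.
  by rewrite fixT inE.
by rewrite -[RHS]/(U a) -e; apply: U_eq; rewrite ?UrepK.
Qed.

Lemma hom_sigma_const : indecomposable X -> forall x y, u (sigma x) = u (sigma y).
Proof.
by move=> /indecomposableP trX x y; have [g gG <-] := trX y x; rewrite -(hom_lam (elt y) gG) lam_elt.
Qed.

End HomConst.

(** * Elements of the brace fixed by the group *)

Section FixedElements.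
Variable X : cycleSet.
Implicit Types (x y : X) (a b z : brace X).
Notation G := (permGroup X).
Local Open Scope ring_scope.

Definition braceFixed z := forall g, g \in G -> lam g z = z.

Lemma braceFixed_gen z : (forall x, lam (sigma x) z = z) -> braceFixed z.
Proof.
move=> fz g gG; have: G \subset 'C[z | lamAction X]%g.
  rewrite gen_subG; apply/subsetP=> _ /imsetP[x _ ->].
  by rewrite inE sigma_permGroup inE; apply/subsetP=> t; rewrite !inE => /eqP->; rewrite /= fz.
by move/subsetP/(_ g gG) => zg; apply: (astab_act zg (set11 z)).
Qed.

Lemma val_fixedD a z : braceFixed z -> val (a + z) = (val a * val z)%g.
Proof. by move=> fz; rewrite val_braceD fz ?val_permGroup. Qed.

Lemma val_fixedMn z n : braceFixed z -> val (z *+ n) = (val z ^+ n)%g.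
Proof.
by move=> fz; elim: n => [|n IHn]; rewrite ?val_brace0 // mulrSr val_fixedD // IHn expgSr.
Qed.

Lemma braceFixedMn z n : braceFixed z -> braceFixed (z *+ n).
Proof. by move=> fz g gG; rewrite lamMn fz. Qed.

(** Written as products, [z + elt x = elt x + z] says [val z * sigma (val z x) = sigma x * val
    z]. *)
Lemma sigma_fixed z x : braceFixed z -> sigma (val z x) = (sigma x ^ val z)%g.
Proof.
move=> fz; have := val_fixedD (elt x) fz.
rewrite addrC val_braceD lam_elt ?val_permGroup //= => e.
by rewrite conjgE -e mulKg.
Qed.

Hypothesis irrX : irretractable X.

Lemma elt_inj : injective (@elt X).
Proof. by move=> x y /(congr1 val) /= /irrX. Qed.

(** By [sigma_fixed] the points [x] and [val z x] have the same permutation, so irretractability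
    makes [val z] trivial. *)
Lemma fixed_central0 z : braceFixed z ->
  (forall x, commute (val z) (sigma x)) -> z = 0.
Proof.
move=> fz cz; apply: val_inj; rewrite val_brace0; apply/permP=> x; rewrite perm1.
apply: irrX; rewrite sigma_fixed // conjgE -cz mulKg //.
Qed.

(** The number of fixed points is congruent to [#|S|] modulo p, hence divisible by p; as 0 is one of
    them there are others. *)
Lemma exists_fixed p (S : {set brace X}) : prime p -> (p.-group G)%g ->
  [acts G, on S | lamAction X] -> 0 \in S -> (p %| #|S|)%N ->
  exists z, [/\ z \in S, z != 0 & braceFixed z].
Proof.
move=> p_pr pG actS S0 dS; have := pgroup_fix_mod pG actS.
rewrite (eqP dS) => /esym/eqP; rewrite -/(dvdn _ _) => dF.
have F0 : 0 \in 'Fix_(S | lamAction X)(G)%g.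
  by rewrite inE S0; apply/afixP=> g gG /=; rewrite lam0.
have : (1 < #|'Fix_(S | lamAction X)(G)%g|)%N.
  by apply: leq_trans (prime_gt1 p_pr) (dvdn_leq _ dF); apply/card_gt0P; exists 0.
rewrite (cardD1 0) F0 => /card_gt0P[z] /andP[z0 /setIP[zS /afixP zF]].
by exists z; split=> // g gG; apply: zF.
Qed.

End FixedElements.

(** * Blocks of imprimitivity from a central element *)

Section BlockHom.
Variables (p : nat) (X : cycleSet).
Notation G := (permGroup X).
Hypothesis p_pr : prime p.
Hypothesis pG : (p.-group G)%g.
Hypothesis cX : #|X| = (p ^ 2)%N.
Hypothesis trX : indecomposable X.
Local Open Scope group_scope.

Lemma central_free k x : k \in 'Z(G) -> k x = x -> k = 1.
Proof.
case/centerP=> kG kC kx; apply/permP=> y; rewrite perm1.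
have [g gG <-] := indecomposableP trX x y.
by rewrite -permM -kC // permM kx.
Qed.

Lemma indec_card_stab x : #|G : 'C_G[x | 'P]| = (p ^ 2)%N.
Proof.
by rewrite -card_orbit (atransP trX) ?inE // cardsT cX.
Qed.

Lemma exists_central : exists k, [/\ k \in 'Z(G), #[k] = p & (p ^ 2 %| #|G|)%N].
Proof.
have [x _] : exists x : X, x \in X by apply/card_gt0P; rewrite cX expn_gt0 prime_gt0.
have d2 : (p ^ 2 %| #|G|)%N by rewrite -(indec_card_stab x) dvdn_indexg.
have ntG : G :!=: 1.
  apply/eqP=> G1; move: d2; rewrite G1 cards1 dvdn1.
  by rewrite -(expn0 p) eqn_exp2l ?prime_gt1.
have /trivgPn[c _ c1] : 'Z(G) != 1 by apply: contraNneq ntG => /(trivg_center_pgroup pG) ->.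
have ntZ : 'Z(G) != 1 by apply: contraNneq ntG => /(trivg_center_pgroup pG) ->.
have [_ dZ _] := pgroup_pdiv (pgroupS (center_sub G) pG) ntZ.
by have [k kZ ok] := Cauchy p_pr dZ; exists k.
Qed.

(* [u] is the action of [G] on the set of p orbits of [k]. *)
Lemma block_hom k : k \in 'Z(G) -> #[k] = p ->
  exists u : {perm X} -> 'F_p,
  {in G &, {morph u : g h / g * h >-> (g + h)%R}} /\
  {in G, forall g x, u g = 0%R <-> exists i : 'F_p, g x = (k ^+ i) x}.
Proof.
move=> kZ ok; have /centerP[kG kC] := kZ.
have [o _] : exists x : X, x \in X by apply/card_gt0P; rewrite cX expn_gt0 prime_gt0.
(* [N] is the stabilizer of the block of [o]; having index p in a p-group, it is normal. *)
pose S := 'C_G[o | 'P]%G; pose N := (<[k]> <*> S)%G.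
have sSG : S \subset G := subsetIl _ _.
have skG : <[k]> \subset G by rewrite cycle_subG.
have defN : N :=: <[k]> * S.
  apply: cent_joinEr; rewrite centsC (subset_trans _ (centS sSG)) // cycle_subG.
  by case/setIP: kZ.
have tiKS : <[k]> :&: S = 1.
  apply/trivgP/subsetP=> h /setIP[kh /setIP[_ /astab1P ho]]; rewrite inE; apply/eqP.
  by apply: central_free ho; move: h kh; apply/subsetP; rewrite cycle_subG.
have oN : #|N| = (p * #|S|)%N by rewrite defN TI_cardMg // -orderE ok.
have sNG : N \subset G by rewrite join_subG skG.
have iN : #|G : N| = p.
  have : (p * #|S| * #|G : N| = p * #|S| * p)%N.
    by rewrite -{1}oN Lagrange // -(Lagrange sSG) indec_card_stab expnS expn1 mulnCA mulnA.
  by move/eqP; rewrite eqn_pmul2l ?muln_gt0 ?(prime_gt0 p_pr) ?cardG_gt0 // => /eqP.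
have kXC g i : g \in G -> commute g (k ^+ i).
  by move=> gG; apply/commuteX/commute_sym/kC.
have kp : k ^+ p = 1 by rewrite -ok expg_order.
have nNG : N <| G by apply: (p_maximal_normal pG); apply: p_index_maximal; rewrite ?iN.
have [u [uM uN]] := normal_index_prime_hom p_pr nNG iN.
exists u; split=> //.
have atom g : g \in G -> g \in N <-> exists i : 'F_p, g o = (k ^+ i) o.
  move=> gG; rewrite defN; split=> [/mulsgP[h s /cyclePmin[i]]|[i go]].
    rewrite ok => lip -> /setIP[sG /astab1P so] ->; exists (i%:R)%R.
    rewrite expg_Fp_nat // -(kXC s i sG) permM.
    by rewrite -[s o]/(aperm o s) so.
  rewrite -(mulKVg (k ^+ i) g) mem_mulg ?mem_cycle // inE groupM ?groupV ?groupX //=.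
  have c : commute g (k ^+ i)^-1 by apply/commuteV/kXC.
  by apply/astab1P; rewrite /= /aperm -c permM go permK.
move=> g gG x; have [h hG <-] := indecomposableP trX o x.
(* Conjugation by [h] transports the question from [x] to [o], where [N] decides it; the exponent is
   kept because [k] is central. *)
have -> : u g = u (h * g * h^-1).
  by rewrite !uM ?groupM ?groupV // (homV uM) // addrAC subrr add0r.
have cG : h * g * h^-1 \in G by rewrite !groupM ?groupV.
split=> [/eqP|[i gi]].
  rewrite uN // => /(atom _ cG).1 [i e]; exists i.
  have := congr1 h e; rewrite !permM permKV => ->.
  by rewrite -!permM (kXC h i hG).
apply/eqP; rewrite uN //; apply/(atom _ cG); exists i.
by rewrite !permM gi -[(k ^+ i) (h o)]permM (kXC h i hG) permM permK.
Qed.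

End BlockHom.

(** * The action on the blocks and its kernel *)

Section Blocks.
Variables (p : nat) (X : cycleSet) (k : {perm X}) (u : {perm X} -> 'F_p).
Notation G := (permGroup X).
Hypothesis p_pr : prime p.
Hypothesis pG : (p.-group G)%g.
Hypothesis cX : #|X| = (p ^ 2)%N.
Hypothesis trX : indecomposable X.
Hypothesis irrX : irretractable X.
Hypothesis kZ : (k \in 'Z(G))%g.
Hypothesis ok : (#[k] = p)%g.
Hypothesis uM : {in G &, {morph u : g h / (g * h)%g >-> (g + h)%R}}.
Hypothesis uP :
  {in G, forall g x, u g = 0%R <-> exists i : 'F_p, g x = (k ^+ i)%g x}.
Local Open Scope ring_scope.
Implicit Types (x y : X) (g m n : {perm X}) (i j : 'F_p).

Definition blockKernel n := (n \in G) && (u n == 0).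
Notation K := blockKernel.

Lemma kernelP n : K n -> n \in G /\ u n = 0.
Proof. by case/andP=> nG /eqP. Qed.

Lemma kp : (k ^+ p = 1)%g. Proof. by rewrite -ok expg_order. Qed.

Lemma kG : k \in G. Proof. by case/centerP: kZ. Qed.

Lemma kXC g j : g \in G -> commute g (k ^+ j)%g.
Proof. by case/centerP: kZ => _ kC gG; apply/commuteX/commute_sym/kC. Qed.

Lemma kXCx g j x : g \in G -> g ((k ^+ j)%g x) = (k ^+ j)%g (g x).
Proof. by move=> gG; rewrite -!permM kXC. Qed.

Lemma kCx g x : g \in G -> g (k x) = k (g x).
Proof. by case/centerP: kZ => _ kC gG; rewrite -!permM kC. Qed.

Lemma kD i j x : (k ^+ (i + j)%R)%g x = (k ^+ i)%g ((k ^+ j)%g x).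
Proof. by rewrite addrC expg_FpD ?kp // permM. Qed.

Lemma kernel_k : K k.
Proof.
rewrite /K kG; apply/eqP.
have [x _] : exists x : X, x \in X by apply/card_gt0P; rewrite cX expn_gt0 prime_gt0.
by apply/(uP kG x); exists 1%:R; rewrite expg_Fp_nat ?kp.
Qed.

Lemma kernelM n m : K n -> K m -> K (n * m)%g.
Proof.
by move=> /kernelP[nG un] /kernelP[mG um]; rewrite /K groupM //= uM // un um addr0.
Qed.

Lemma kernelV n : K n -> K n^-1%g.
Proof. by case/kernelP=> nG un; rewrite /K groupV nG (homV uM) //= un oppr0. Qed.

Lemma kernelX n i : K n -> K (n ^+ i)%g.
Proof. by case/kernelP=> nG un; rewrite /K groupX //= (homX uM) // un mul0rn. Qed.

Lemma kernel_quo g h : g \in G -> h \in G -> u g = u h -> K (g^-1 * h)%g.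
Proof.
by move=> gG hG e; rewrite /K groupM ?groupV //= uM ?groupV // (homV uM) // e addNr.
Qed.

Lemma kernel_act n x : K n -> exists i, n x = (k ^+ i)%g x.
Proof. by case/kernelP=> nG un; apply/uP. Qed.

Lemma fix_kernel g x : g \in G -> g x = x -> K g.
Proof.
by move=> gG gx; rewrite /K gG; apply/eqP/(uP gG x); exists 0; rewrite expg0 perm1.
Qed.

Lemma kernel_expE n x i j : K n -> n x = (k ^+ i)%g x ->
  (n ^+ j)%g x = (k ^+ (i * j)%R)%g x.
Proof.
move=> /kernelP[nG _] e.
have {}e (t : nat) : (n ^+ t)%g x = (k ^+ (i * t%:R)%R)%g x.
  elim: t => [|t IHm]; first by rewrite mulr0 !expg0.
  by rewrite expgSr permM IHm kXCx // e -kD mulrSr mulrDr mulr1.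
by rewrite e natr_Fp_val.
Qed.

Lemma kernel_exp1 n : K n -> (n ^+ p = 1)%g.
Proof.
move=> Kn; apply/permP=> x; rewrite perm1.
have [i nx] := kernel_act x Kn; have /kernelP[nG _] := Kn.
have {}e (t : nat) : (n ^+ t)%g x = (k ^+ (i * t%:R)%R)%g x.
  elim: t => [|t IHm]; first by rewrite mulr0 !expg0 perm1.
  by rewrite expgSr permM IHm kXCx // nx -kD mulrSr mulrDr mulr1.
by rewrite e pchar_Fp_0 // mulr0 expg0 perm1.
Qed.

(** On each block both act as powers of [k]. *)
Lemma kernelC n m : K n -> K m -> commute n m.
Proof.
move=> Kn Km; apply/permP=> x; rewrite !permM.
have [/kernelP[nG _] /kernelP[mG _]] := (Kn, Km).
have [[i ni] [j mj]] := (kernel_act x Kn, kernel_act x Km).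
by rewrite ni mj !kXCx // ni mj -!kD addrC.
Qed.

Lemma kernel_kx n x : K n -> n x != x -> exists j, k x = (n ^+ j)%g x.
Proof.
move=> Kn nx; have [i e] := kernel_act x Kn.
have i0 : i != 0 by apply: contraNneq nx => i0; rewrite e i0 perm1.
exists i^-1; rewrite (kernel_expE _ Kn e) divff // -[1]/(1%:R) expg_Fp_nat ?kp.
Qed.

(* Otherwise [G] acts regularly, the brace has as many elements as [X], and
   the orbit [elt X] of [G] contains the fixed element 0. *)
Lemma kernel_nonfree : exists m x y, [/\ K m, m x = x & m y != y].
Proof.
have [o _] : exists x : X, x \in X by apply/card_gt0P; rewrite cX expn_gt0 prime_gt0.
case: (pickP (fun q : {perm X} * (X * X) =>
   [&& K q.1, q.1 q.2.1 == q.2.1 & q.1 q.2.2 != q.2.2])) => [[m [x y]]|none].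
  by case/and3P=> Km /eqP mx my; exists m, x, y.
have reg : {in G &, injective (fun g : {perm X} => g o)}.
  move=> g h gG hG /= e; apply: (mulIg h^-1%g); rewrite mulgV; apply/permP=> y.
  have ghG : (g * h^-1)%g \in G by rewrite groupM ?groupV.
  have fo : (g * h^-1)%g o = o by rewrite permM e permK.
  have := none ((g * h^-1)%g, (o, y)); rewrite /= fo eqxx (fix_kernel ghG fo) /=.
  by rewrite perm1 => /negbFE/eqP.
have cG : (#|{: brace X}| <= #|X|)%N.
  by rewrite card_brace -(card_in_imset reg) max_card.
have [inv _ eltK] := inj_card_bij (elt_inj irrX) cG.
have fix0 g x : g \in G -> elt x = 0 -> g x = x.
  by move=> gG ex; apply: (elt_inj irrX); rewrite -lam_elt // ex lam0.
have X1 : #|X| = 1%N.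
  apply/eqP/card1P; exists (inv 0) => y; rewrite !inE; apply/esym/eqP.
  by have [g gG <-] := indecomposableP trX (inv 0) y; apply: fix0; rewrite ?eltK.
by move: X1; rewrite cX => /eqP; rewrite -(expn0 p) eqn_exp2l ?prime_gt1.
Qed.

Lemma elt_sub_lam x y (w : brace X) :
  val (lam (sigma x) (elt y - elt x)) = val w <-> sigma y = (sigma x * val w)%g.
Proof.
have := val_braceD (elt x) (elt y - elt x); rewrite addrC subrK /= => ->.
by split=> [->|/mulgI].
Qed.

(** Otherwise there is a nonzero fixed [z] with [f = val z] in the kernel. It is shown that [f] adds
    the same element [d o] to every [elt x] and that [sigma o] fixes [d o]; then [f] commutes with
    [sigma o], which forces [z = 0]. *)
Lemma sigma_not_const : ~ (forall x y, u (sigma x) = u (sigma y)).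
Proof.
move=> uc; have sG x := sigma_permGroup x.
have [o _] : exists x : X, x \in X by apply/card_gt0P; rewrite cX expn_gt0 prime_gt0.
pose H := [set a : brace X | u (val a) == 0].
have actH : [acts G, on H | lamAction X]%g.
  apply/subsetP=> g gG; rewrite !inE gG; apply/subsetP=> a; rewrite !inE /=.
  by rewrite (hom_lam p_pr pG uM).
have H0 : 0 \in H by rewrite inE val_brace0 (hom1 uM).
have dH : (p %| #|H|)%N.
  have gK : group_set [set g | K g].
    apply/group_setP; split=> [|g h]; rewrite !inE /K; last exact: kernelM.
    by rewrite group1 (hom1 uM) eqxx.
  have <- : #|[set g | K g]| = #|H|.
    rewrite -[RHS](card_imset _ (val_inj : injective (val : brace X -> _))).
    apply: eq_card => g; rewrite inE.
    apply/andP/imsetP=> [[gG ug]|[a]]; last by rewrite inE => ua ->; rewrite val_permGroup.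
    by have [a e] := brace_permGroup gG; exists a; rewrite ?inE e.
  by rewrite -ok; apply: (order_dvdG (G := Group gK)); rewrite inE kernel_k.
have [z [zH z0 zF]] := exists_fixed p_pr pG actH H0 dH.
set f := val z; have fG : f \in G by apply: val_permGroup.
have Kf : K f by move: zH; rewrite inE /K fG.
have sf x : sigma (f x) = (sigma x ^ f)%g by apply: sigma_fixed.
pose D x : {perm X} := [~ sigma x, f]%g.
have sD x : sigma (f x) = (sigma x * D x)%g by rewrite sf /D commgEl mulKVg.
have KD x : K (D x).
  rewrite /D commgEl; apply: kernel_quo; rewrite ?groupJ ?sG //.
  rewrite conjgE !uM ?groupM ?groupV ?sG // (homV uM) //.
  by rewrite addrCA addNr addr0.
(* All [sigma x] lie in one coset of the abelian kernel, which contains both [f] and [D o]. *)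
have DE x : D x = D o.
  have Kn : K ((sigma o)^-1 * sigma x)%g by apply: kernel_quo; rewrite ?sG.
  rewrite /D -[sigma x](mulKVg (sigma o)) commMgJ.
  have -> : ([~ (sigma o)^-1 * sigma x, f] = 1)%g by apply/eqP/commgP/kernelC.
  rewrite mulg1 conjgE.
  have c : commute (D o) ((sigma o)^-1 * sigma x)%g by apply: kernelC.
  by rewrite -/(D o) c mulKg.
have f'C x : ~ commute f (sigma x).
  move=> fx; have Do : D o = 1%g by rewrite -(DE x); apply/eqP/commgP/commute_sym.
  move/eqP: z0; apply; apply: (fixed_central0 irrX zF) => y.
  by apply/commute_sym/commgP/eqP; rewrite -/(D y) DE.
have D1 : D o != 1%g.
  by apply/eqP=> Do; apply: (f'C o); apply/commute_sym/commgP/eqP.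
have fx x : f x != x.
  apply: contraNneq D1 => fx; have := sD x; rewrite fx DE.
  by rewrite -{1}[sigma x]mulg1 => /mulgI <-.
pose d x := elt (f x) - elt x.
pose w := lam (sigma o) (d o).
have wD : val w = D o by apply: (mulgI (sigma o)); rewrite -sD; apply/esym/elt_sub_lam.
have dw x : lam (sigma x) (d x) = w.
  by apply: val_inj; apply/elt_sub_lam; rewrite wD sD DE.
(* The square map is onto, so [y] is [sigma x x] for some [x]. Conjugating [m] by [sigma x] gives a
   kernel element that fixes [x], hence [f x], hence [d x]. *)
have fix_point m y : K m -> m y = y -> lam m w = w.
  have [inv _ invK] := cs_sq_bij X.
  move=> Km; have /kernelP[mG _] := Km.
  rewrite -[y]invK -sigmaE; move: (inv y) => x mx.
  pose n : {perm X} := (sigma x * m * (sigma x)^-1)%g.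
  have nG : n \in G by rewrite !groupM ?groupV ?sG.
  have nx : n x = x by rewrite !permM mx permK.
  have nf : n (f x) = f x.
    by rewrite -permM -(kernelC _ Kf) ?(fix_kernel nG nx) // permM nx.
  have -> : lam m w = lam (sigma x * m)%g (d x) by rewrite (lamM _ (sG x) mG) dw.
  have -> : (sigma x * m = n * sigma x)%g by rewrite /n mulgKV.
  rewrite (lamM _ nG (sG x)) -[RHS](dw x); congr lam.
  by rewrite /d [LHS]lamB !lam_elt // nf nx.
(* Some [m0] in the kernel fixes [x0] and moves [y0]. A power of it agrees with [n] at [y0], so [n]
   is a product of two kernel elements with a fixed point each. *)
have fixK n : K n -> lam n w = w.
  move=> Kn; have [m0 [x0 [y0 [Km0 m0x m0y]]]] := kernel_nonfree.
  have [l nl] := kernel_act y0 Kn; have [j mj] := kernel_act y0 Km0.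
  have j0 : j != 0 by apply: contraNneq m0y => j0; rewrite mj j0 perm1.
  pose m1 : {perm X} := (m0 ^+ (l / j)%R)%g.
  have Km1 : K m1 by apply: kernelX.
  have m1y : m1 y0 = n y0 by rewrite (kernel_expE _ Km0 mj) nl mulrC divfK.
  have m1w : lam m1 w = w.
    apply: (fix_point _ x0) => //; rewrite /m1.
    by elim: (nat_of_ord _) => [|t IHt]; rewrite ?perm1 // expgSr permM IHt.
  have /kernelP[m1G _] := Km1; have /kernelP[nG _] := Kn.
  rewrite -[n](mulgKV m1) lamM ?groupM ?groupV // (fix_point _ y0) //.
    by rewrite kernelM ?kernelV.
  by rewrite permM -m1y permK.
have dE x : d x = d o.
  rewrite -(lamK (sG x) (d x)) -(lamK (sG o) (d o)) !dw.
  rewrite -{1}(fixK ((sigma x)^-1 * sigma o)^-1%g).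
    by rewrite -lamM ?groupV ?groupM ?groupV ?sG // invMg invgK mulgK.
  by rewrite kernelV // kernel_quo ?sG.
have {}dE x : elt (f x) = elt x + d o by rewrite -(dE x) addrC subrK.
have dfX t x : elt ((f ^+ t)%g x) = elt x + d o *+ t.
  elim: t x => [|t IHt] x; first by rewrite perm1 addr0.
  by rewrite expgSr permM dE IHt -addrA -mulrSr.
have dp : d o *+ p = 0.
  by have := dfX p o; rewrite kernel_exp1 // perm1 -{1}[elt o]addr0 => /addrI.
have [i fi] := kernel_act o Kf; have [j Dj] := kernel_act o (KD o).
have i0 : i != 0 by apply: contraNneq (fx o) => i0; rewrite fi i0 perm1.
pose l := (j / i)%R.
(* Computing [elt (D o o)] in two ways yields [lam (sigma o) (d o) = (1 - l) d o]. *)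
have Do : elt (D o o) = elt o + d o *+ l.
  by rewrite -dfX (kernel_expE _ Kf fi) Dj mulrC divfK.
have Do' : elt (D o o) = elt o + d o - lam (sigma o) (d o).
  rewrite /D commgEl conjgE !permM dE -lam_elt ?sG //.
  have := dE (f^-1%g ((sigma o)^-1%g o)); rewrite permKV => /esym/eqP.
  rewrite eq_sym -subr_eq => /eqP <-.
  by rewrite lamB lam_elt ?sG // permKV addrAC.
have lam_do : lam (sigma o) (d o) = d o.
  have [e oe] := p_natP (mem_p_elt pG (sG o)).
  apply/eqP; rewrite -subr_eq0; apply/eqP.
  (* The natural number [(p - l).+1] stands for the eigenvalue 1 - l of ['F_p]. *)
  apply: (@p_order_eigen p _ (fun a => a = 0) (lam (sigma o)) p_pr _ _ _ _ e _ (p - l).+1) => //.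
  - by move=> a b -> ->; rewrite subrr.
  - exact: lamD.
  - by move=> a ->; rewrite lam0.
  - have it t : iter t (lam (sigma o)) (d o) = lam (sigma o ^+ t)%g (d o).
      by elim: t => [|t IHt]; rewrite ?lam1 // expgSr lamM ?groupX ?sG //= IHt.
    by rewrite it -oe expg_order lam1.
  have lp : (l < p)%N by rewrite -{2}(Fp_cast p_pr).
  have e' : d o - lam (sigma o) (d o) = d o *+ l.
    by apply: (addrI (elt o)); rewrite addrA -Do' Do.
  rewrite mulrS opprD addrA mulrnBr ?(ltnW lp) // dp sub0r opprK.
by rewrite -e' addrA subrK subrr.
apply: (f'C o); apply/permP=> x; rewrite !permM; apply: (elt_inj irrX).
by rewrite dE -(lam_elt (f x) (sG o)) -(lam_elt x (sG o)) dE lamD lam_do.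
Qed.

(** Suppose [f = val z] is in the kernel. Where [f x = x], [u (sigma x)] is 0, since otherwise [f]
    would commute with all powers of [sigma x] and with the kernel, hence with everything; where [f]
    moves [x], [k x] is a power of [f] applied to [x]. Either way [k] preserves [u (sigma x)], so by
    [hom_sigma_const] the latter is constant, which is excluded. *)
Lemma fixed_notin_kernel z : braceFixed z -> z != 0 -> u (val z) != 0.
Proof.
move=> zF z0; apply/eqP=> uz; set f := val z.
have fG : f \in G by apply: val_permGroup.
have Kf : K f by rewrite /K fG uz eqxx.
have sG x := sigma_permGroup x.
have ufix x : f x = x -> u (sigma x) = 0.
  move=> fx; apply/eqP/negPn/negP=> ux.
  have fsx : commute f (sigma x).
    by apply/commute_sym/commgP/conjg_fixP; rewrite -sigma_fixed // -/f fx.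
  move/eqP: z0; apply; apply: (fixed_central0 irrX zF) => y.
  pose t := u (sigma y) / u (sigma x).
  rewrite -[sigma y](mulKVg (sigma x ^+ t)%g).
  apply: commuteM; first exact: commuteX.
  apply: kernelC => //; apply: kernel_quo; rewrite ?groupX ?sG //.
  by rewrite (homX uM) ?sG // -mulr_natr natr_Fp_val mulrC divfK.
have uk x : u (sigma (k x)) = u (sigma x).
  have [fx|fx] := eqVneq (f x) x.
    by rewrite !ufix // kCx // fx.
  have [j ->] := kernel_kx Kf fx.
  rewrite -val_fixedMn // sigma_fixed ?conjgE; last exact: braceFixedMn.
  have vG : val (z *+ j) \in G by apply: val_permGroup.
  by rewrite !uM ?groupM ?groupV ?sG // (homV uM) // addrCA addNr addr0.
apply: sigma_not_const; apply: (hom_sigma_const p_pr pG uM) => // n nG x un.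
have Kn : K n by rewrite /K nG un eqxx.
have [i ->] := kernel_act x Kn.
by elim: (nat_of_ord i) => [|t IHt]; rewrite ?perm1 // expgSr permM uk.
Qed.

(** A nonzero fixed element is rescaled to get [u] equal to 1. Its p-th multiple is fixed and in the
    kernel, hence 0. *)
Lemma exists_translation : exists z, [/\ braceFixed z, u (val z) = 1 & z *+ p = 0].
Proof.
have pT : [acts G, on [set: brace X] | lamAction X]%g.
  by apply/subsetP=> g gG; rewrite !inE gG; apply/subsetP=> a; rewrite !inE.
have [k' [_ _ d2]] := exists_central p_pr pG cX trX.
have dT : (p %| #|[set: brace X]|)%N.
  by rewrite cardsT card_brace (dvdn_trans _ d2) // dvdn_exp.
have [z [_ z0 zF]] := exists_fixed p_pr pG pT (in_setT 0) dT.
have zG : val z \in G by apply: val_permGroup.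
have uz := fixed_notin_kernel zF z0.
have uX c : u (val (z *+ c)) = u (val z) *+ c by rewrite val_fixedMn // (homX uM).
exists (z *+ ((u (val z))^-1 : 'F_p)%R); split; first exact: braceFixedMn.
  by rewrite uX -mulr_natr natr_Fp_val divff.
have zp : z *+ p = 0.
  apply/eqP/negPn/negP=> /(fixed_notin_kernel (braceFixedMn p zF)).
  by rewrite uX -mulr_natr pchar_Fp_0 // mulr0 eqxx.
by rewrite mulrnAC zp mul0rn.
Qed.

(** * Coordinates built from a fixed translation *)

Section Translation.
Variable z : brace X.
Hypothesis zF : braceFixed z.
Hypothesis uz : u (val z) = 1.
Hypothesis zp : z *+ p = 0.
Let f := val z.

Lemma translation_exp1 : (f ^+ p = 1)%g.
Proof. by rewrite /f -val_fixedMn // zp val_brace0. Qed.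

Lemma sigma_translation x c : sigma ((f ^+ c)%g x) = (sigma x ^ (f ^+ c))%g.
Proof. by rewrite -val_fixedMn // sigma_fixed //; apply: braceFixedMn. Qed.

Lemma u_translation x c : u (sigma ((f ^+ c)%g x)) = u (sigma x).
Proof.
rewrite sigma_translation conjgE !uM ?groupM ?groupV ?groupX ?sigma_permGroup ?val_permGroup //.
by rewrite (homV uM) ?groupX ?val_permGroup // addrCA addNr addr0.
Qed.

Lemma translation_nz : z != 0.
Proof.
apply/eqP=> z0; have := uz; rewrite z0 val_brace0 (hom1 uM) => /eqP.
by rewrite eq_sym oner_eq0.
Qed.

Lemma mulrn_Fp_inj c d : z *+ (c : 'F_p)%R = z *+ (d : 'F_p)%R -> c = d.
Proof.
move=> e; have := congr1 (fun a => u (val a)) e.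
have fG : f \in G by apply: val_permGroup.
by rewrite !val_fixedMn // !(homX uM) // uz !natr_Fp_val.
Qed.

Lemma block_transitive x y : exists a i : 'F_p, y = (k ^+ i)%g ((f ^+ a)%g x).
Proof.
have [g gG <-] := indecomposableP trX x y.
have fG : f \in G by apply: val_permGroup.
have Kn : K ((f ^+ u g)^-1 * g)%g.
  by apply: kernel_quo; rewrite ?groupX // (homX uM) // uz natr_Fp_val.
have [i e] := kernel_act ((f ^+ u g)%g x) Kn.
by exists (u g), i; rewrite -e permM permK.
Qed.

(** The number of cosets of the line [Z] of [z] that [G] fixes is divisible by p, and [Z] is one, so
    another exists. A multiple of [z] is added to its representative to reach the kernel. *)
Lemma exists_second_translation : exists y : brace X,
  [/\ K (val y), (forall g, g \in G -> exists c : 'F_p, lam g y = y + z *+ c)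
    & forall c, y != z *+ c].
Proof.
pose gA : finGroupType := (brace X : finZmodType).
pose Z : {group gA} := <[z : gA]>%G.
pose S : {set {set gA}} := rcosets Z [set: gA].
have memZ (a : gA) : reflect (exists c : 'F_p, a = z *+ c) (a \in Z).
  apply: (iffP idP) => [/cycleP[c ->]|[c ->]]; last first.
    by rewrite -FinRing.zmodXgE mem_cycle.
  by exists c%:R; rewrite mulrn_Fp_nat // FinRing.zmodXgE.
have memC (a b : gA) : reflect (exists c : 'F_p, b = a + z *+ c) (b \in (Z :* a)%g).
  rewrite mem_rcoset FinRing.zmodMgE FinRing.zmodVgE; apply: (iffP (memZ _)) => [[c e]|[c ->]]; exists c.
    by rewrite -e addrC subrK.
  by rewrite addrAC subrr add0r.
have oZ : #|Z| = p.
  have dZ : (#|Z| %| p)%N by rewrite -orderE order_dvdn FinRing.zmodXgE zp.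
  have [_ pP] := primeP p_pr; case/orP: (pP _ dZ) => /eqP // Z1.
  by case/negP: translation_nz; rewrite -[z == 0]/((z : gA) == 1%g) -order_eq1 orderE Z1.
have oS : (p %| #|S|)%N.
  have [k' [_ _ d2]] := exists_central p_pr pG cX trX.
  have e : (#|Z| * #|S| = #|G|)%N by rewrite Lagrange ?subsetT // cardsT -card_brace.
  by rewrite -(dvdn_pmul2l (prime_gt0 p_pr)) -[in X in (_ %| X)%N]oZ e mulnn.
pose to := lamAction X.
have toC (a : gA) g : g \in G -> (to^*)%act (Z :* a)%g g = (Z :* (lam g a : gA))%g.
  move=> gG; apply/setP=> b; apply/imsetP/memC => [[c /memC[i ->] ->]|[i ->]].
    by exists i; rewrite /= lamD lamMn zF.
  exists (a + z *+ i); first by apply/memC; exists i.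
  by rewrite /= lamD lamMn zF.
have actS : [acts G, on S | to^*]%g.
  apply/subsetP=> g gG; rewrite !inE gG; apply/subsetP=> _ /rcosetsP[a _ ->].
  by rewrite inE toC //; apply/rcosetsP; exists (lam g a).
have := pgroup_fix_mod pG actS; rewrite (eqP oS) => /esym/eqP; rewrite -/(dvdn _ _) => dF.
have fixZ : (Z : {set gA}) \in 'Fix_(S | to^*)(G)%g.
  rewrite inE; apply/andP; split.
    by apply/rcosetsP; exists 0; rewrite // mulg1.
  by apply/afixP=> g gG; rewrite -[Z : {set gA}]mulg1 toC // lam0.
have : (1 < #|'Fix_(S | to^*)(G)%g|)%N.
  by apply: leq_trans (prime_gt1 p_pr) (dvdn_leq _ dF); apply/card_gt0P; exists (Z : {set gA}).
rewrite (cardD1 (Z : {set gA})) fixZ => /card_gt0P[C] /andP[CZ /setIP[/rcosetsP[a _ Ca] /afixP CF]].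
have aZ c : a != z *+ c.
  apply: contraNneq CZ => ac; rewrite Ca; apply/eqP/rcoset_id.
  by rewrite ac -FinRing.zmodXgE mem_cycle.
have aF g : g \in G -> exists c : 'F_p, lam g a = a + z *+ c.
  by move=> gG; apply/memC; rewrite -Ca -(CF g gG) Ca toC // rcoset_refl.
have aG : val a \in G by apply: val_permGroup.
have fG : f \in G by apply: val_permGroup.
pose c := - u (val a).
exists (a + z *+ c); split=> [|g gG|d].
- rewrite val_fixedD; last exact: braceFixedMn.
  rewrite val_fixedMn // /K groupM ?groupX // andTb uM ?groupX // (homX uM) // uz.
  by rewrite natr_Fp_val subrr.
- have [d e] := aF g gG; exists d.
  by rewrite lamD lamMn zF // e addrAC.
apply: contraNneq (aZ (d%:R - c : 'F_p)%R) => e.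
rewrite mulrn_FpD // mulrn_Fp_nat // -e -addrA -mulrn_FpD // subrr.
by rewrite mulr0n addr0.
Qed.

(** The coefficient [theta g] of [z] in [lam g y - y] is a homomorphism. It takes one nonzero value
    [c] on all [sigma x], and [h = val y] is a power of [k], so that [sigma (h x)] is [sigma x]
    times [f ^ c]. *)
Lemma exists_block_translation : exists e : 'F_p,
  e != 0 /\ forall x, sigma ((k ^+ e)%g x) = (sigma x * f)%g.
Proof.
have [y [Kh yG y'z]] := exists_second_translation.
have [theta thetaP] : exists theta : {perm X} -> 'F_p,
    forall g, g \in G -> lam g y = y + z *+ theta g.
  apply: (fin_all_exists (P := fun g c => g \in G -> lam g y = y + z *+ (c : 'F_p))) => g.
  by have [/yG[c e]|] := boolP (g \in G); [exists c | exists 0].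
set h := val y in Kh *; have [hG uh] := kernelP Kh.
have sG x := sigma_permGroup x; have fG : f \in G by apply: val_permGroup.
have thetaM : {in G &, {morph theta : g g' / (g * g')%g >-> g + g'}}.
  move=> g g' gG g'G; apply: mulrn_Fp_inj; apply: (addrI y).
  rewrite -thetaP ?groupM // lamM // thetaP // lamD lamMn zF // thetaP //.
  by rewrite mulrn_FpD // addrAC -addrA.
have thetaJ g g' : g \in G -> g' \in G -> theta (g ^ g')%g = theta g.
  move=> gG g'G; rewrite conjgE !thetaM ?groupM ?groupV // (homV thetaM) //.
  by rewrite addrCA addNr addr0.
(* This is [y + elt x = elt x + y] read in the group. *)
have sh x : sigma (h x) = (sigma x ^ h * f ^+ theta (sigma x))%g.
  have := val_braceD (elt x) y; rewrite addrC val_braceD lam_elt //= thetaP // -/h.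
  rewrite val_fixedD; last exact: braceFixedMn.
  by rewrite val_fixedMn // -/h => e; rewrite conjgE -!mulgA -e mulKg.
have thetah x : theta (sigma (h x)) = theta (sigma x) * (1 + theta f).
  rewrite sh thetaM ?groupJ ?groupX // thetaJ // (homX thetaM) //.
  by rewrite -mulr_natr natr_Fp_val mulrDr mulr1 mulrC.
(* Otherwise [y] would be a nonzero fixed element in the kernel. *)
have [x0 tx0] : exists x0, theta (sigma x0) != 0.
  case: (pickP (fun x => theta (sigma x) != 0)) => [x0 tx0|none]; first by exists x0.
  have yF : braceFixed y.
    by apply: braceFixed_gen => x; rewrite thetaP // (eqP (negbFE (none x))) mulr0n addr0.
  have y0 : y != 0 by have := y'z 0; rewrite mulr0n.
  by have := fixed_notin_kernel yF y0; rewrite -/h uh eqxx.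
(* As [h ^ p = 1], iterating [thetah] p times from [x0] gives [(1 + theta f) ^ p = 1], that is
   [1 + theta f = 1] in ['F_p]. *)
have thetaf : theta f = 0.
  have thetahX t : theta (sigma ((h ^+ t)%g x0)) = theta (sigma x0) * (1 + theta f) ^+ t.
    elim: t => [|t IHt]; first by rewrite perm1 mulr1.
    by rewrite expgSr permM thetah IHt exprSr mulrA.
  have := thetahX p; rewrite kernel_exp1 // perm1 -[X in _ ^+ X]expn1 Fp_pow //.
  rewrite -{1}[theta (sigma x0)]mulr1 => /(mulfI tx0)/eqP.
  by rewrite -subr_eq0 opprD addrA subrr add0r oppr_eq0 => /eqP.
have {}thetah x : theta (sigma (h x)) = theta (sigma x) by rewrite thetah thetaf addr0 mulr1.
have thetahX t x : theta (sigma ((h ^+ t)%g x)) = theta (sigma x).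
  by elim: t => [|t IHt]; rewrite ?perm1 // expgSr permM thetah.
have uh_theta x : u (sigma (h x)) = u (sigma x) + theta (sigma x).
  rewrite sh uM ?groupJ ?groupX // (homX uM) // uz natr_Fp_val conjgE.
  by rewrite !uM ?groupM ?groupV // (homV uM) // addrCA addNr addr0.
have theta_hfix x : h x = x -> theta (sigma x) = 0.
  by move=> hx; have := uh_theta x; rewrite hx -{1}[u _]addr0 => /addrI.
have thetak x : theta (sigma (k x)) = theta (sigma x).
  have [hx|hx] := eqVneq (h x) x.
    by rewrite !theta_hfix // kCx // hx.
  by have [j ->] := kernel_kx Kh hx.
have thetac x : theta (sigma x) = theta (sigma x0).
  have [a [i ->]] := block_transitive x0 x.
  have kX t x' : theta (sigma ((k ^+ t)%g x')) = theta (sigma x').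
    by elim: t => [|t IHt]; rewrite ?perm1 // expgSr permM thetak.
  by rewrite kX sigma_translation thetaJ ?groupX.
set c := theta (sigma x0) in tx0 thetac.
have uhX t x : u (sigma ((h ^+ t)%g x)) = u (sigma x) + c * t%:R.
  elim: t => [|t IHt]; first by rewrite perm1 mulr0 addr0.
  by rewrite expgSr permM uh_theta IHt thetac -addrA mulrSr mulrDr mulr1.
have [i0 hx0] := kernel_act x0 Kh.
have uk x i : h x = (k ^+ i)%g x -> u (sigma (k x)) = u (sigma x) + c / i.
  move=> hx; have i_nz : i != 0.
    apply: contraNneq tx0 => i_0; rewrite -(thetac x) theta_hfix //.
    by rewrite hx i_0 perm1.
  have -> : k x = (h ^+ (i^-1)%R)%g x.
    by rewrite (kernel_expE _ Kh hx) divff // -[1]/(1%:R) expg_Fp_nat ?kp.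
  by rewrite uhX natr_Fp_val.
have i0_nz : i0 != 0.
  by apply: contraNneq tx0 => i_0; rewrite /c theta_hfix // hx0 i_0 perm1.
(* The exponent of [h] on a block is determined by the jump of [u (sigma x)] under [k], and [f]
   carries this jump unchanged to every block. *)
have hE : h = (k ^+ i0)%g.
  apply/permP=> x; have [a [i ->]] := block_transitive x0 x.
  rewrite kXCx // [RHS]kXCx ?groupX ?kG //; congr ((k ^+ i)%g _).
  have [j hj] := kernel_act ((f ^+ a)%g x0) Kh.
  suff <- : j = i0 by [].
  apply: invr_inj; apply: (mulfI tx0); apply: (addrI (u (sigma x0))).
  rewrite -(uk _ _ hx0) -(u_translation x0 a) -(uk _ _ hj).
  by rewrite -kCx ?groupX // u_translation.
(* [k ^ (i0 / c)] is the power of [h] of exponent 1 / c, and each application of [h] contributes a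
   factor [f ^ c]. *)
exists (i0 / c); split; first by rewrite mulf_neq0 ?invr_eq0.
move=> x; rewrite expg_FpM ?kp // -hE.
have shX t x' : sigma ((h ^+ t)%g x') = (sigma x' * f ^+ (c * t%:R)%R)%g.
  elim: t => [|t IHt]; first by rewrite perm1 mulr0 mulg1.
  rewrite expgSr permM sh thetac IHt mulrSr mulrDr mulr1 expg_FpD ?translation_exp1 //.
  rewrite mulgA; congr (_ * _)%g; apply/conjg_fixP/commgP/commute_sym.
  by rewrite hE; apply/commute_sym/kXC; rewrite groupM ?groupX.
by rewrite shX natr_Fp_val divff // -[1]/(1%:R) expg_Fp_nat ?translation_exp1.
Qed.

Lemma translation_coords : exists (r : 'F_p * 'F_p -> X) (Phi : 'F_p -> 'F_p),
  bijective r /\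
  forall a c b d : 'F_p, cs_op (r (a, c)) (r (b, d)) = r (b + c, d + Phi (b - a)).
Proof.
have [e [e0 skE]] := exists_block_translation.
have [x1 _] : exists x : X, x \in X by apply/card_gt0P; rewrite cX expn_gt0 prime_gt0.
have fG : f \in G by apply: val_permGroup.
have sG x := sigma_permGroup x.
pose k' : {perm X} := (k ^+ e)%g.
have k'p : (k' ^+ p = 1)%g by rewrite expgAC kp expg1n.
have sk'X x t : sigma ((k' ^+ t)%g x) = (sigma x * f ^+ t)%g.
  elim: t => [|t IHt]; first by rewrite perm1 mulg1.
  by rewrite expgSr permM skE IHt expgSr mulgA.
have k'C g t x : g \in G -> g ((k' ^+ t)%g x) = (k' ^+ t)%g (g x).
  by move=> gG; rewrite -!permM; congr (fun_of_perm _ x); apply/esym; apply: commuteX; apply: kXC.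
have kk' i : (k ^+ i = k' ^+ (i / e)%R)%g by rewrite -expg_FpM ?kp // mulrC divfK.
(* The origin is chosen so that [sigma o] preserves every block; [Phi t] is the amount by which it
   then moves the point [f ^ t o] inside its block. *)
pose o := (k' ^+ (- u (sigma x1))%R)%g x1.
have uo : u (sigma o) = 0.
  by rewrite sk'X uM ?groupX // (homX uM) // uz natr_Fp_val subrr.
have Ko : K (sigma o) by rewrite /K sG uo eqxx.
have [Phi PhiP] : exists Phi : 'F_p -> 'F_p,
    forall t : 'F_p, sigma o ((f ^+ t)%g o) = (k' ^+ Phi t)%g ((f ^+ t)%g o).
  apply: (fin_all_exists (P := fun (t c : 'F_p) =>
    sigma o ((f ^+ t)%g o) = (k' ^+ c)%g ((f ^+ t)%g o))) => t.
  by have [i ->] := kernel_act ((f ^+ t)%g o) Ko; exists (i / e); rewrite kk'.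
pose r (q : 'F_p * 'F_p) := (f ^+ q.1)%g ((k' ^+ q.2)%g o).
exists r, Phi; split=> [|a c b d].
  have [inv invK] : exists inv, forall y, r (inv y) = y.
    apply: (fin_all_exists (P := fun y q => r q = y)) => y.
    have [a [i ->]] := block_transitive o y.
    by exists (a, i / e); rewrite /r /= k'C ?groupX // kk'.
  have inv_inj : injective inv := can_inj invK.
  have /(inj_card_bij inv_inj) inv_bij : (#|{: 'F_p * 'F_p}| <= #|X|)%N.
    by rewrite card_prod card_Fp // cX.
  exact: (bij_can_bij inv_bij (invK : cancel inv r)).
have rE a' c' : r (a', c') = (f ^+ a')%g ((k' ^+ c')%g o) by [].
have fk t s w : (f ^+ t)%g ((k' ^+ s)%g w) = (k' ^+ s)%g ((f ^+ t)%g w).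
  by rewrite k'C ?groupX.
rewrite -sigmaE !rE sigma_translation sk'X conjgE !permM.
have -> : (f ^+ b = f ^+ (b - a)%R * f ^+ a)%g.
  by rewrite -expg_FpD ?translation_exp1 // subrK.
rewrite permM permK fk k'C ?sG // PhiP !fk.
have -> : b + c = b - a + c + a by rewrite addrAC subrK.
by rewrite [d + _]addrC !expg_FpD ?translation_exp1 // !permM.
Qed.

End Translation.
End Blocks.

Theorem pgroup_coords (p : nat) (X : cycleSet) :
  prime p -> (p.-group (permGroup X))%g -> #|X| = (p ^ 2)%N ->
  indecomposable X -> irretractable X ->
  exists (r : 'F_p * 'F_p -> X) (Phi : 'F_p -> 'F_p), bijective r /\
  forall a x b y, cs_op (r (a, x)) (r (b, y)) = r (b + x, y + Phi (b - a))%R.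
Proof.
move=> p_pr pG cX trX irrX.
have [k [kZ ok _]] := exists_central p_pr pG cX trX.
have [u [uM uP]] := block_hom p_pr pG cX trX kZ ok.
have [z [zF uz zp]] := exists_translation p_pr pG cX trX irrX kZ ok uM uP.
exact: (translation_coords p_pr pG cX trX irrX kZ ok uM uP zF uz zp).
Qed.

(* All orbits of a normal subgroup of a transitive group have the same size. *)
Lemma normalized_p'group_fix (gT : finGroupType) (D : {group gT}) (rT : finType)
    (to : action D rT) (P Q : {group gT}) (S : {set rT}) (p k : nat) :
  prime p -> #|S| = (p ^ k)%N -> (p^'.-group Q)%g -> P \subset D -> Q \subset D ->
  P \subset ('N(Q))%g -> [transitive P, on S | to]%g -> [acts Q, on S | to]%g ->
  forall q x, q \in Q -> x \in S -> to x q = x.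
Proof.
move=> p_pr cS pQ sPD sQD nQP trP actQ q x qQ xS.
have PD := subsetP sPD; have QD := subsetP sQD.
pose d := #|orbit to Q x|.
have cardT y : y \in S -> #|orbit to Q y| = d.
  case/(atransP2in sPD trP xS)=> g gP ->.
  have -> : orbit to Q (to x g) = (fun z => to z g) @: orbit to Q x.
    apply/setP=> z; apply/imsetP/imsetP=> [[h hQ ->]|[_ /imsetP[h hQ ->] ->]].
      have hQ' : (h ^ g^-1)%g \in Q by rewrite memJ_norm // groupV (subsetP nQP).
      exists (to x (h ^ g^-1)%g); first exact: imset_f.
      by rewrite -!actMin ?(PD g gP) ?(QD _ hQ) ?(QD _ hQ') // (conjgC (h ^ g^-1)%g g) conjgKV.
    exists (h ^ g)%g; first by rewrite memJ_norm // (subsetP nQP).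
    have hgD : (h ^ g)%g \in D by rewrite groupJ ?(PD g gP) ?(QD _ hQ).
    by rewrite -!actMin ?(PD g gP) ?(QD _ hQ) // conjgC.
  by apply: card_imset; apply: act_inj.
have dS : d %| #|S|.
  rewrite -(acts_sum_card_orbit actQ).
  rewrite (eq_bigr (fun=> d)) => [|_ /imsetP[y yS ->]]; last exact: cardT.
  by rewrite sum_nat_const dvdn_mull.
have dQ : d %| #|Q| by rewrite -(card_orbit_in_stab to x sQD) dvdn_mulr.
have /eqP d1 : d == 1%N.
  have cop : coprime (p ^ k) #|Q|.
    by apply: (@pnat_coprime p) => //; rewrite pnatX pnat_id.
  by rewrite -dvdn1 -(eqnP cop) dvdn_gcd -cS dS.
have xq : to x q \in orbit to Q x by apply: imset_f.
have xx : x \in orbit to Q x by apply/imsetP; exists 1%g; rewrite ?act1.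
by apply: (card_le1_eqP (A := orbit to Q x)) => //; rewrite -/d d1.
Qed.

(** * Cabling *)

Section Primary.
Variables (V : finZmodType) (p : nat).
Local Open Scope ring_scope.

Lemma mulrn_card (a : V) : a *+ #|{: V}| = 0.
Proof.
by have := expg_cardG (in_setT (a : (V : finGroupType))); rewrite cardsT.
Qed.

Lemma mulrn_eqmod (a : V) n m : n = m %[mod #|{: V}|] -> a *+ n = a *+ m.
Proof.
have modE k : a *+ k = a *+ (k %% #|{: V}|).
  by rewrite {1}(divn_eq k #|{: V}|) mulrnDr mulnC mulrnA mulrn_card mul0rn add0r.
by move=> e; rewrite modE e -modE.
Qed.

(** Being 1 modulo the p-part of the order and 0 modulo the p'-part, this multiplier is the
    projection onto the p-primary component. *)
Definition primaryExp := chinese #|{: V}|`_p #|{: V}|`_p^' 1 0.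
Notation m := primaryExp.

Let cop : coprime #|{: V}|`_p #|{: V}|`_p^' := coprime_partC p _ _.
Let V_gt0 : (0 < #|{: V}|)%N. Proof. by apply/card_gt0P; exists 0. Qed.
Let VE : (#|{: V}|`_p * #|{: V}|`_p^')%N = #|{: V}|. Proof. exact: partnC. Qed.

Lemma primary_pprimary (a : V) : a *+ m *+ #|{: V}|`_p = 0.
Proof.
have d : (#|{: V}|`_p^' %| m)%N by rewrite /dvdn chinese_modr // mod0n.
by rewrite -mulrnA -(divnK d) -mulnA [(_`_p^' * _)%N]mulnC VE mulnC mulrnA mulrn_card mul0rn.
Qed.

Lemma primary_id (a : V) : a *+ #|{: V}|`_p = 0 -> a *+ m = a.
Proof.
move=> a0; have modE k : a *+ k = a *+ (k %% #|{: V}|`_p).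
  by rewrite {1}(divn_eq k #|{: V}|`_p) mulrnDr mulnC mulrnA a0 mul0rn add0r.
by rewrite modE chinese_modl // -modE.
Qed.

Lemma primary_compl (a : V) : (a - a *+ m) *+ #|{: V}|`_p^' = 0.
Proof.
have e : (1 * #|{: V}|`_p^' = m * #|{: V}|`_p^' %[mod #|{: V}|`_p * #|{: V}|`_p^'])%N.
  by rewrite -!muln_modl chinese_modl.
rewrite VE mul1n in e.
by rewrite mulrnBl -mulrnA (mulrn_eqmod a e) subrr.
Qed.

Lemma primary_eq0 (a : V) : a *+ #|{: V}|`_p^' = 0 -> a *+ m = 0.
Proof.
move=> a0; have d : (#|{: V}|`_p^' %| m)%N by rewrite /dvdn chinese_modr // mod0n.
by rewrite -(divnK d) mulnC mulrnA a0 mul0rn.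
Qed.

(** By Cauchy one torsion subgroup is a p-group and the other a p'-group; every [a] splits as
    [a *+ m] plus the rest, so their orders multiply to that of [V]. *)
Lemma card_primary : prime p ->
  #|[set a : V | a *+ #|{: V}|`_p == 0]| = (#|{: V}|`_p)%N /\
  #|[set a : V | a *+ #|{: V}|`_p^' == 0]| = (#|{: V}|`_p^')%N.
Proof.
move=> p_pr; pose gV : finGroupType := V.
pose T n : {set gV} := [set a : V | a *+ n == 0].
have gT n : group_set (T n).
  apply/group_setP; split=> [|a b]; rewrite !inE ?mul0rn // FinRing.zmodMgE mulrnDl.
  by move=> /eqP-> /eqP->; rewrite addr0.
have piT pi n : (pi.-nat n)%N -> (pi.-group (T n))%g.
  move=> pin; apply/(@pgroupP _ _ (Group (gT n))) => q q_pr /(Cauchy q_pr)[a aT oa].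
  move: aT; rewrite inE => an.
  have : (#[a : gV]%g %| n)%N by rewrite order_dvdn FinRing.zmodXgE.
  by rewrite oa => qn; apply: (pnatPpi pin); rewrite mem_primes q_pr qn andbT; case/andP: pin.
pose A := Group (gT (#|{: V}|`_p)%N); pose B := Group (gT (#|{: V}|`_p^')%N).
have pA : (p.-nat #|A|)%N by apply/piT/part_pnat.
have pB : (p^'.-nat #|B|)%N by apply/piT/part_pnat.
have AB : (#|A| * #|B| = #|{: V}|)%N.
  rewrite -cardsT -TI_cardMg.
    apply/eq_card=> a; rewrite inE; apply/mulsgP.
    exists (a *+ m) (a - a *+ m); rewrite ?inE ?primary_pprimary ?primary_compl ?eqxx //.
    by rewrite FinRing.zmodMgE addrC subrK.
  by apply: coprime_TIg; apply: (pnat_coprime pA).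
have eA : ((#|A| * #|B|)`_p = #|A|)%N.
  by rewrite partnM ?cardG_gt0 // (part_pnat_id pA) (part_p'nat pB) muln1.
have eB : ((#|A| * #|B|)`_p^' = #|B|)%N.
  rewrite partnM ?cardG_gt0 // (part_pnat_id pB) (part_p'nat (pi := p^')) ?mul1n //.
  by rewrite pnatNK.
by rewrite AB in eA eB; split; [apply: esym eA | apply: esym eB].
Qed.

End Primary.

Section Cabling.
Variables (X : cycleSet) (m : nat).
Implicit Types (x y z : X).
Local Open Scope ring_scope.

Definition cablingOp x y := val (elt x *+ m) y.

Fact cabling_law x y z :
  cablingOp (cablingOp x y) (cablingOp x z) = cablingOp (cablingOp y x) (cablingOp y z).
Proof.
have op u v w : cablingOp (cablingOp u v) (cablingOp u w) = val (elt u *+ m + elt v *+ m) w.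
  by rewrite val_braceD lamMn lam_elt ?val_permGroup // permM.
by rewrite !op addrC.
Qed.

Fact cabling_bij x : bijective (cablingOp x).
Proof. by exists (val (elt x *+ m))^-1%g; [apply: permK | apply: permKV]. Qed.

(** The square map of the cabling is the [m]-th iterate of that of [X]. *)
Fact cabling_sq_bij : bijective (fun x => cablingOp x x).
Proof.
have opE t x : val (elt x *+ t) x = iter t (fun y => cs_op y y) x.
  elim: t => [|t IHt]; first by rewrite val_brace0 perm1.
  by rewrite mulrSr val_braceD lam_elt ?val_permGroup // permM IHt /= sigmaE.
apply: (eq_bij (f := iter m (fun y : X => cs_op y y))) => [|x].
  elim: (m) => [|t IHt]; first by exists id.
  exact: (bij_comp (cs_sq_bij X) IHt).
by rewrite /cablingOp opE.
Qed.

Definition cabling := CycleSet cabling_law cabling_bij cabling_sq_bij.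

Lemma sigma_cabling x : sigma (x : cabling) = val (elt x *+ m).
Proof. by apply/permP=> y; rewrite sigmaE. Qed.

Lemma wordPerm_cabling (s : seq cabling) :
  wordPerm s = val ((\sum_(x <- s) elt (x : X)) *+ m).
Proof.
elim/last_ind: s => [|s x IHs]; first by rewrite big_nil mul0rn val_brace0.
rewrite -cats1 wordPerm_cat IHs big_cat big_seq1 /= mulrnDl val_braceD; congr (_ * _)%g.
by rewrite wordPerm_cons mulg1 sigma_cabling lamMn lam_elt ?val_permGroup.
Qed.

Lemma mem_cabling_permGroup g :
  reflect (exists a : brace X, g = val (a *+ m)) (g \in permGroup cabling).
Proof.
apply: (iffP idP) => [/permGroup_wordPerm[s /eqP<-]|[a ->]].
  by eexists; apply: wordPerm_cabling.
have [s ->] := brace_sum a.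
by rewrite -wordPerm_cabling; apply: wordPerm_permGroup.
Qed.

End Cabling.

(** * The p-primary cabling and the p'-subgroup *)

Section PrimaryCabling.
Variables (p : nat) (X : cycleSet).
Hypothesis p_pr : prime p.
Hypothesis cX : #|X| = (p ^ 2)%N.
Hypothesis trX : indecomposable X.
Hypothesis irrX : irretractable X.
Notation G := (permGroup X).
Notation m := (primaryExp (brace X) p).
Notation Y := (cabling X m).
Notation P := (permGroup Y).
Implicit Types (x y z : X) (a b : brace X) (g h q n : {perm X}).
Local Open Scope ring_scope.

Let cardA : #|{: (brace X : finZmodType)}| = #|G|.
Proof. exact: card_brace. Qed.

Definition p'primary a := a *+ (#|{: (brace X : finZmodType)}|`_p^')%N == 0.

Lemma p'primaryP a : reflect (a *+ m = 0) (p'primary a).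
Proof.
apply: (iffP eqP) => [/primary_eq0 //|am].
by have := primary_compl p a; rewrite am subr0.
Qed.

Lemma p'primary_lam g a : p'primary (lam g a) = p'primary a.
Proof.
have [gG|/lam_notin -> //] := boolP (g \in G).
by rewrite /p'primary -lamMn -{1}(lam0 g) (inj_eq (can_inj (lamK gG))).
Qed.

Lemma p'primary_compl a : p'primary (a - a *+ m).
Proof. by apply/eqP/primary_compl. Qed.

Lemma sub_cabling_permGroup : P \subset G.
Proof. by apply/subsetP=> g /mem_cabling_permGroup[a ->]; apply: val_permGroup. Qed.

Lemma card_cabling_permGroup : #|P| = (#|G|`_p)%N.
Proof.
rewrite -cardA -(card_primary (brace X) p_pr).1.
rewrite -(card_imset _ (val_inj : injective (val : brace X -> _))).
apply: eq_card => g; apply/mem_cabling_permGroup/imsetP => [[a ->]|[a]].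
  by exists (a *+ m) => //; rewrite inE primary_pprimary.
by rewrite inE => /eqP/primary_id am ->; exists a; rewrite am.
Qed.

Lemma pgroup_cabling : (p.-group P)%g.
Proof. by rewrite /pgroup card_cabling_permGroup part_pnat. Qed.

(** The order of [P] is the full p-part of that of [G], and a point stabilizer in [P] is at most the
    p-part of one in [G]; so an orbit of [P] has at least [p ^ 2] points. *)
Lemma indecomposable_cabling : indecomposable Y.
Proof.
have [o _] : exists x : X, x \in X by apply/card_gt0P; rewrite cX expn_gt0 prime_gt0.
apply/imsetP; exists o => //; apply/esym/eqP; rewrite eqEcard subsetT /= cardsT.
have cG := card_orbit_stab 'P G o; have cP := card_orbit_stab 'P P o.
have oG : #|orbit 'P G o| = #|X| by rewrite (atransP trX) ?inE // cardsT.
have dS : (#|'C_P[o | 'P]%g| %| #|'C_G[o | 'P]%g|`_p)%N.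
  rewrite -[X in (X %| _)%N](part_pnat_id (pi := p)); last first.
    exact: pgroupS (subsetIl _ _) pgroup_cabling.
  by apply: partn_dvd; rewrite ?cardG_gt0 // cardSg // setSI // sub_cabling_permGroup.
have := dvdn_leq _ dS; rewrite part_gt0 => /(_ isT) leS.
rewrite -(leq_pmul2r (cardG_gt0 'C_P[o | 'P]%G)) cP card_cabling_permGroup -cG oG.
rewrite partnM ?cardG_gt0 // ?cX ?expn_gt0 ?prime_gt0 // part_pnat_id ?pnatX ?pnat_id //.
by rewrite leq_mul2l leS orbT.
Qed.

Lemma cabling_transitive x y : exists2 g : {perm X}, g \in P & g x = y.
Proof. exact: indecomposableP indecomposable_cabling x y. Qed.

Fact hallGroup_set : group_set [set val a | a : brace X & p'primary a].
Proof.
apply/group_setP; split=> [|g h].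
  apply/imsetP; exists (0 : brace X); last by rewrite val_brace0.
  by rewrite inE; apply/eqP/mul0rn.
case/imsetP=> a; rewrite inE => pa -> /imsetP[b]; rewrite inE => pb ->.
apply/imsetP; exists ((a : brace X) + lam (val a)^-1%g b).
  rewrite inE /p'primary mulrnDl (eqP pa) add0r.
  by rewrite -[_ == 0]/(p'primary _) p'primary_lam.
by rewrite val_braceD lamKV ?val_permGroup.
Qed.

Definition hallGroup := Group hallGroup_set.
Notation Q := hallGroup.

Lemma hallGroupP q : reflect (exists2 a, p'primary a & q = val a) (q \in Q).
Proof.
by apply: (iffP imsetP) => [[a]|[a pa ->]]; [rewrite inE => pa ->|]; exists a; rewrite ?inE.
Qed.

Lemma sub_hallGroup : Q \subset G.
Proof. by apply/subsetP=> q /hallGroupP[a _ ->]; apply: val_permGroup. Qed.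

Lemma card_hallGroup : #|Q| = (#|G|`_p^')%N.
Proof.
rewrite -cardA -(card_primary (brace X) p_pr).2.
rewrite -(card_imset _ (val_inj : injective (val : brace X -> _))).
apply: eq_card => g; apply/hallGroupP/imsetP => [[a pa ->]|[a]].
  by exists a; rewrite ?inE.
by rewrite inE => pa ->; exists a.
Qed.

Lemma p'group_hallGroup : (p^'.-group Q)%g.
Proof. by rewrite /pgroup card_hallGroup part_pnat. Qed.

(** For [q = val a], [a + b = b + a] says that the conjugate of [q] by [val b] is
    [val (lam (val b) a)]. *)
Lemma hallGroup_fix_norm b : (forall q, q \in Q -> lam q b = b) -> (val b \in 'N(Q))%g.
Proof.
move=> fb; rewrite inE; apply/subsetP=> _ /imsetP[q qQ ->].
have [a pa qa] := hallGroupP _ qQ.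
apply/hallGroupP; exists (lam (val b) a); first by rewrite p'primary_lam.
have := val_braceD a b; rewrite addrC val_braceD -qa fb // => e.
by rewrite conjgE -e mulKg.
Qed.

(** [P] is transitive on [p ^ 2] points, so a p'-group that it normalizes acts trivially; hence the
    p'-part [a - a *+ m] is 0. *)
Lemma hallGroup_trivial : (P \subset 'N(Q))%g -> forall a, a *+ m = a.
Proof.
move=> nQP; have Q1 q : q \in Q -> q = 1%g.
  move=> qQ; apply/permP=> x; rewrite perm1.
  have actQ : [acts Q, on [set: X] | 'P]%g by apply/actsP=> h _ y; rewrite !inE.
  by have := normalized_p'group_fix p_pr (etrans (cardsT X) cX) p'group_hallGroup
    (subsetT _) (subsetT _) nQP indecomposable_cabling actQ qQ (in_setT x).
move=> a; have : val (a - a *+ m) = val (0 : brace X).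
  rewrite val_brace0; apply: Q1; apply/hallGroupP.
  by exists (a - a *+ m); rewrite ?p'primary_compl.
by move=> e; apply/esym/subr0_eq/val_inj.
Qed.

Lemma lam_primary_elt g x : g \in G -> lam g (elt x *+ m) = elt (g x) *+ m.
Proof. by move=> gG; rewrite lamMn lam_elt. Qed.

Lemma hallGroup_trivial_of_fix :
  (forall q x, q \in Q -> lam q (elt x *+ m) = elt x *+ m) -> forall a, a *+ m = a.
Proof.
move=> fQ; apply: hallGroup_trivial; apply/subsetP=> _ /mem_cabling_permGroup[a ->].
apply: hallGroup_fix_norm => q qQ.
elim/brace_ind: a => [|x a IHa]; first by rewrite mul0rn lam0.
by rewrite mulrnDl lamD IHa fQ.
Qed.

(** If it failed, the set [S] of all p-parts would have 1 or p elements. It suffices that [Q] fixes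
    [S] pointwise: then every [elt x] is its own p-part. For p elements, a member of [P] is
    constructed that normalizes [Q] and is transitive on [S]. *)
Lemma primary_elt_inj x y : elt x *+ m = elt y *+ m -> x = y.
Proof.
move=> exy; apply: (elt_inj irrX); apply/eqP; apply: contraT => nxy.
have PG := subsetP sub_cabling_permGroup; have QG := subsetP sub_hallGroup.
pose S : {set brace X} := [set elt z *+ m | z : X].
have SP z : elt z *+ m \in S by apply: imset_f.
pose to := lamAction X; pose s := elt x *+ m.
have trS : [transitive P, on S | to]%g.
  apply/imsetP; exists s; first exact: SP.
  apply/setP=> a.
  apply/imsetP/imsetP => [[z _ ->]|[g gP ->]].
    have [g gP <-] := cabling_transitive x z.
    by exists g => //=; rewrite lam_primary_elt ?PG.
  by exists (g x) => //=; rewrite lam_primary_elt ?PG.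
have actQ : [acts Q, on S | to]%g.
  apply/subsetP=> q qQ; rewrite !inE QG //; apply/subsetP=> _ /imsetP[z _ ->].
  by rewrite inE /= lam_primary_elt ?QG.
have ltS : (#|S| < p ^ 2)%N.
  rewrite -cX ltn_neqAle leq_imset_card andbT.
  apply: contra nxy => /imset_injP inj.
  by apply/eqP; congr elt; apply: inj.
suff fQ q a : q \in Q -> a \in S -> lam q a = a.
  have id_m := hallGroup_trivial_of_fix (fun q z qQ => fQ q _ qQ (SP z)).
  by case/eqP: nxy; rewrite -[LHS]id_m exy id_m.
have : (#|S| %| #|P|)%N by apply: (atrans_dvd_in sub_cabling_permGroup trS).
have [j cP] := p_natP pgroup_cabling; rewrite cP.
case/(dvdn_pfactor _ _ p_pr) => i _ cS.
move: ltS; rewrite cS ltn_exp2l ?prime_gt1 //.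
case: i cS => [|[|//]] cS _ qQ aS.
  apply: (card_le1_eqP (A := S)); rewrite ?cS //.
  by have := acts_act actQ qQ a; rewrite aS /= => ->.
pose N := 'C_P[s | to]%G.
have iN : #|P : N|%g = p.
  rewrite -(card_orbit_in to s sub_cabling_permGroup).
  by rewrite (atransPin sub_cabling_permGroup trS (SP x)).
have nN : (N <| P)%g.
  by apply: (p_maximal_normal pgroup_cabling); apply: p_index_maximal;
    rewrite ?iN ?subsetIl.
have [u [uM uN]] := normal_index_prime_hom p_pr nN iN.
have fixN n z : n \in N -> lam n (elt z *+ m) = elt z *+ m.
  move=> nN'; have [g gP <-] := cabling_transitive x z.
  have nP : n \in P by case/setIP: nN'.
  rewrite -lam_primary_elt ?PG //.
  rewrite -[LHS]lamM ?PG // (conjgCV g n) lamM ?PG //; last first.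
    by rewrite groupJ ?groupV.
  congr lam.
  have : (n ^ g^-1)%g \in N by rewrite memJ_norm // groupV (subsetP (normal_norm nN)).
  by case/setIP=> _ c; apply: (astab_act c (set11 s)).
have uc : forall y z : Y, u (sigma y) = u (sigma z).
  apply: (hom_sigma_const p_pr pgroup_cabling uM) => [n nP v un|]; last first.
    exact: indecomposable_cabling.
  have nN' : n \in N by rewrite -uN // un.
  rewrite !sigma_cabling -lam_primary_elt ?PG //.
  by rewrite fixN.
pose c := u (sigma (x : Y)).
have uword (t : seq Y) : u (wordPerm t) = c *+ size t.
  elim/last_ind: t => [|t z IHt]; first by rewrite (hom1 uM).
  rewrite -cats1 wordPerm_cat /= uM ?wordPerm_permGroup // IHt wordPerm_cons mulg1.
  by rewrite size_cat addn1 mulrSr (uc _ x).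
have c0 : c != 0.
  have /subsetPn[g gP gN] : ~~ (P \subset N).
    by rewrite -indexg_eq1 iN neq_ltn prime_gt1 ?orbT.
  move: gN; rewrite -uN //; apply: contraNneq => c0.
  by have [t /eqP <-] := permGroup_wordPerm gP; rewrite uword c0 mul0rn.
(* Summing over all [h x] makes [b] invariant under [Q], so [val b] normalizes [Q]; and [u (val b)]
   is [#|Q|] times [c], nonzero because p does not divide [#|Q|]. *)
pose t : seq X := [seq h x | h : {perm X} in Q].
pose b := (\sum_(z <- t) elt z) *+ m.
have bP : val b \in P by apply/mem_cabling_permGroup; eexists.
have ub : u (val b) != 0.
  rewrite -(wordPerm_cabling (t : seq Y)) uword size_map -cardE.
  rewrite -mulr_natr mulf_neq0 // -(dvdn_pcharf (pchar_Fp p_pr)) -prime_coprime //.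
  by apply: (@pnat_coprime p); [rewrite pnat_id | apply: p'group_hallGroup].
have fb h : h \in Q -> lam h b = b.
  move=> hQ; rewrite /b lamMn big_map big_enum /=; congr (_ *+ _).
  rewrite (big_morph _ (lamD h) (lam0 h)) [RHS](reindex_inj (mulIg h)) /=.
  apply: eq_big => [g|g gQ]; first exact: esym (groupMr (G := Q) g hQ).
  by rewrite lam_elt ?QG // permM.
have bN : val b \notin N by rewrite -uN.
have nQb : (<[val b]>%g \subset 'N(Q))%g by rewrite cycle_subG hallGroup_fix_norm.
have sbP : (<[val b]>%g \subset P)%g by rewrite cycle_subG.
have sbG := subset_trans sbP sub_cabling_permGroup.
have trb : [transitive <[val b]>, on S | to]%g.
  apply/imsetP; exists s; first exact: SP.
  have sub : orbit to <[val b]> s \subset S.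
    by rewrite -(atransPin sub_cabling_permGroup trS (SP x)) imsetS.
  apply/esym/eqP; rewrite eqEcard sub cS expn1.
  have pb : (p.-group <[val b]>)%g := pgroupS sbP pgroup_cabling.
  have [i oi] : exists i, #|orbit to <[val b]> s| = (p ^ i)%N.
    have [i' ci] := p_natP pb.
    have : (#|orbit to <[val b]> s| %| p ^ i')%N.
      by rewrite -ci -(card_orbit_in_stab to s sbG) dvdn_mulr.
    by case/(dvdn_pfactor _ _ p_pr) => i _ ->; exists i.
  rewrite oi; case: i oi => [|i _]; last by rewrite expnS leq_pmulr ?expn_gt0 ?prime_gt0.
  move=> o1; case/negP: bN; rewrite inE bP /=.
  have inorb h : h \in <[val b]>%g -> to s h \in orbit to <[val b]> s by apply: imset_f.
  have e : to s (val b) = to s 1%g.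
    by apply: (card_le1_eqP (A := orbit to <[val b]> s)); rewrite ?o1 ?inorb ?cycle_id ?group1.
  rewrite inE (subsetP sbG) ?cycle_id // inE; apply/subsetP=> v; rewrite !inE => /eqP->.
  by rewrite e /= lam1.
exact: (normalized_p'group_fix p_pr cS p'group_hallGroup sbG sub_hallGroup nQb trb actQ qQ aS).
Qed.

Lemma irretractable_cabling : irretractable Y.
Proof. by move=> x y; rewrite !sigma_cabling => /val_inj/primary_elt_inj. Qed.

End PrimaryCabling.

(** * The normal form *)

Section Family.
Variable p : nat.
Hypothesis p_pr : prime p.
Local Open Scope ring_scope.
Notation F := 'F_p.
Implicit Types (al : F) (Phi : F -> F).

Definition famOp al Phi (u v : F * F) : F * F :=
  (al * v.1 + u.2, al * v.2 + Phi (v.1 - u.1)).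

Lemma famOpE al Phi (a x b y : F) :
  famOp al Phi (a, x) (b, y) = (al * b + x, al * y + Phi (b - a)).
Proof. by []. Qed.

Definition famValid al Phi :=
  [/\ al != 0, forall t, Phi (- t) = Phi t, forall t, Phi (al * t) = al * Phi t
    & exists t, Phi t != Phi 0].

Lemma step_affine (g : F -> F) d k : d != 0 ->
  (forall y, g (y + d) = g y + k) -> forall y, g y = g 0 + k / d * y.
Proof.
move=> d0 gd y.
have gn n : g (d * n%:R) = g 0 + k * n%:R.
  elim: n => [|n IHn]; first by rewrite !mulr0 addr0.
  by rewrite !mulrS !mulrDr !mulr1 addrC gd IHn -addrA [_ + k]addrC.
have := gn (y / d : F); rewrite natr_Fp_val mulrC divfK // => ->.
by rewrite mulrAC mulrA.
Qed.

Lemma F2_eq1 al : ~~ odd p -> al != 0 -> al = 1.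
Proof.
move=> odd_p; have p2 : p = 2%N by case/even_prime: p_pr odd_p => [//|->].
move: al; rewrite p2 => al.
by case: al => [[|[|//]]] //= lt _; apply: val_inj.
Qed.

Lemma F_two_neq0 : odd p -> 2%:R != 0 :> F.
Proof.
move=> odd_p; rewrite -(dvdn_pcharf (pchar_Fp p_pr)); apply/negP=> d2.
have p2 : p = 2%N by apply/eqP; rewrite eqn_leq prime_gt1 // dvdn_leq.
by move: odd_p; rewrite p2.
Qed.

Lemma famValid0 al Phi : famValid al Phi -> al != 1 -> Phi 0 = 0.
Proof.
case=> _ _ Phial _ al1; have := Phial 0; rewrite mulr0 => /eqP.
rewrite -subr_eq0 -{1}[Phi 0]mul1r -mulrBl mulf_eq0 subr_eq0 eq_sym (negPf al1).
by move/eqP.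
Qed.

Lemma famOp_law al Phi u v w : famValid al Phi ->
  famOp al Phi (famOp al Phi u v) (famOp al Phi u w) =
  famOp al Phi (famOp al Phi v u) (famOp al Phi v w).
Proof.
case=> _ even lin _; case: u => a x; case: v => b y; case: w => c z.
rewrite /famOp /=; congr pair.
  by rewrite -opprB even; ring.
have -> : al * c + x - (al * b + x) = al * (c - b) by ring.
have -> : al * c + y - (al * a + y) = al * (c - a) by ring.
by rewrite !lin; ring.
Qed.

(** Two different values of [Phi] in the first component of the law make the first component of [h]
    affine in the second variable. Its slope must vanish; then a single affine function [A] gives
    both components. *)
Lemma famOp_iso al al' Phi Phi' (h : F * F -> F * F) :
  famValid al Phi -> famValid al' Phi' -> injective h ->
  (forall u v, h (famOp al Phi u v) = famOp al' Phi' (h u) (h v)) ->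
  exists s be, [/\ s != 0, al' = al, (1 - al) * be = 0,
    forall u, h u = (s * u.1 + be, s * u.2) & forall t, Phi' (s * t) = s * Phi t].
Proof.
move=> V V' hI hM; have [al0 even lin [t0 nc]] := V; have [al'0 _ _ _] := V'.
pose h1 b y := (h (b, y)).1; pose h2 b y := (h (b, y)).2.
have E1 a x b y : h1 (al * b + x) (al * y + Phi (b - a)) = al' * h1 b y + h2 a x.
  by rewrite /h1 -[(_, _)]/(famOp al Phi (a, x) (b, y)) hM.
have E2 a x b y : h2 (al * b + x) (al * y + Phi (b - a)) =
    al' * h2 b y + Phi' (h1 b y - h1 a x).
  by rewrite /h2 -[(_, _)]/(famOp al Phi (a, x) (b, y)) hM.
pose d := Phi t0 - Phi 0; have d0 : d != 0 by rewrite subr_eq0.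
have [A [B h1E]] : exists A B : F -> F, forall c y, h1 c y = A c + B c * y.
  exists (fun c => h1 c 0), (fun c => (h2 (- t0) c - h2 0 c) / d) => c.
  apply: step_affine => // y.
  have := E1 (- t0) c 0 ((y - Phi 0) / al); have := E1 0 c 0 ((y - Phi 0) / al).
  rewrite !sub0r opprK oppr0 mulr0 add0r mulrC divfK // subrK => ->.
  rewrite /d -addrA [- Phi 0 + _]addrC => ->.
  by ring.
have BE b c : B c * al = al' * B b.
  have ec : al * b + (c - al * b) = c by ring.
  have e0 := E1 0 (c - al * b) b 0; have e1 := E1 0 (c - al * b) b 1.
  rewrite !h1E ec in e0 e1.
  suff -> : B c * al = (A c + B c * (al * 1 + Phi (b - 0))) - (A c + B c * (al * 0 + Phi (b - 0))).
    by rewrite e0 e1; ring.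
  by ring.
have Bc c : B c = B 0 by apply: (mulIf al0); rewrite (BE 0) (BE 0).
(* A nonzero slope makes [Phi - Phi 0] additive. Being even, it vanishes if p is odd; if p = 2, then
   [al = 1] and [E3] shows that [Phi] is constant. *)
have B0 : B 0 = 0.
  apply/eqP; apply: contraT => B0; have eal : al' = al.
    by apply: (mulIf B0); rewrite -(BE 0 0) mulrC.
  have E3 a b : B 0 * Phi (b - a) = h2 a 0 + (al * A b - A (al * b)).
    have := E1 a 0 b 0; rewrite !h1E !Bc eal addr0 !mulr0 add0r addr0 => e.
    by apply: (addrI (A (al * b))); rewrite e; ring.
  have E4 b t : Phi (b + t) = Phi t + (Phi b - Phi 0).
    apply: (mulfI B0); rewrite !mulrDr mulrN.
    have e1 := E3 (- t) b; have e2 := E3 (- t) 0; have e3 := E3 0 b; have e4 := E3 0 0.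
    rewrite ?opprK ?subr0 ?add0r in e1 e2 e3 e4.
    by rewrite e1 e2 e3 e4; ring.
  case/negP: nc; case: (boolP (odd p)) => [odd_p|/F2_eq1 F2].
    have := E4 t0 (- t0); rewrite subrr even => e.
    rewrite -subr_eq0; have /mulfI := F_two_neq0 odd_p; move/(_ (Phi t0 - Phi 0) 0).
    rewrite mulr0 => -> //.
    have -> : 2%:R * (Phi t0 - Phi 0) = Phi t0 + (Phi t0 - Phi 0) - Phi 0 by ring.
    by rewrite -e subrr.
  have al1 := F2 _ al0.
  have := E3 0 t0; have := E3 0 0; rewrite al1 !mul1r !subrr !subr0 !addr0 => <- /mulfI.
  by move=> -> //; rewrite eqxx.
have {}h1E c y : h1 c y = A c by rewrite h1E Bc B0 mul0r addr0.
have h2E a x : h2 a x = A x - al' * A 0.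
  have := E1 a x 0 0; rewrite !h1E mulr0 add0r => ->.
  by rewrite addrC addKr.
have AE b x : A (al * b + x) = al' * A b + (A x - al' * A 0).
  by have := E1 0 x b 0; rewrite !h1E h2E.
(* [AE] at [al^-1] says that [A (x + 1) - A x] is this constant. *)
pose s := al' * (A al^-1 - A 0).
have {}AE' y : A y = A 0 + s * y.
  rewrite -[s]divr1; apply: step_affine => [|x]; first exact: oner_neq0.
  have := AE al^-1 x; rewrite divff // addrC => ->.
  by rewrite /s; ring.
have s0 : s != 0.
  apply: contraTneq (oner_neq0 F) => s0; rewrite negbK.
  have hE u : h u = (A 0, A 0 - al' * A 0).
    case: u => a x; rewrite [LHS]surjective_pairing -/(h1 a x) -/(h2 a x) h1E h2E.
    by rewrite !(AE' a) !(AE' x) s0 !mul0r !addr0.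
  have /hI/(congr1 fst) e : h (0, 0) = h (1, 0) by rewrite !hE.
  by rewrite eq_sym; apply/eqP.
have eal : al' = al.
  have := AE 1 0; rewrite mulr1 addr0 (AE' al) (AE' 1) mulr1 => e.
  apply: (mulIf s0); apply: (addrI (A 0)); rewrite [al * s]mulrC e; ring.
have E5 t : s * Phi t + (1 - al) * ((1 - al) * A 0) = Phi' (s * t).
  have := E2 0 0 t 0; rewrite !h2E !h1E !subr0 mulr0 add0r eal.
  rewrite (AE' (Phi t)) (AE' t) => e.
  have -> : s * t = A 0 + s * t - A 0 by ring.
  by apply: (addrI (al * (A 0 - al * A 0))); rewrite -e; ring.
(* When [al] is not 1, both [Phi 0] and [Phi' 0] vanish, and [E5] at 0 leaves only the term with
   [A 0]. *)
have be0 : (1 - al) * A 0 = 0.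
  have [->|al1] := eqVneq al 1; first by rewrite subrr mul0r.
  have := E5 0; rewrite mulr0 (famValid0 V al1) (famValid0 V') ?eal // mulr0 add0r.
  by move/eqP; rewrite mulf_eq0 subr_eq0 eq_sym (negPf al1) => /eqP.
exists s, (A 0); split=> // [[a x]|t]; last by rewrite -E5 be0 mulr0 addr0.
rewrite [LHS]surjective_pairing -/(h1 a x) -/(h2 a x) h1E h2E (AE' a) (AE' x) /= eal addrC.
have e : A 0 - al * A 0 = (1 - al) * A 0 by ring.
by rewrite [A 0 + s * x - _]addrAC e be0 add0r.
Qed.

End Family.

(** * Reduction to the normal form *)

(* For p = 2 this bounds the p'-part of a subgroup of the symmetric group on [X]. *)
Lemma odd_part_24 : 24`_2^' = 3.
Proof.
rewrite -[24]/(2 ^ 3 * 3) partnM // partnX.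
rewrite (part_p'nat (pi := 2^') (n := 2)) ?pnatNK ?pnat_id // exp1n mul1n.
by rewrite part_pnat_id // -odd_2'nat.
Qed.

(** * The p'-parts in the coordinates of the cabling *)

Section PrimaryCoords.
Variables (p : nat) (X : cycleSet).
Hypothesis p_pr : prime p.
Hypothesis cX : #|X| = (p ^ 2)%N.
Hypothesis trX : indecomposable X.
Hypothesis irrX : irretractable X.
Notation G := (permGroup X).
Notation m := (primaryExp (brace X) p).
Notation Y := (cabling X m).
Notation P := (permGroup Y).
Notation Q := (hallGroup p X).
Notation F := 'F_p.
Implicit Types (x y v : X) (a b : brace X) (g h q n : {perm X}) (c d s t : F).
Local Open Scope ring_scope.

Variables (r : F * F -> X) (Phi : F -> F).
Hypothesis r_bij : bijective r.
Hypothesis r_op : forall a c b d : F,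
  val (elt (r (a, c)) *+ m) (r (b, d)) = r (b + c, d + Phi (b - a)).
Let pe x : brace X := elt x *+ m.
Let tau x : {perm X} := val (pe x).

Let PG : forall g : {perm X}, g \in P -> g \in G.
Proof. exact: (subsetP (sub_cabling_permGroup p X)). Qed.

Let peP x : tau x \in P.
Proof. by apply/mem_cabling_permGroup; exists (elt x). Qed.

Let pe_inj : injective pe.
Proof. exact: primary_elt_inj. Qed.

Let lam_pe g x : g \in G -> lam g (pe x) = pe (g x).
Proof. exact: lam_primary_elt. Qed.

Lemma coordsP v : exists c d : F, v = r (c, d).
Proof. by have [s _ sK] := r_bij; exists (s v).1, (s v).2; rewrite -surjective_pairing sK. Qed.

Lemma coords_inj (a b c d : F) : r (a, b) = r (c, d) -> a = c /\ b = d.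
Proof. by move/(bij_inj r_bij) => [-> ->]. Qed.

Lemma perm_coords g h : (forall c d : F, g (r (c, d)) = h (r (c, d))) -> g = h.
Proof. by move=> e; apply/permP=> v; have [c [d ->]] := coordsP v. Qed.

Lemma tauV (c d b e : F) : ((tau (r (c, d)))^-1)%g (r (b, e)) = r (b - d, e - Phi (b - d - c)).
Proof. by apply: (can_inj (permK (tau (r (c, d))))); rewrite permKV r_op !subrK. Qed.

Lemma Phi_even t : Phi (- t) = Phi t.
Proof.
have := @cs_law Y (r (0, 0)) (r (t, 0)) (r (0, 0)); rewrite /cs_op /= /cablingOp.
rewrite !r_op !addr0 !add0r !subr0 => /(bij_inj r_bij)[].
by move=> ->.
Qed.

(** A period [s] would give the points [(s, 0)] and [(0, 0)] the same permutation. *)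
Lemma Phi_aperiodic s : (forall t, Phi (t - s) = Phi t) -> s = 0.
Proof.
move=> per; have e : tau (r (s, 0)) = tau (r (0, 0)).
  by apply: perm_coords => c d; rewrite !r_op per subr0.
by have /pe_inj/(bij_inj r_bij)[] := val_inj e.
Qed.

Definition shift1 : {perm X} := ((tau (r (0, 0)%R))^-1 * tau (r (0, 1)%R))%g.
Notation f := shift1.

Lemma shift1E c d : f (r (c, d)) = r (c + 1, d).
Proof. by rewrite permM tauV r_op !subr0 subrK. Qed.

Lemma shift1_P : f \in P.
Proof. by rewrite groupM ?groupV ?peP. Qed.

Definition shiftElt : brace X := Sub f (PG shift1_P).
Notation z := shiftElt.

Lemma tau_shift c d : (f * tau (f (r (c, d))))%g = (tau (r (c, d)) * f)%g.
Proof.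
apply: perm_coords => c' d'; rewrite permM [RHS]permM !shift1E !r_op shift1E opprD.
by congr (r (_, _ + Phi _)); ring.
Qed.

Lemma lam_tau_z x : lam (tau x) z = z.
Proof.
have [c [d ->]] := coordsP x; apply: val_inj; apply: (mulgI (tau (r (c, d)))).
by rewrite -val_braceD addrC val_braceD /= lam_pe ?PG ?shift1_P // tau_shift.
Qed.

Lemma lam_z g : g \in P -> lam g z = z.
Proof.
move=> gP; have: P \subset 'C[z | lamAction X]%g.
  rewrite gen_subG; apply/subsetP=> _ /imsetP[x _ ->]; rewrite sigma_cabling.
  by rewrite inE PG ?peP // inE; apply/subsetP=> b; rewrite !inE => /eqP->; rewrite /= lam_tau_z.
by move/subsetP/(_ g gP) => zg; apply: (astab_act zg (set11 z)).
Qed.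

Lemma pe_shift c d : pe (r (c, d + 1)) = pe (r (c, d)) + z.
Proof.
apply: val_inj; rewrite val_braceD lam_tau_z; apply: perm_coords => c' d'.
by rewrite permM !r_op shift1E addrA.
Qed.

Lemma pe_shiftMn c d (n : nat) : pe (r (c, d + n%:R)) = pe (r (c, d)) + z *+ n.
Proof.
elim: n => [|n IHn]; first by rewrite !addr0.
by rewrite mulrSr addrA pe_shift IHn mulrSr addrA.
Qed.

Lemma shiftElt_p : z *+ p = 0.
Proof.
have := pe_shiftMn 0 0 p; rewrite pchar_Fp_0 // addr0 -{1}[pe _]addr0.
by move/addrI.
Qed.

Lemma pe_shiftF (c d e : F) : pe (r (c, d + e)) = pe (r (c, d)) + z *+ e.
Proof. by rewrite -pe_shiftMn natr_Fp_val. Qed.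

Lemma shiftElt_inj (d e : F) : z *+ d = z *+ e -> d = e.
Proof.
move=> de; have : pe (r (0, d)) = pe (r (0, e)).
  by rewrite -[d]add0r -[e]add0r !pe_shiftF de.
by move/pe_inj/(bij_inj r_bij) => [].
Qed.

Lemma val_z_mulrn a (e : F) : val a \in P -> val (a + z *+ e) = (val a * f ^+ e)%g.
Proof.
move=> aP; rewrite val_braceD lamMn lam_z //; congr (_ * _)%g.
elim: (nat_of_ord e) => [|n IHn]; first by rewrite val_brace0.
by rewrite mulrSr expgSr val_braceD IHn lam_z // groupX ?shift1_P.
Qed.

Definition inLine a := exists c : F, a = z *+ c.

Lemma inLineB a b : inLine a -> inLine b -> inLine (a - b).
Proof.
move=> [c ->] [d ->]; exists (c - d).
by apply/eqP; rewrite subr_eq -mulrn_FpD ?subrK // shiftElt_p.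
Qed.

Lemma inLineMn a (n : nat) : inLine a -> inLine (a *+ n).
Proof.
move=> [c ->]; exists (c * n%:R); rewrite mulrn_FpM ?shiftElt_p //.
by rewrite mulrn_Fp_nat // mulrnAC shiftElt_p mul0rn.
Qed.

Lemma pe_diff_line (a c b d : F) : inLine (pe (r (a, c)) - pe (r (b, d))) -> a = b.
Proof.
move=> [e E]; have : pe (r (a, c)) = pe (r (b, d + e)).
  by rewrite pe_shiftF -E addrC subrK.
by move/pe_inj/(bij_inj r_bij) => [].
Qed.

Lemma pe_line (a c d : F) : inLine (pe (r (a, c)) - pe (r (a, d))).
Proof. by exists (c - d); apply/eqP; rewrite subr_eq addrC -pe_shiftF [d + _]addrC subrK. Qed.

Lemma shift1X (c d : F) (n : nat) : (f ^+ n)%g (r (c, d)) = r (c + n%:R, d).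
Proof.
elim: n c => [|n IHn] c; first by rewrite perm1 addr0.
by rewrite expgS permM shift1E IHn mulrS addrA.
Qed.

(** Translation by [z] preserves the set of all [pe x], and [lam q] maps this set to itself. *)
Lemma shift_period q x : q \in G -> exists y, pe y = pe x + lam q z.
Proof.
move=> qG; have [c [d e]] := coordsP (q^-1%g x); exists (q (r (c, d + 1))).
by rewrite -lam_pe // pe_shift lamD -e lam_pe // permKV.
Qed.

(** If [z' = lam q z] were off the line of [z], the set of all [pe x] would be a coset of the plane
    spanned by [z] and [z']. Comparing the permutations of [pe x] and [pe x + z'] then produces a
    nonzero period of [Phi]. *)
Lemma lam_shift_line q : odd p -> q \in G -> inLine (lam q z).
Proof.
move=> odd_p qG; set z' := lam q z.
case: (pickP (fun c : F => z' == z *+ c)) => [c /eqP e|none]; first by exists c.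
have ni : ~ inLine z' by case=> c e; have := none c; rewrite /= e eqxx.
have z'p : z' *+ p = 0 by rewrite -lamMn shiftElt_p lam0.
have period x : exists y, pe y = pe x + z' := shift_period x qG.
have [w wE] : exists w : F -> F * F, forall a : F, pe (r (w a)) = pe (r (a, 0)) + z'.
  apply: (fin_all_exists (P := fun (a : F) (w : F * F) => pe (r w) = pe (r (a, 0)) + z')) => a.
  have [y <-] := period (r (a, 0)).
  by have [c [d ->]] := coordsP y; exists (c, d).
pose A (a : F) := (w a).1; pose C (a : F) := (w a).2.
have {}wE (a : F) : pe (r (A a, C a)) = pe (r (a, 0)) + z' by rewrite -surjective_pairing.
have periodMn x (i : nat) : exists y, pe y = pe x + z' *+ i.
  elim: i => [|i [y e]]; first by exists x; rewrite addr0.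
  by have [y' e'] := period y; exists y'; rewrite e' e mulrSr addrA.
have [W WE] : exists W : F * F -> X, forall ij : F * F,
    pe (W ij) = pe (r (0, 0)) + (z' *+ ij.1 + z *+ ij.2).
  apply: (fin_all_exists (P := fun (ij : F * F) x =>
    pe x = pe (r (0, 0)) + (z' *+ ij.1 + z *+ ij.2))) => [[i j]].
  have [y e] := periodMn (r (0, 0)) i; have [c [d ey]] := coordsP y.
  by exists (r (c, d + j)); rewrite pe_shiftF -ey e addrA.
have W_inj : injective W.
  move=> [i j] [i' j'] /(congr1 pe); rewrite !WE => /addrI /= e.
  have [ii'|nii'] := eqVneq i i'.
    by move: e; rewrite ii' => /addrI/shiftElt_inj->.
  case: ni; have e' : z' *+ (i - i')%R = z *+ (j' - j)%R.
    apply: (addrI (z' *+ i')); apply: (addIr (z *+ j)).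
    rewrite -mulrn_FpD // addrCA subrr addr0 e -addrA -mulrn_FpD ?shiftElt_p //.
    by rewrite subrK.
  have -> : z' = z' *+ (i - i')%R *+ ((i - i')^-1)%R.
    rewrite -mulrn_FpM // divff ?subr_eq0 // -[1]/(1%:R) mulrn_Fp_nat //.
  by rewrite e'; apply: inLineMn; exists (j' - j).
have W_surj x : exists ij : F * F, x = W ij.
  have /(inj_card_bij W_inj)[V _ WK] : (#|X| <= #|{: F * F}|)%N.
    by rewrite cX card_prod card_Fp.
  by exists (V x).
(* [lam g] preserves the plane and fixes [z], so it is a scalar modulo the line; the scalar is 1
   because [g] has p-power order. *)
have eigen g : g \in P -> inLine (lam g z' - z').
  move=> gP; have gG := PG gP.
  have [u ue] := period (g^-1%g (r (0, 0))).
  have [[i j] uE] := W_surj (g u).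
  have e : lam g z' = z' *+ i + z *+ j.
    apply: (addrI (pe (r (0, 0)))); rewrite -(WE (i, j)) -uE -lam_pe // ue lamD lam_pe //.
    by rewrite permKV.
  have [n on] := p_natP (mem_p_elt (pgroup_cabling X p_pr) gP).
  apply: (@p_order_eigen p _ inLine (lam g) p_pr _ _ _ _ n z' i) => //.
  - by exists 0.
  - exact: inLineB.
  - exact: lamD.
  - by move=> _ [c ->]; exists c; rewrite lamMn lam_z.
  - have it k b : iter k (lam g) b = lam (g ^+ k)%g b.
      by elim: k => [|k IHk]; rewrite ?lam1 // expgSr lamM ?groupX //= IHk.
    by rewrite it -on expg_order lam1.
  - by rewrite z'p; exists 0.
  by rewrite e addrAC subrr add0r; exists j.
have AS (a : F) : A (a + 1) = A a + 1.
  apply/esym/(@pe_diff_line _ (C a) _ (C (a + 1))); rewrite wE -shift1E -lam_pe ?PG ?shift1_P //.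
  rewrite wE lamD lam_pe ?PG ?shift1_P // shift1E opprD addrACA subrr add0r.
  exact/eigen/shift1_P.
have AE (a : F) : A a = A 0 + a.
  by rewrite (step_affine (oner_neq0 F) AS) divr1 mul1r.
pose s := A 0.
have s0 : s != 0.
  apply/eqP=> s0; apply: ni; rewrite -(addKr (pe (r (0, 0))) z') -wE -/s s0 addrC.
  exact: pe_line.
have [th thE] : exists th : F -> F, forall a : F,
    lam (tau (r (a, 0))) z' = z' + z *+ th a.
  apply: (fin_all_exists (P := fun (a th : F) => lam (tau (r (a, 0))) z' = z' + z *+ th)) => a.
  by have [c e] := eigen _ (peP (r (a, 0))); exists c; rewrite -e addrC subrK.
have hP : val z' \in P.
  apply/mem_cabling_permGroup; exists (lam q (elt (r (0, 1)) - elt (r (0, 0)))).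
  rewrite -lamMn mulrnBl -/(pe _) -/(pe _) -{1}[1]add0r pe_shift.
  by rewrite addrAC subrr add0r.
(* The point on the left does not depend on [a], so neither does the second coordinate on the right;
   since [A a = s + a], the difference [Phi (t - s) - Phi t] is constant. *)
have kappa (b a : F) : exists d : F,
    val z' (r (b, 0)) = r (d, Phi (b - A a) - Phi (b - a)).
  have e : tau (r (A a, C a)) = (tau (r (a, 0)) * (val z' * f ^+ th a))%g.
    by rewrite -val_z_mulrn // -thE /tau wE val_braceD.
  have := congr1 (fun g : {perm X} => g (r (b, - Phi (b - a)))) e.
  rewrite !permM !r_op addr0 addNr; have [c [d ->]] := coordsP (val z' (r (b, 0))).
  by rewrite shift1X => /coords_inj[_ <-]; exists c; rewrite addrC.
have [k kE] : exists k : F, forall t : F, Phi (t - s) = Phi t + k.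
  have [d0 e0] := kappa 0 0; exists (Phi (0 - A 0) - Phi (0 - 0)) => t.
  have [d e] := kappa 0 (- t).
  have := e; rewrite e0 => /coords_inj[_ ->]; rewrite AE !sub0r opprD opprK.
  by rewrite -/s [- s + t]addrC addrCA subrr addr0.
(* Evenness gives [Phi s = Phi 0 + k] as well as [Phi 0 = Phi s + k], so [2 k = 0], and p is odd. *)
have k0 : k = 0.
  have e1 := kE 0; have e2 := kE s; rewrite sub0r Phi_even in e1; rewrite subrr e1 in e2.
  have /mulfI := F_two_neq0 p_pr odd_p; apply; rewrite mulr0.
  by apply: (addrI (Phi 0)); rewrite addr0 {2}e2; ring.
by case/eqP: s0; apply: Phi_aperiodic => t; rewrite kE k0 addr0.
Qed.

Definition p'part x : brace X := elt x - pe x.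

Lemma p'part_p'primary x : p'primary p (p'part x).
Proof. exact: p'primary_compl. Qed.

Lemma lam_p'part g x : g \in G -> lam g (p'part x) = p'part (g x).
Proof. by move=> gG; rewrite lamB lam_elt // lam_pe. Qed.

Lemma Phi_step : exists t, Phi (t + 1) != Phi t.
Proof.
case: (pickP (fun t => Phi (t + 1) != Phi t)) => [t tP|none]; first by exists t.
suff e : (- 1 : F) = 0 by case/eqP: (oner_neq0 F); rewrite -[1]opprK e oppr0.
by apply: Phi_aperiodic => t; rewrite opprK; apply/eqP/negbFE/none.
Qed.

(** The elements of [Q] fixing [z] form a p'-group normalized by a transitive group, so they are
    trivial. It follows that [f] fixes all p'-primary elements, and the invariance of [p'part] under
    [f] and a conjugate of [f] spreads over [X]. *)
Lemma p'part_const_odd : odd p -> forall x y, p'part x = p'part y.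
Proof.
move=> odd_p; have QG := subsetP (sub_hallGroup p X).
have fG : f \in G by apply/PG/shift1_P.
have line q : q \in G -> exists c : F, lam q z = z *+ c by apply: lam_shift_line.
have valz (c : F) : val (z *+ c) = (f ^+ c)%g.
  by have := @val_z_mulrn 0 c; rewrite add0r val_brace0 mul1g; apply; apply: group1.
have fz : lam f z = z by apply/lam_z/shift1_P.
have fVz : lam f^-1%g z = z by rewrite -{1}fz lamK.
have fXz (c : F) : lam (f ^+ c)%g z = z by apply/lam_z/groupX/shift1_P.
have Q1_trivial q : q \in Q -> lam q z = z -> q = 1%g.
  have gQ1 : group_set [set q in Q | lam q z == z].
    apply/group_setP; split=> [|g h]; rewrite !inE; first by rewrite group1 lam1 eqxx.
    case/andP=> gQ /eqP gz /andP[hQ /eqP hz].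
    by rewrite groupM // lamM ?QG // gz hz eqxx.
  pose Q1 := Group gQ1.
  have sQ1 : Q1 \subset Q by apply/subsetP=> g; rewrite inE => /andP[].
  have [rho rK rhoK] := r_bij.
  have kf_inj : injective (fun v => r ((rho v).1, (rho v).2 + 1)).
    move=> v v' /coords_inj[e1 /addIr e2]; apply: (can_inj rhoK).
    by rewrite [LHS]surjective_pairing e1 e2 -surjective_pairing.
  (* The vertical shift [k] and [f] generate a transitive group; [k] commutes with every [q] in [Q1]
     because [pe (k v) = pe v + z]. *)
  pose k := perm kf_inj.
  have kE (c d : F) : k (r (c, d)) = r (c, d + 1) by rewrite permE rK.
  have pek v : pe (k v) = pe v + z by have [c [d ->]] := coordsP v; rewrite kE pe_shift.
  have kX (c d : F) (n : nat) : (k ^+ n)%g (r (c, d)) = r (c, d + n%:R).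
    elim: n d => [|n IHn] d; first by rewrite perm1 addr0.
    by rewrite expgS permM kE IHn mulrS addrA.
  pose L := <<[set f; k]>>%G.
  have nQL : (L \subset 'N(Q1))%g.
    rewrite gen_subG; apply/subsetP=> g; rewrite !inE => /orP[]/eqP->;
      apply/subsetP=> _ /imsetP[h hQ1 ->]; move: hQ1; rewrite !inE => /andP[hQ /eqP hz].
      have [a pa ha] := hallGroupP _ _ hQ.
      have e : (h ^ f)%g = val (lam f a).
        have := val_braceD a z; rewrite addrC val_braceD -ha hz /= => e.
        by rewrite conjgE -e mulKg.
      rewrite e; apply/andP; split.
        by apply/hallGroupP; exists (lam f a); rewrite ?p'primary_lam.
      have hG := QG h hQ.
      by rewrite -e conjgE (lamM _ (groupVr fG) (groupM hG fG)) (lamM _ hG fG) fVz hz fz.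
    suff -> : (h ^ k)%g = h by rewrite hQ hz eqxx.
    apply/conjg_fixP/commgP/permP=> v; rewrite !permM; apply: pe_inj.
    by rewrite pek -(lam_pe v (QG h hQ)) -(lam_pe (k v) (QG h hQ)) pek lamD hz.
  have trL : [transitive L, on [set: X] | 'P]%g.
    apply/imsetP; exists (r (0, 0)) => //; apply/setP=> v; rewrite inE; apply/esym/imsetP.
    have [c [d ->]] := coordsP v; exists (k ^+ d * f ^+ c)%g.
      by rewrite groupM ?groupX ?mem_gen // !inE eqxx ?orbT.
    by rewrite /= /aperm permM kX shift1X !natr_Fp_val !add0r.
  have actQ1 : [acts Q1, on [set: X] | 'P]%g by apply/actsP=> h _ v; rewrite !inE.
  have p'Q1 : (p^'.-group Q1)%g := pgroupS sQ1 (p'group_hallGroup X p_pr).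
  move=> qQ qz; apply/permP=> v; rewrite perm1.
  have qQ1 : q \in Q1 by rewrite inE qQ qz eqxx.
  exact: (normalized_p'group_fix p_pr (etrans (cardsT X) cX) p'Q1 (subsetT _) (subsetT _)
    nQL trL actQ1 qQ1 (in_setT v)).
have lamf a : p'primary p a -> lam f a = a.
  move=> pa; pose q := val a; have qQ : q \in Q by apply/hallGroupP; exists a.
  have qG := QG q qQ; have [c qz] := line q qG.
  have e : (q * f ^+ c = f * val (lam f a))%g.
    by rewrite -valz -qz -val_braceD addrC val_braceD.
  have fQ : val (lam f a) \in Q by apply/hallGroupP; exists (lam f a); rewrite ?p'primary_lam.
  have fE : val (lam f a) = (f^-1 * (q * f ^+ c))%g by rewrite e mulKg.
  (* The two permutations differ by powers of [f], which fix [z], so they scale [z] by the same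
     factor and their quotient fixes it. *)
  have q1 : (q^-1 * val (lam f a))%g = 1%g.
    apply: Q1_trivial; first by rewrite groupM ?groupV.
    have [c' q'z] := line q^-1%g (groupVr qG).
    have fcG : (f ^+ c)%g \in G by rewrite groupX.
    rewrite fE (lamM _ (groupVr qG) (groupM (groupVr fG) (groupM qG fcG))) q'z.
    rewrite (lamM _ (groupVr fG) (groupM qG fcG)) (lamM _ qG fcG) !lamMn fVz qz !lamMn fXz.
    by rewrite -[RHS](lamKV qG) q'z lamMn qz.
  by apply: val_inj; rewrite -[LHS](mulKVg q) q1 mulg1.
have wf x : p'part (f x) = p'part x.
  by rewrite -lam_p'part // lamf // p'part_p'primary.
have [t tP] := Phi_step; pose d := Phi (t + 1) - Phi t.
have d0 : d != 0 by rewrite subr_eq0.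
(* Conjugated by [tau (r (0, 0))], the shift [f] sends [(t, y)] to [(t + 1, y + d)], whereas [f]
   sends it to [(t + 1, y)]; both preserve [p'part]. *)
have wt0 (y : F) : p'part (r (t + 1, y + d)) = p'part (r (t + 1, y)).
  rewrite -[r (t + 1, y)]shift1E wf.
  pose g := tau (r (0, 0)); have gG : g \in G by apply/PG/peP.
  have -> : r (t + 1, y + d) = g (f (g^-1%g (r (t, y)))).
    rewrite tauV !subr0 shift1E r_op addr0 subr0.
    by congr (r (_, _)); rewrite /d; ring.
  by rewrite -lam_p'part // wf lam_p'part // permKV.
have wt (y : F) : p'part (r (t + 1, y)) = p'part (r (t + 1, 0)).
  have wn (n : nat) : p'part (r (t + 1, d *+ n)) = p'part (r (t + 1, 0)).
    by elim: n => [|n IHn]; rewrite ?mulr0n // mulrSr wt0.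
  by have := wn (y / d : F)%R; rewrite -mulr_natr natr_Fp_val mulrC divfK.
have wE x : p'part x = p'part (r (t + 1, 0)).
  have [c [y ->]] := coordsP x; rewrite -(wt y).
  have wX (n : nat) v : p'part ((f ^+ n)%g v) = p'part v.
    by elim: n => [|n IHn]; rewrite ?perm1 // expgSr permM wf.
  rewrite -(wX (t + 1 - c : F)%R (r (c, y))) shift1X natr_Fp_val.
  by rewrite addrC subrK.
by move=> x y; rewrite !wE.
Qed.

(** [Q] has odd order at most 3, and the values of [p'part], permuted transitively by the 2-group
    [P], number at most 2. So [Q] preserves each fibre; if there were two values, fibres would have
    at most 2 points, [Q] would be trivial and every p'-part 0. *)
Lemma p'part_const_even : ~~ odd p -> forall x y, p'part x = p'part y.
Proof.
move=> even_p; have p2 : p = 2%N by case/even_prime: p_pr even_p => [//|->].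
have QG := subsetP (sub_hallGroup p X).
have oQ : odd #|Q|.
  by rewrite odd_2'nat -p2; apply: p'group_hallGroup.
have fix2 (T : finType) (to : action G T) (a : T) :
    (#|orbit to Q a| <= 2)%N -> forall q, q \in Q -> to a q = a.
  move=> le2 q qQ; have := card_orbit_in_stab to a (sub_hallGroup p X) => e.
  have o1 : odd #|orbit to Q a| by move: oQ; rewrite -e oddM => /andP[].
  have c1 : #|orbit to Q a| = 1%N by case: #|_| le2 o1 => [|[|[|]]].
  apply: (card_le1_eqP (A := orbit to Q a)); rewrite ?c1 ?imset_f //.
  by apply/imsetP; exists 1%g; rewrite ?act1.
have leQ : (#|Q| <= 3)%N.
  have dG : (#|G| %| 24)%N.
    have -> : 24%N = #|[set: {perm X}]|.
      transitivity #|perm_on [set: X]|; first by rewrite card_perm cardsT cX p2.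
      by apply: eq_card => g; rewrite !inE; apply/subsetP=> v _; rewrite inE.
    exact: cardSg (subsetT G).
  rewrite card_hallGroup // p2 -odd_part_24; apply: dvdn_leq; first exact: part_gt0.
  exact: partn_dvd.
pose W : {set brace X} := [set p'part x | x : X].
have Ww x : p'part x \in W by apply: imset_f.
have leW : (#|W| <= 3)%N.
  rewrite -(card_imset _ (val_inj : injective (val : brace X -> _))).
  apply: leq_trans leQ; apply/subset_leq_card/subsetP=> _ /imsetP[_ /imsetP[x _ ->] ->].
  by apply/hallGroupP; exists (p'part x); rewrite ?p'part_p'primary.
have trW : [transitive P, on W | lamAction X]%g.
  apply/imsetP; exists (p'part (r (0, 0))) => //; apply/setP=> a.
  apply/imsetP/imsetP => [[x _ ->]|[g gP ->]].
    have [g gP <-] := cabling_transitive p_pr cX trX (r (0, 0)) x.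
    by exists g => //=; rewrite lam_p'part ?PG.
  by exists (g (r (0, 0))) => //=; rewrite lam_p'part ?PG.
have [i cP] := p_natP (pgroup_cabling X p_pr).
have : (#|W| %| #|P|)%N by apply: (atrans_dvd_in (sub_cabling_permGroup p X) trW).
rewrite cP => /(dvdn_pfactor _ _ p_pr)[j _ cW].
have {leW cW j} le2 : (#|W| <= 2)%N.
  move: leW; rewrite cW p2; case: j {cW} => [|[|j]] //; rewrite 2!expnS mulnA => le3.
  by have := leq_trans (leq_pmulr (2 * 2) (_ : 0 < 2 ^ j)%N) le3; rewrite expn_gt0 => /(_ isT).
have wQ q x : q \in Q -> p'part (q x) = p'part x.
  move=> qQ; rewrite -lam_p'part ?QG //.
  apply: (fix2 _ (lamAction X)) => //; apply: leq_trans le2.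
  apply/subset_leq_card/subsetP=> _ /imsetP[h hQ ->] /=.
  by rewrite lam_p'part ?QG.
move=> x y; apply/eqP; apply: contraT => nxy.
pose Fb v := [set v' | p'part v' == p'part v].
have leF v : (#|Fb v| <= 2)%N.
  have [v' nv] : exists v', p'part v' != p'part v.
    have [e|nv] := eqVneq (p'part x) (p'part v); last by exists x.
    by exists y; rewrite -e eq_sym.
  have [g gP gv] := cabling_transitive p_pr cX trX v v'.
  have dis : [disjoint Fb v & g @: Fb v].
    apply/pred0P=> t /=; apply/andP=> [[tF /imsetP[t' t'F et]]].
    move: tF t'F; rewrite !inE => /eqP tv /eqP t'v; case/eqP: nv.
    by rewrite -tv et -gv -!lam_p'part ?PG // t'v.
  have : (#|Fb v| + #|g @: Fb v| <= 4)%N.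
    have := leq_card_setU (Fb v) (g @: Fb v).
    rewrite /leqif dis => [[_ /eqP <-]].
    have cX4 : #|X| = 4%N by rewrite cX p2.
    by rewrite -cX4 max_card.
  rewrite card_imset ?addnn; last exact: perm_inj.
  by rewrite -[4%N]/(2.*2)%N leq_double.
have Q1 : Q :=: 1%g.
  apply/trivgP/subsetP=> q qQ; rewrite inE; apply/eqP/permP=> v; rewrite perm1.
  apply: (fix2 _ ('P \ subsetT G)%act) => //; apply: leq_trans (leF v).
  by apply/subset_leq_card/subsetP=> _ /imsetP[h hQ ->]; rewrite inE wQ.
have id_m a : a *+ m = a.
  by apply: (hallGroup_trivial p_pr cX trX); rewrite Q1 norm1 subsetT.
by case/eqP: nxy; rewrite /p'part /pe !id_m !subrr.
Qed.

Lemma famValid_Phi : famValid 1 Phi.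
Proof.
split=> [||t|]; [exact: oner_neq0 | exact: Phi_even | by rewrite !mul1r | ].
case: (pickP (fun t => Phi t != Phi 0)) => [t tP|none]; first by exists t.
have [t /eqP[]] := Phi_step.
by rewrite (eqP (negbFE (none t))) (eqP (negbFE (none (t + 1)))).
Qed.

(** Now [sigma x = tau x * q], where [q] belongs to the common p'-part. As an automorphism of the
    cabling, [q] is affine by [famOp_iso]; its ratio [s] becomes the parameter [al]. *)
Lemma twisted_coords : exists (r' : F * F -> X) (al : F) (Phi' : F -> F),
  [/\ bijective r', famValid al Phi'
    & forall u v : F * F, cs_op (r' u) (r' v) = r' (famOp al Phi' u v)].
Proof.
have p'part_const x y : p'part x = p'part y.
  by case: (boolP (odd p)) => [/p'part_const_odd|/p'part_const_even]; apply.
pose w0 := p'part (r (0, 0)); pose q := val w0.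
have w0F g : g \in G -> lam g w0 = w0.
  by move=> gG; rewrite lam_p'part //; apply: p'part_const.
have eltE x : elt x = pe x + w0.
  by rewrite /w0 -(p'part_const x) /p'part addrC subrK.
have sE x : sigma x = (tau x * q)%g.
  by rewrite -[sigma x]/(val (elt x)) eltE val_braceD w0F ?PG ?peP.
have qG : q \in G by apply: val_permGroup.
have tq x : (tau x * q)%g = (q * tau (q x))%g.
  by rewrite -sE -[sigma x]/(val (elt x)) eltE addrC val_braceD lam_pe.
have [rho rK rhoK] := r_bij.
pose h u := rho (q (r u)).
have rh u : r (h u) = q (r u) by rewrite /h rhoK.
have r_fam (u v : F * F) : tau (r u) (r v) = r (famOp 1 Phi u v).
  by case: u v => [a c] [b d]; rewrite r_op /famOp /= !mul1r.
have h_inj : injective h.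
  by move=> u v e; apply: (bij_inj r_bij); apply: (@perm_inj _ q); rewrite -!rh e.
have h_fam (u v : F * F) : h (famOp 1 Phi u v) = famOp 1 Phi (h u) (h v).
  by apply: (bij_inj r_bij); rewrite rh -!r_fam -permM tq permM !rh.
have [s [be [s0 _ _ hE PhiE]]] := famOp_iso p_pr famValid_Phi famValid_Phi h_inj h_fam.
have qE (c d : F) : q (r (c, d)) = r (s * c + be, s * d) by rewrite -rh hE.
(* If [s = 1], then [q] translates the first coordinate by [be]; its order divides [#|Q|], which is
   prime to p, so [be = 0]. *)
have [ga gaE] : exists ga : F, s * ga + be = ga.
  have [s1|s1] := eqVneq s 1; last first.
    exists (be / (1 - s)); have s1' : 1 - s != 0 by rewrite subr_eq0 eq_sym.
    by apply: (mulIf s1'); rewrite mulrDl -mulrA divfK //; ring.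
  exists 0; rewrite mulr0 add0r.
  have qn (n : nat) : (q ^+ n)%g (r (0, 0)) = r (be * n%:R, 0).
    elim: n => [|n IHn]; first by rewrite perm1 mulr0.
    by rewrite expgSr permM IHn qE s1 !mul1r mulrSr mulrDr mulr1.
  have qQ : q \in Q by apply/hallGroupP; exists w0; rewrite ?p'part_p'primary.
  have /coords_inj[/eqP be0 _] : r (be * #|Q|%:R, 0) = r (0, 0).
    by rewrite -qn expg_cardG // perm1.
  move: be0; rewrite mulf_eq0 => /orP[/eqP //|].
  rewrite -(dvdn_pcharf (pchar_Fp p_pr)) => dQ.
  have := p'group_hallGroup X p_pr; rewrite /pgroup p'natE // => /negP[].
  exact: dQ.
(* The origin moves to a column fixed by [q]. Dividing by [s] cancels the factor that [q] puts on
   [x] in the first coordinate, and turns [s * Phi] into [s * s * Phi] in the second. *)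
pose r' (u : F * F) := r (u.1 + ga, u.2 / s).
exists r', s, (fun t => s * s * Phi t); split.
- exists (fun v => ((rho v).1 - ga, (rho v).2 * s)) => [[c d]|v].
    by rewrite rK /= addrK divfK.
  by rewrite /r' /= subrK mulfK // -surjective_pairing.
- have [_ even _ [t tP]] := famValid_Phi; split=> // [t'|t'|].
  + by rewrite even.
  + by rewrite PhiE; ring.
  by exists t; rewrite (inj_eq (mulfI _)) // mulf_neq0.
move=> [a x] [b y]; rewrite -sigmaE sE permM /r' r_op qE /famOp /=.
congr (r (_, _)).
  by rewrite -{2}gaE; field.
have -> : b + ga - (a + ga) = b - a by ring.
by field.
Qed.

End PrimaryCoords.

Theorem indecomposable_coords (p : nat) (X : cycleSet) :
  prime p -> #|X| = (p ^ 2)%N -> indecomposable X -> irretractable X ->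
  exists (r : 'F_p * 'F_p -> X) (al : 'F_p) (Phi : 'F_p -> 'F_p),
  [/\ bijective r, famValid al Phi
    & forall u v, cs_op (r u) (r v) = r (famOp al Phi u v)].
Proof.
move=> p_pr cX trX irrX.
have [r [Phi [r_bij r_op]]] := @pgroup_coords p (cabling X (primaryExp (brace X) p)) p_pr
  (pgroup_cabling X p_pr) cX (indecomposable_cabling p_pr cX trX)
  (irretractable_cabling p_pr cX trX irrX).
exact: (twisted_coords p_pr cX trX irrX r_bij r_op).
Qed.

(** * Isomorphism classes *)

Lemma isomorphic_sym (X Y : cycleSet) : isomorphic X Y -> isomorphic Y X.
Proof.
case=> f [g fK gK] fM; exists g; first by exists f.
by move=> x y; apply: (can_inj fK); rewrite fM !gK.
Qed.

Lemma isomorphic_trans (X Y Z : cycleSet) :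
  isomorphic X Y -> isomorphic Y Z -> isomorphic X Z.
Proof.
case=> f f_bij fM [g g_bij gM]; exists (g \o f); first exact: bij_comp.
by move=> x y; rewrite /= fM gM.
Qed.

Section FamilyCycleSet.
Variables (p : nat) (al : 'F_p) (Phi : 'F_p -> 'F_p).
Hypothesis p_pr : prime p.
Hypothesis V : famValid al Phi.
Local Open Scope ring_scope.
Notation F := 'F_p.

Fact famOp_bij (u : F * F) : bijective (famOp al Phi u).
Proof.
have [al0 _ _ _] := V; apply: injF_bij => [[b y] [b' y']] e.
have e1 : al * b + u.2 = al * b' + u.2 := congr1 fst e.
have e2 : al * y + Phi (b - u.1) = al * y' + Phi (b' - u.1) := congr1 snd e.
have eb : b = b' by apply: (mulfI al0); apply: addIr e1.
by move: e2; rewrite eb => /addIr/(mulfI al0)->.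
Qed.

Fact famOp_sq_bij : bijective (fun u : F * F => famOp al Phi u u).
Proof.
have [al0 _ _ _] := V; apply: injF_bij => [[b y] [b' y']] e.
have e1 : al * b + y = al * b' + y' := congr1 fst e.
have e2 : al * y + Phi (b - b) = al * y' + Phi (b' - b') := congr1 snd e.
move: e2 e1; rewrite !subrr => /addIr/(mulfI al0) ->.
by move/addIr/(mulfI al0)->.
Qed.

Definition famCycleSet : cycleSet :=
  @CycleSet (F * F)%type (famOp al Phi) (fun u v w => famOp_law u v w V) famOp_bij famOp_sq_bij.
Notation X := famCycleSet.

Lemma card_famCycleSet : #|X| = (p ^ 2)%N.
Proof. by rewrite card_prod card_Fp. Qed.

(** Equal permutations force [x = y] and make [a - b] a period of [Phi]; a nonzero period would make
    [Phi] constant. *)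
Lemma irretractable_famCycleSet : irretractable X.
Proof.
move=> [a x] [b y] /permP e; have {}e (v : F * F) : famOp al Phi (a, x) v = famOp al Phi (b, y) v.
  by have := e v; rewrite !sigmaE.
have e1 : al * 0 + x = al * 0 + y := congr1 fst (e (0, 0)).
move/addrI: e1 => ->; suff -> : a = b by [].
apply/eqP; rewrite -subr_eq0; apply: contraT => ab.
have [_ _ _ [t]] := V; rewrite (@step_affine p Phi _ 0 ab) => [|t'].
  by rewrite mul0r mul0r addr0 eqxx.
have e2 : al * 0 + Phi (t' + a - a) = al * 0 + Phi (t' + a - b) := congr1 snd (e (t' + a, 0)).
by move/addrI: e2; rewrite addrK addrA addr0 => ->.
Qed.

(** [g] moves the points of column 0 vertically by the nonzero [d], and [f] shifts horizontally, so
    together they reach every point from the origin. *)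
Lemma indecomposable_famCycleSet : indecomposable X.
Proof.
have [al0 _ _ [t tP]] := V; pose d := Phi t - Phi 0; have d0 : d != 0 by rewrite subr_eq0.
pose s0 : {perm X} := sigma ((0, 0) : X).
have sE (u v : X) : sigma u v = famOp al Phi u v by rewrite sigmaE.
have sG u := @sigma_permGroup X u.
have s0V (b y : F) : (s0^-1)%g ((b, y) : X) = (b / al, (y - Phi (b / al)) / al).
  apply: (can_inj (permK s0)); rewrite permKV sE famOpE subr0 addr0.
  by congr pair; field.
pose f : {perm X} := (s0^-1 * sigma ((0, 1)%R : X))%g.
have fE (b y : F) : f ((b, y) : X) = (b + 1, y).
  by rewrite permM s0V sE famOpE subr0; congr pair; field.
pose g : {perm X} := (s0^-1 * sigma ((- t, 0)%R : X))%g.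
have gE (y : F) : g ((0, y) : X) = (0, y + d).
  rewrite permM s0V sE famOpE mul0r opprK add0r addr0 mulr0.
  by congr pair; rewrite /d; field.
have fX (b y : F) (n : nat) : (f ^+ n)%g ((b, y) : X) = (b + n%:R, y).
  elim: n b => [|n IHn] b; first by rewrite perm1 addr0.
  by rewrite expgS permM fE IHn mulrS addrA.
have gX (y : F) (n : nat) : (g ^+ n)%g ((0, y) : X) = (0, y + d *+ n).
  elim: n y => [|n IHn] y; first by rewrite perm1 addr0.
  by rewrite expgS permM gE IHn -addrA -mulrS.
apply/imsetP; exists ((0, 0) : X) => //; apply/setP=> [[b y]]; rewrite inE.
apply/esym/imsetP; exists (g ^+ (y / d : F)%R * f ^+ b)%g.
  by rewrite groupM // groupX // groupM ?groupV ?sG.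
apply: esym; change ((g ^+ (y / d : F)%R * f ^+ b)%g ((0, 0) : X) = (b, y)).
by rewrite permM gX fX !add0r natr_Fp_val -mulr_natr natr_Fp_val mulrC divfK.
Qed.

End FamilyCycleSet.

Section IsoFamily.
Variables (p : nat) (al al' : 'F_p) (Phi Phi' : 'F_p -> 'F_p).
Hypothesis p_pr : prime p.
Hypothesis V : famValid al Phi.
Hypothesis V' : famValid al' Phi'.
Local Open Scope ring_scope.

Lemma isomorphic_famCycleSetP :
  isomorphic (famCycleSet V) (famCycleSet V') <->
  al' = al /\ exists2 s : 'F_p, s != 0 & forall t, Phi' (s * t) = s * Phi t.
Proof.
split=> [[h h_bij hM]|[eal [s s0 sP]]].
  have [s [be [s0 -> _ _ sP]]] := famOp_iso p_pr V V' (bij_inj h_bij) hM.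
  by split=> //; exists s.
exists (fun u : famCycleSet V => (s * u.1, s * u.2) : famCycleSet V').
  exists (fun u : famCycleSet V' => (u.1 / s, u.2 / s) : famCycleSet V) => [[a x]|[a x]] /=.
    by congr pair; field.
  by congr pair; field.
move=> [a x] [b y]; rewrite /cs_op /= !famOpE eal -mulrBr sP.
by congr pair; ring.
Qed.

End IsoFamily.

(** * Parameters and the scaling action of the units *)

Section Orbits.
Variable p : nat.
Hypothesis p_pr : prime p.
Local Open Scope ring_scope.
Notation F := 'F_p.
Notation U := {unit 'F_p}.
Notation param := (U * {ffun F -> F})%type.

Definition validParam (w : param) : bool :=
  [&& [forall t, w.2 (- t) == w.2 t],
      [forall t, w.2 (FinRing.uval w.1 * t) == FinRing.uval w.1 * w.2 t]
    & [exists t, w.2 t != w.2 0]].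

Lemma unitF_neq0 (s : U) : FinRing.uval s != 0.
Proof. by rewrite -unitfE; apply: valP. Qed.

Lemma validParamP (w : param) : reflect (famValid (FinRing.uval w.1) w.2) (validParam w).
Proof.
apply: (iffP and3P) => [[/forallP ev /forallP lin /existsP nc]|[_ ev lin nc]].
  by split=> // [|t|t]; [apply: unitF_neq0 | apply/eqP | apply/eqP].
by split=> //; [apply/forallP=> t; rewrite ev | apply/forallP=> t; rewrite lin | apply/existsP].
Qed.

(** The second component is the solution [Phi'] of [Phi' (s * t) = s * Phi t]. *)
Definition scaleParam (w : param) (s : U) : param :=
  (w.1, [ffun t => FinRing.uval s * w.2 ((FinRing.uval s)^-1 * t)]).

Fact scaleParam_is_action : is_action [set: {unit F}] scaleParam.
Proof.
apply: is_total_action => [[al Phi]|[al Phi] s s'].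
  by congr pair; apply/ffunP=> t; rewrite ffunE /= invr1 !mul1r.
congr pair; apply/ffunP=> t; rewrite !ffunE /= invrM ?(valP s) ?(valP s') //.
by rewrite [RHS]mulrA; congr (_ * Phi _); [apply: mulrC | rewrite -mulrA mulrCA].
Qed.

Definition paramAction := Action scaleParam_is_action.
Definition validParams : {set param} := [set w | validParam w].
Definition paramOrbits := orbit paramAction [set: {unit F}] @: validParams.

Lemma famCycleSet_isoP (w w' : param) (V : famValid (FinRing.uval w.1) w.2)
    (V' : famValid (FinRing.uval w'.1) w'.2) :
  isomorphic (famCycleSet V) (famCycleSet V') <->
  w' \in orbit paramAction [set: {unit F}] w.
Proof.
rewrite isomorphic_famCycleSetP //; split=> [[e [s s0 sP]]|/imsetP[s _ ->]].
  have us : s \is a GRing.unit by rewrite unitfE.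
  apply/imsetP; exists (FinRing.unit F us) => //.
  rewrite [LHS]surjective_pairing (val_inj e); congr pair; apply/ffunP=> t.
  by rewrite ffunE /= -sP mulrA divff // mul1r.
split=> //; exists (FinRing.uval s); first exact: unitF_neq0.
by move=> t; rewrite ffunE /= mulrA mulVr ?mul1r //; apply: valP.
Qed.

Lemma acts_validParams : [acts [set: {unit F}], on validParams | paramAction]%g.
Proof.
apply/actsP=> s _ w; rewrite !inE.
have act_valid w' (s' : {unit F}) : validParam w' -> validParam (paramAction w' s').
  have u0 := unitF_neq0 s'.
  case/validParamP=> al0 ev lin [t nc]; apply/validParamP; split=> // [t'|t'|] /=.
  - by rewrite !ffunE mulrN ev.
  - by rewrite !ffunE [_^-1 * (_ * _)]mulrCA lin mulrCA.
  exists (FinRing.uval s' * t); rewrite !ffunE mulr0 mulrA mulVf // mul1r.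
  by rewrite (inj_eq (mulfI u0)).
apply/idP/idP; last exact: act_valid.
by move/(act_valid _ s^-1%g); rewrite -[paramAction _ _]/(paramAction _ s^-1%g) actK.
Qed.

Lemma isoClassCount_paramOrbits :
  isoClassCount (indecIrretrOfSize (p ^ 2)) #|paramOrbits|.
Proof.
have pick_rep (i : 'I_#|paramOrbits|) : exists w : param,
    validParam w && (enum_val i == orbit paramAction [set: {unit F}] w).
  by have /imsetP[w] := enum_valP i; rewrite inE => Vw ->; exists w; rewrite Vw eqxx.
pose w i := xchoose (pick_rep i).
have wV i : famValid (FinRing.uval (w i).1) (w i).2.
  by apply/validParamP; have /andP[] := xchooseP (pick_rep i).
have wE i : enum_val i = orbit paramAction [set: {unit F}] (w i).
  by apply/eqP; have /andP[] := xchooseP (pick_rep i).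
exists (fun i => famCycleSet (wV i)); split.
- move=> i; split; first exact: card_famCycleSet.
    exact: indecomposable_famCycleSet.
  exact: irretractable_famCycleSet.
- move=> i j /famCycleSet_isoP ij; apply: enum_val_inj; rewrite !wE.
  by apply/esym/orbit_in_eqP; rewrite ?subsetT.
move=> X [cX trX irrX].
have [r [al [Phi [r_bij V rM]]]] := indecomposable_coords p_pr cX trX irrX.
have al_unit : al \is a GRing.unit by rewrite unitfE; case: V.
pose w0 : param := (FinRing.unit F al_unit, [ffun t => Phi t]).
have V0 : famValid (FinRing.uval w0.1) w0.2.
  case: V => al0 ev lin [t nc]; split=> // [t'|t'|]; rewrite ?ffunE //.
  by exists t; rewrite !ffunE.
have isoX : isomorphic X (famCycleSet V0).
  apply: isomorphic_sym; exists r => // u v; rewrite -/(cs_op _ _) rM.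
  by rewrite /cs_op /= /famOp ffunE.
have O0 : orbit paramAction [set: {unit F}] w0 \in paramOrbits.
  by apply: imset_f; rewrite inE; apply/validParamP.
have [i ei] : exists i : 'I_#|paramOrbits|, enum_val i = orbit paramAction [set: {unit F}] w0.
  by exists (enum_rank_in O0 (orbit paramAction [set: {unit F}] w0)); rewrite enum_rankK_in.
exists i; apply: (isomorphic_trans isoX); apply/famCycleSet_isoP.
by rewrite -ei wE; apply: orbit_refl.
Qed.

End Orbits.

(** * The function psi *)

Section DivisorSums.
Implicit Types (n m d e : nat).

Lemma perm_divisors n s : 0 < n -> uniq s -> (forall d, (d \in s) = (d %| n)) ->
  perm_eq (divisors n) s.
Proof.
move=> n_gt0 us ds; apply: uniq_perm => // [|d]; first exact: divisors_uniq.
by rewrite ds -dvdn_divisors.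
Qed.

Lemma sum_divisors_dvd n m (G : nat -> nat) : 0 < n -> m %| n ->
  \sum_(e <- divisors m) G e = \sum_(e <- divisors n | e %| m) G e.
Proof.
move=> n_gt0 mn; rewrite -[RHS]big_filter; apply/perm_big/perm_divisors.
- exact: dvdn_gt0 mn.
- by rewrite filter_uniq ?divisors_uniq.
move=> d; rewrite mem_filter -dvdn_divisors //.
by case dm: (d %| m) => //=; apply: dvdn_trans mn.
Qed.

Lemma sum_divisors_mul n e (G : nat -> nat) : 0 < n -> e %| n ->
  \sum_(d <- divisors n | e %| d) G d = \sum_(c <- divisors (n %/ e)) G (e * c).
Proof.
move=> n_gt0 en; have e_gt0 := dvdn_gt0 n_gt0 en.
have ne_gt0 : 0 < n %/ e by rewrite divn_gt0 ?(dvdn_leq n_gt0).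
rewrite -[RHS](big_map (muln e) xpredT) -big_filter.
apply/perm_big/uniq_perm; first by rewrite filter_uniq ?divisors_uniq.
  rewrite map_inj_uniq ?divisors_uniq // => c c' /eqP.
  by rewrite eqn_pmul2l // => /eqP.
move=> d; rewrite mem_filter -dvdn_divisors //; apply/andP/mapP => [[ed dn]|[c]].
  exists (d %/ e); last by rewrite mulnC divnK.
  rewrite -dvdn_divisors //.
  by rewrite -(dvdn_pmul2l e_gt0) ![e * _]mulnC !divnK.
rewrite -dvdn_divisors // => cn ->.
by rewrite dvdn_mulr // -(divnK en) [_ * e]mulnC dvdn_pmul2l.
Qed.

Lemma sum_divisors_conv n (F : nat -> nat -> nat) : 0 < n ->
  \sum_(d <- divisors n) \sum_(e <- divisors d) F e (d %/ e) =
  \sum_(e <- divisors n) \sum_(c <- divisors (n %/ e)) F e c.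
Proof.
move=> n_gt0.
under eq_big_seq => d.
  rewrite -dvdn_divisors // => dn; rewrite (sum_divisors_dvd _ n_gt0 dn); over.
rewrite (exchange_big_dep predT) //=; apply: eq_big_seq => e.
rewrite -dvdn_divisors // => en; rewrite sum_divisors_mul //.
by apply: eq_bigr => c _; rewrite mulKn // (dvdn_gt0 n_gt0 en).
Qed.

Lemma sum_divisors_rev n (G : nat -> nat) : 0 < n ->
  \sum_(d <- divisors n) G (n %/ d) = \sum_(d <- divisors n) G d.
Proof.
move=> n_gt0; rewrite -[LHS](big_map (divn n) xpredT).
apply/esym/perm_big/perm_divisors => //.
  rewrite map_inj_in_uniq ?divisors_uniq // => d d'; rewrite -!dvdn_divisors // => dn d'n e.
  have nd_gt0 : 0 < n %/ d by rewrite divn_gt0 ?(dvdn_gt0 n_gt0 dn) ?(dvdn_leq n_gt0).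
  apply/eqP; rewrite -(eqn_pmul2l nd_gt0) divnK // e divnK //.
have divK c : c %| n -> n %/ (n %/ c) = c.
  move=> cn; rewrite -{1}(divnK cn) mulKn //.
  by rewrite divn_gt0 ?(dvdn_gt0 n_gt0 cn) ?(dvdn_leq n_gt0).
have div_dvd c : c %| n -> n %/ c %| n by move=> cn; rewrite -{2}(divnK cn) dvdn_mulr.
move=> d; apply/mapP/idP => [[c]|dn].
  by rewrite -dvdn_divisors // => cn ->; apply: div_dvd.
by exists (n %/ d); rewrite ?divK // -dvdn_divisors // div_dvd.
Qed.

Lemma sum_divisors_coprime m n (G : nat -> nat) : 0 < m -> 0 < n -> coprime m n ->
  \sum_(d <- divisors (m * n)) G d =
  \sum_(a <- divisors m) \sum_(b <- divisors n) G (a * b).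
Proof.
move=> m_gt0 n_gt0 mn; rewrite -(big_allpairs_dep (h := muln) (r2 := fun=> divisors n)).
apply/perm_big/perm_divisors; first by rewrite muln_gt0 m_gt0.
  apply: allpairs_uniq; rewrite ?divisors_uniq // => u w.
  case/allpairsP=> [[a b] [/= + + ->]] /allpairsP[[a' b'] [/= + + ->]] /=.
  rewrite -!dvdn_divisors // => am bn a'm b'n e.
  have ea : a = a'.
    have gE c d : c %| m -> d %| n -> gcdn m (c * d) = c.
      move=> cm dn; rewrite Gauss_gcdl; first by apply/gcdn_idPr.
      exact: coprime_dvdr dn mn.
    by rewrite -(gE a b) // e gE.
  have a_gt0 := dvdn_gt0 m_gt0 am.
  by move/eqP: e; rewrite -ea eqn_pmul2l // => /eqP ->.
move=> d; apply/allpairsP/idP => [[[a b] [/= + + ->]]|dmn].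
  by rewrite -!dvdn_divisors // => am bn; apply: dvdn_mul.
have d_gt0 : 0 < d by apply: dvdn_gt0 dmn; rewrite muln_gt0 m_gt0.
have pim : \pi(m).-nat m by apply: pnat_pi.
have pin : \pi(m)^'.-nat n by rewrite -coprime_pi'.
have mn_gt0 : 0 < m * n by rewrite muln_gt0 m_gt0.
have em : (m * n)`_\pi(m) = m.
  by rewrite partnM // (part_pnat_id pim) (part_p'nat pin) muln1.
have en : (m * n)`_\pi(m)^' = n.
  by rewrite partnM // (part_pnat_id pin) part_p'nat ?mul1n // pnatNK.
(* The two factors are the parts of [d] at the primes of [m] and at the other primes. *)
exists (d`_\pi(m), d`_\pi(m)^') => /=; rewrite -!dvdn_divisors // partnC //.
by split=> //; [rewrite -{2}em | rewrite -en]; apply: partn_dvd.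
Qed.

Lemma sum_totient_divisors n : 0 < n -> \sum_(d <- divisors n) totient d = n.
Proof.
move=> n_gt0; rewrite -[RHS]sum_totient_dvd.
rewrite -(big_mkord (fun d => d %| n) totient) -[RHS]big_filter.
apply/perm_big/perm_divisors => //; first by rewrite filter_uniq ?iota_uniq.
move=> d; rewrite mem_filter mem_index_iota /=.
by case dn: (d %| n) => //=; rewrite ltnS dvdn_leq.
Qed.

(** [psi] is the Dirichlet convolution of [d * totient d] with [totient]. Summing the second factor
    over divisors gives [n %/ e], which leaves [n] times the totient sum of [n]. *)
Lemma sum_psi n : 0 < n -> \sum_(d <- divisors n) psi d = n ^ 2.
Proof.
move=> n_gt0; rewrite /psi (sum_divisors_conv (fun e c => e * totient e * totient c)) //.
transitivity (\sum_(e <- divisors n) n * totient e).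
  apply: eq_big_seq => e; rewrite -dvdn_divisors // => en.
  rewrite -big_distrr /= sum_totient_divisors; last first.
    by rewrite divn_gt0 ?(dvdn_gt0 n_gt0 en) ?(dvdn_leq n_gt0).
  by rewrite mulnAC [e * _]mulnC divnK.
by rewrite -big_distrr /= sum_totient_divisors.
Qed.

Lemma psi_mul m n : 0 < m -> 0 < n -> coprime m n -> psi (m * n) = psi m * psi n.
Proof.
move=> m_gt0 n_gt0 mn; rewrite /psi sum_divisors_coprime // big_distrl /=.
apply: eq_big_seq => a; rewrite -dvdn_divisors // => am; rewrite big_distrr /=.
apply: eq_big_seq => b; rewrite -dvdn_divisors // => bn.
have cab : coprime a b := coprime_dvdl am (coprime_dvdr bn mn).
have cq : coprime (m %/ a) (n %/ b).
  by apply: coprime_dvdl (coprime_dvdr _ mn); rewrite dvdn_div.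
have -> : m * n %/ (a * b) = (m %/ a) * (n %/ b).
  rewrite -{1}(divnK am) -{1}(divnK bn) mulnACA mulnK //.
  by rewrite muln_gt0 (dvdn_gt0 m_gt0 am) (dvdn_gt0 n_gt0 bn).
by rewrite !totient_coprime //; lia.
Qed.

(** This is the difference of the sums [sum_psi] at two consecutive powers of [q]. *)
Lemma psi_pfactor q v : prime q -> psi (q ^ v.+1) = (q ^ 2 - 1) * q ^ (2 * v).
Proof.
move=> q_pr; have q_gt0 := prime_gt0 q_pr.
have sumE w (G : nat -> nat) : \sum_(d <- divisors (q ^ w)) G d = \sum_(i < w.+1) G (q ^ i).
  rewrite -(big_mkord xpredT (fun i => G (q ^ i))) -(big_map (expn q) xpredT).
  apply/perm_big/perm_divisors; first by rewrite expn_gt0 q_gt0.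
    rewrite map_inj_uniq ?iota_uniq // => i j /eqP.
    by rewrite eqn_exp2l ?prime_gt1 // => /eqP.
  move=> d; apply/mapP/(dvdn_pfactor _ _ q_pr) => [[i]|[i]].
    by rewrite mem_index_iota /= => iw ->; exists i.
  by move=> iw ->; exists i; rewrite ?mem_index_iota.
have S w : \sum_(i < w.+1) psi (q ^ i) = q ^ (2 * w).
  by rewrite -sumE sum_psi ?expn_gt0 ?q_gt0 // -expnM mulnC.
have := S v.+1; rewrite big_ord_recr /= S => e.
apply: (@addnI (q ^ (2 * v))); rewrite e mulnBl mul1n subnKC; last first.
  by rewrite leq_pmull // expn_gt0 q_gt0.
by rewrite -expnD; congr expn; lia.
Qed.

Lemma psi_prod n : 0 < n ->
  psi n = \prod_(q <- primes n) ((q ^ 2 - 1) * q ^ (2 * logn q n - 2)).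
Proof.
elim/ltn_ind: n => n IHn n_gt0; have [n1|n1] := leqP n 1.
  have -> : n = 1 by apply/eqP; rewrite eqn_leq n1.
  by rewrite /psi !big_cons !big_nil.
pose q := pdiv n; have q_pr : prime q := pdiv_prime n1.
have qn : q %| n := pdiv_dvd n.
have nE := partnC q n_gt0; set m := n`_q^' in nE; set v := logn q n.
have m_gt0 : 0 < m by apply: part_gt0.
have v_gt0 : 0 < v by rewrite logn_gt0 mem_primes q_pr n_gt0.
have pE : n`_q = q ^ v by apply: p_part.
have cqm : coprime q m.
  by apply: (@pnat_coprime q); rewrite ?pnat_id ?part_pnat.
have mn : m < n.
  rewrite -[n in _ < n]nE pE ltn_Pmull // -(expn0 q) ltn_exp2l ?prime_gt1 //.
have {}nE : n = q ^ v * m by rewrite -pE nE.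
rewrite [in LHS]nE psi_mul ?expn_gt0 ?m_gt0 ?(prime_gt0 q_pr) ?coprimeXl //.
have -> : psi (q ^ v) = (q ^ 2 - 1) * q ^ (2 * v - 2).
  by rewrite -(prednK v_gt0) psi_pfactor //; congr (_ * q ^ _); lia.
rewrite IHn //.
have pe : perm_eq (primes n) (q :: primes m).
  apply: uniq_perm; rewrite /= ?primes_uniq ?andbT //.
    by rewrite mem_primes q_pr m_gt0 /= -prime_coprime.
  move=> r; rewrite inE {1}nE primesM ?expn_gt0 ?m_gt0 ?(prime_gt0 q_pr) //.
  by rewrite primesX // primes_prime // inE.
rewrite (perm_big _ pe) big_cons; congr (_ * _); apply: eq_big_seq => r rm.
have [r_pr _ rdm] : [/\ prime r, 0 < m & r %| m] by move: rm; rewrite mem_primes => /and3P.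
have rq : r != q by apply: contraTneq rdm => ->; rewrite -prime_coprime.
suff -> : logn r n = logn r m by [].
rewrite nE lognM ?expn_gt0 ?m_gt0 ?(prime_gt0 q_pr) // lognX.
by rewrite logn_prime // (negPf rq) muln0.
Qed.

End DivisorSums.

(** * Counting orbits *)

Section FiberSums.

Lemma sum_fiber (T : finType) (S : {set T}) (f : T -> nat) (s : seq nat) (h : nat -> nat) :
  uniq s -> (forall w, w \in S -> f w \in s) ->
  \sum_(w in S) h (f w) = \sum_(d <- s) #|[set w in S | f w == d]| * h d.
Proof.
move=> us fs.
transitivity (\sum_(w in S) \sum_(d <- s | f w == d) h d).
  apply: eq_bigr => w wS; rewrite (big_rem _ (fs w wS)) /= eqxx big1_seq ?addn0 //.
  by move=> d /andP[/eqP <-]; rewrite mem_rem_uniq // inE eqxx.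
rewrite (exchange_big_dep predT) //=; apply: eq_bigr => d _.
rewrite -sum1_card big_distrl /=; apply: eq_big => [w|w _]; rewrite ?inE ?mul1n //.
Qed.

End FiberSums.

(** * Pairs of elements generating a subgroup of a cyclic group *)

Section CyclicPairs.
Variables (gT : finGroupType) (G : {group gT}).
Hypothesis cycG : cyclic G.
Local Open Scope group_scope.

Lemma cyclic_torsion e : e %| #|G| ->
  exists2 H : {group gT}, #|H| = e & forall x, (x \in H) = (x \in G) && (x ^+ e == 1).
Proof.
have /cyclicP[a defG] := cycG; rewrite defG -orderE => ea.
have a_gt0 := order_gt0 a; have e_gt0 := dvdn_gt0 a_gt0 ea.
have ae_gt0 : 0 < #[a] %/ e by rewrite divn_gt0 ?(dvdn_leq a_gt0).
have oH : #[a ^+ (#[a] %/ e)] = e.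
  by rewrite orderXdiv ?dvdn_div // -{1}(divnK ea) mulKn.
exists <[a ^+ (#[a] %/ e)]>%G => [|x]; first by rewrite -orderE.
apply/idP/andP => [xH|[/cycleP[i ->]]].
  split; first by move: x xH; apply/subsetP; rewrite cycle_subG mem_cycle.
  by rewrite -order_dvdn -oH order_dvdG.
rewrite -expgM -order_dvdn -{1}(divnK ea) dvdn_pmul2r // => /dvdnP[j ->].
by rewrite mulnC expgM mem_cycle.
Qed.

Definition pairGen (w : gT * gT) : {group gT} := <<[set w.1; w.2]>>%G.

Lemma card_pairGen_dvd x y e : x \in G -> y \in G -> e %| #|G| ->
  (#|pairGen (x, y)| %| e) = (x ^+ e == 1) && (y ^+ e == 1).
Proof.
move=> xG yG eG; have [H oH HE] := cyclic_torsion eG.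
apply/idP/andP => [de|[xe ye]].
  split; rewrite -order_dvdn; apply: dvdn_trans de; apply: order_dvdG.
    by apply: mem_gen; rewrite !inE eqxx.
  by apply: mem_gen; rewrite !inE eqxx orbT.
rewrite -oH cardSg // gen_subG; apply/subsetP=> t.
by rewrite !inE => /orP[]/eqP->; rewrite HE ?xG ?yG.
Qed.

(** The pairs that generate a subgroup of order dividing [e] are those inside the subgroup of order
    [e], so these counts and [psi] both have divisor sum [e ^ 2]; induction separates the terms. *)
Lemma card_pairGen e : e %| #|G| ->
  #|[set w in setX G G | #|pairGen w| == e]| = psi e.
Proof.
elim/ltn_ind: e => e IHe eG; have e_gt0 := dvdn_gt0 (cardG_gt0 G) eG.
have sumE : \sum_(d <- divisors e) #|[set w in setX G G | #|pairGen w| == d]| = (e ^ 2)%N.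
  have [H oH HE] := cyclic_torsion eG.
  have -> : (e ^ 2)%N = #|setX H H| by rewrite cardsX oH.
  pose S := [set w in setX G G | #|pairGen w| %| e].
  have <- : S = setX H H.
    apply/setP=> [[x y]]; rewrite !inE /= !HE.
    case xG: (x \in G) => //=; case yG: (y \in G) => //=; last by rewrite andbF.
    by rewrite card_pairGen_dvd.
  rewrite -[RHS]sum1_card.
  rewrite (@sum_fiber _ S (fun w => #|pairGen w|) (divisors e) (fun=> 1%N)) ?divisors_uniq //.
    apply: eq_big_seq => d; rewrite -dvdn_divisors // => de; rewrite muln1.
    apply: eq_card => w; rewrite [LHS]inE [RHS]inE [w \in S]inE -andbA; congr (_ && _).
    by case: eqP => [->|]; rewrite ?de ?andbF.
  by move=> w; rewrite inE -dvdn_divisors // => /andP[].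
have := sum_psi e_gt0; rewrite -sumE.
have ee : e \in divisors e by rewrite -dvdn_divisors.
rewrite !(big_rem _ ee) /= => /eqP.
have -> : \sum_(d <- rem e (divisors e)) #|[set w in setX G G | #|pairGen w| == d]| =
    \sum_(d <- rem e (divisors e)) psi d.
  apply: eq_big_seq => d; rewrite mem_rem_uniq ?divisors_uniq // inE.
  case/andP=> nde; rewrite -dvdn_divisors // => de; apply: IHe (dvdn_trans de eG).
  by rewrite ltn_neqAle nde dvdn_leq.
by rewrite eqn_add2r => /eqP.
Qed.

Lemma sum_pairGen (h : nat -> nat) :
  \sum_(x in G) \sum_(y in G) h #|pairGen (x, y)| =
  \sum_(e <- divisors #|G|) psi e * h e.
Proof.
rewrite pair_big /=.
transitivity (\sum_(w in setX G G) h #|pairGen w|).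
  by apply: eq_big => [[x y]|[x y] _] //=; rewrite inE.
rewrite (@sum_fiber _ _ (fun w => #|pairGen w|) (divisors #|G|)) ?divisors_uniq //.
  by apply: eq_big_seq => d; rewrite -dvdn_divisors ?cardG_gt0 // => dG; rewrite card_pairGen.
move=> [x y] /setXP[xG yG]; rewrite -dvdn_divisors ?cardG_gt0 //.
rewrite cardSg // gen_subG; apply/subsetP=> t.
by rewrite !inE => /orP[]/eqP->.
Qed.

End CyclicPairs.

(** * Functions equivariant under a subgroup *)

Section Equivariant.
Variables (gT : finGroupType) (H : {group gT}) (F : finNzRingType) (chi : gT -> F).
Hypothesis chi1 : chi 1%g = 1%R.
Hypothesis chiM : {in H &, {morph chi : g h / (g * h)%g >-> (g * h)%R}}.
Local Open Scope group_scope.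

(** The values at coset representatives can be prescribed freely and determine the function. *)
Lemma card_equivariant :
  #|[set Psi : {ffun gT -> F} |
      [forall h in H, forall t, Psi (h * t) == (chi h * Psi t)%R]]| =
  (#|F| ^ #|[set: gT] : H|)%N.
Proof.
set E := [set Psi | _]; pose S := rcosets H [set: gT].
(* The default 0 at sets that are not cosets makes the image exactly the functions supported on
   [S]. *)
pose restr (Psi : {ffun gT -> F}) : {ffun {set gT} -> F} :=
  [ffun C => if C \in S then Psi (repr C) else 0%R].
have EP (Psi : {ffun gT -> F}) : reflect (forall h t, h \in H -> Psi (h * t) = (chi h * Psi t)%R) (Psi \in E).
  rewrite inE; apply: (iffP forall_inP) => [Ps h t hH|Ps h hH].
    exact/eqP/(forallP (Ps h hH)).
  by apply/forallP=> t; rewrite Ps.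
have SH t : H :* t \in S by apply/rcosetsP; exists t.
have reprE t : exists2 h, h \in H & t = h * repr (H :* t).
  case: repr_rcosetP => h hH; exists h^-1; rewrite ?groupV //.
  by rewrite mulKg.
have restr_inj : {in E &, injective restr}.
  move=> Psi Psi' /EP EPsi /EP EPsi' e; apply/ffunP=> t.
  have [h hH ->] := reprE t; rewrite EPsi // EPsi' //.
  by have := congr1 (fun g : {ffun _ -> _} => g (H :* t)) e; rewrite !ffunE SH => ->.
rewrite -(card_in_imset restr_inj) -(card_pffun_on 0%R S predT).
apply: eq_card => g; apply/imsetP/pffun_onP => [[Psi _ ->]|[supp _]].
  split=> [|//]; apply/subsetP=> C; rewrite inE ffunE.
  by case: ifP => // _; rewrite eqxx.
pose Psi : {ffun gT -> F} := [ffun t => (chi (t * (repr (H :* t))^-1) * g (H :* t))%R].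
have EPsi : Psi \in E.
  apply/EP=> h t hH; rewrite !ffunE.
  have -> : H :* (h * t) = H :* t by rewrite rcosetM rcoset_id.
  have [h' h'H e] := reprE t.
  rewrite mulrA -chiM //; first by rewrite !mulgA.
  by rewrite {1}e mulgK.
exists Psi => //; apply/ffunP=> C; rewrite ffunE.
case: ifP => [/rcosetsP[t _ ->]|C'S].
  have e : H :* repr (H :* t) = H :* t by apply: rcoset_repr.
  by rewrite ffunE e mulgV chi1 mul1r.
apply/eqP; apply: contraFT C'S => gC; apply: (subsetP supp).
by rewrite inE.
Qed.

End Equivariant.

(** * Even equivariant functions on F_p *)

Section SemiInvariants.
Variable p : nat.
Hypothesis p_pr : prime p.
Local Open Scope ring_scope.
Notation F := 'F_p.
Notation U := {unit 'F_p}.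
Notation uval := FinRing.uval.

Definition semiInv (D : {set U}) : {set {ffun F -> F}} :=
  [set Phi : {ffun F -> F} | [&& Phi 0 == 0, [forall t, Phi (- t) == Phi t]
    & [forall c in D, forall t, Phi (uval c * t) == uval c * Phi t]]].

Lemma semiInvP (D : {set U}) (Phi : {ffun F -> F}) :
  reflect [/\ Phi 0 = 0, forall t, Phi (- t) = Phi t
            & forall c t, c \in D -> Phi (uval c * t) = uval c * Phi t]
          (Phi \in semiInv D).
Proof.
rewrite inE; apply: (iffP and3P) => [[/eqP P0 /forallP ev /forall_inP eqv]|[P0 ev eqv]].
  by split=> // [t|c t cD]; [apply/eqP | apply/eqP/(forallP (eqv c cD))].
split; [exact/eqP | by apply/forallP=> t; rewrite ev |].
by apply/forall_inP=> c cD; apply/forallP=> t; rewrite eqv.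
Qed.

(** The units under which a given [Phi] is equivariant form a group. *)
Lemma semiInv_gen (A : {set U}) : semiInv <<A>>%g = semiInv A.
Proof.
apply/setP=> Phi; apply/semiInvP/semiInvP => -[P0 ev eqv]; split=> // c t cA.
  by apply: eqv; apply: mem_gen.
pose S := [set c : U | [forall t, Phi (uval c * t) == uval c * Phi t]].
have SP (c' : U) : reflect (forall t, Phi (uval c' * t) = uval c' * Phi t) (c' \in S).
  by rewrite inE; apply: (iffP forallP) => H t'; apply/eqP; rewrite ?H.
have gS : group_set S.
  apply/group_setP; split=> [|c1 c2 /SP h1 /SP h2]; first by apply/SP=> t'; rewrite /= !mul1r.
  by apply/SP=> t'; rewrite /= -!mulrA h1 h2.
have sAS : <<A>>%g \subset Group gS.
  by rewrite gen_subG; apply/subsetP=> c' c'A; apply/SP=> t'; apply: eqv.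
by have /SP := subsetP sAS _ cA.
Qed.

Lemma card_units : #|[set: U]| = (p - 1)%N.
Proof. by rewrite card_finField_unit card_Fp // subn1. Qed.

Lemma cyclic_units : cyclic [set: U].
Proof. exact: field_unit_group_cyclic. Qed.

Definition minus1 : U := FinRing.unit F (unitrN1 F).

Hypothesis odd_p : odd p.

Lemma one_neqN1 : (1 : F) != -1.
Proof. by rewrite -subr_eq0 opprK -mulr2n F_two_neq0. Qed.

Lemma order_minus1 : #[minus1]%g = 2.
Proof.
apply: nt_prime_order => //; first by apply: val_inj; rewrite /= mulrNN mulr1.
apply/eqP=> /(congr1 (fun u : U => uval u)) /=; move=> e.
by case/eqP: one_neqN1.
Qed.

Lemma minus1_in_even (D : {group U}) : ~~ odd #|D| -> minus1 \in D.
Proof.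
rewrite -dvdn2 => /(Cauchy (isT : prime 2))[x xD x2].
suff -> : minus1 = x by [].
apply: val_inj => /=; have : uval x ^+ 2 == 1.
  by rewrite -FinRing.val_unitX -x2 expg_order.
rewrite -subr_eq0 subr_sqr_1 mulf_eq0 subr_eq0 addr_eq0 => /orP[]/eqP // x1.
have : #[x]%g = 1%N by apply/eqP; rewrite order_eq1; apply/eqP/val_inj.
by rewrite x2.
Qed.

Lemma card_semiInv_even (D : {group U}) : ~~ odd #|D| -> #|semiInv D| = 1%N.
Proof.
move=> evD; apply/eqP/cards1P; exists [ffun=> 0]; apply/setP=> Phi; rewrite [RHS]inE.
apply/semiInvP/eqP=> [[_ ev eqv]|->]; last first.
  by split=> [|t|c t _]; rewrite !ffunE ?mulr0.
apply/ffunP=> t; rewrite ffunE; apply/eqP.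
have := eqv _ t (minus1_in_even evD); rewrite /= !mulN1r ev => /eqP.
by rewrite -subr_eq0 opprK -mulr2n -mulr_natl mulf_eq0 (negPf (F_two_neq0 p_pr odd_p)).
Qed.

(** As -1 is not in [D], evenness and equivariance amount to one equivariance under the product of
    [D] and the group of -1, for the character that is the identity on [D] and 1 at -1. Since
    [Phi 0 = 0], only values at units matter. *)
Lemma card_semiInv_odd (D : {group U}) : odd #|D| ->
  #|semiInv D| = (p ^ ((p - 1) %/ (2 * #|D|)))%N.
Proof.
move=> oddD; pose m := minus1.
have abU (x y : U) : (x * y = y * x)%g by apply: val_inj; apply: mulrC.
have mD : m \notin D.
  by apply/negP=> /order_dvdG; rewrite order_minus1 dvdn2 oddD.
have mm : (m * m = 1)%g by apply: val_inj; rewrite /= mulrNN mulr1.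
pose H := (D <*> <[m]>)%G.
have defH : H = (D * <[m]>)%g :> {set U}.
  by rewrite /= norm_joinEr //; apply: cents_norm; apply/centsP=> x _ y _; apply: abU.
have HP x : x \in H -> (x \in D) || ((m * x)%g \in D).
  rewrite defH => /mulsgP[d y dD]; rewrite (cycle2g order_minus1) !inE => /orP[]/eqP-> ->.
    by rewrite mulg1 dD.
  by rewrite [(m * _)%g]abU -mulgA mm mulg1 dD orbT.
have oH : #|H| = (2 * #|D|)%N.
  rewrite defH TI_cardMg ?orderE -?orderE ?order_minus1 1?mulnC //.
  by apply: coprime_TIg; rewrite -orderE order_minus1 coprimen2.
pose chi (c : U) : F := if c \in D then uval c else - uval c.
have chi1 : chi 1%g = 1 by rewrite /chi group1.
have chiM : {in H &, {morph chi : g h / (g * h)%g >-> g * h}}.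
  move=> g h /HP gH /HP hH; rewrite /chi.
  case gD: (g \in D) gH => /= gH; first by rewrite groupMl //; case: ifP => _; rewrite //= mulrN.
  case hD: (h \in D) hH => /= hH; first by rewrite groupMr // gD /= mulNr.
  have -> : (g * h)%g \in D.
    have -> : (g * h = (m * g) * (m * h))%g; last by rewrite groupM.
    by rewrite [(m * g)%g]abU -mulgA (mulgA m m) mm mul1g.
  by rewrite mulrNN.
pose restr (Phi : {ffun F -> F}) : {ffun U -> F} := [ffun u => Phi (uval u)].
have restr_inj : {in semiInv D &, injective restr}.
  move=> Phi Phi' /semiInvP[P0 _ _] /semiInvP[P0' _ _] e; apply/ffunP=> t.
  have [->|t0] := eqVneq t 0; first by rewrite P0 P0'.
  have tU : t \is a GRing.unit by rewrite unitfE.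
  by have := congr1 (fun g : {ffun _ -> _} => g (FinRing.unit F tU)) e; rewrite !ffunE.
have -> : ((p - 1) %/ (2 * #|D|))%N = #|[set: U] : H|%g.
  by rewrite -divgS ?subsetT // oH card_units.
have := card_equivariant chi1 chiM; rewrite card_Fp // => <-.
rewrite -(card_in_imset restr_inj).
apply: eq_card => Psi; rewrite [RHS]inE; apply/imsetP/forall_inP => [[Phi /semiInvP[_ ev eqv] ->]|eqv].
  move=> h /HP hH; apply/forallP=> t; rewrite /chi !ffunE /=.
  case hD: (h \in D) hH => /= hH; first by rewrite eqv.
  have := eqv _ (uval t) hH; rewrite /= !mulN1r => <-.
  by rewrite mulNr ev.
(* Extension by 0 from the units to the field. *)
pose Phi : {ffun F -> F} := [ffun t => oapp Psi 0 (insub t)].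
have PhiU (u : U) : Phi (uval u) = Psi u by rewrite ffunE valK.
have Phi0 : Phi 0 = 0 by rewrite ffunE insubN // unitr0.
have uP (t : F) : t = 0 \/ exists u : U, t = uval u.
  have [->|t0] := eqVneq t 0; first by left.
  have tU : t \is a GRing.unit by rewrite unitfE.
  by right; exists (FinRing.unit F tU).
have DH : D \subset H by apply: joing_subl.
have mH : m \in H by apply: (subsetP (joing_subr _ _)); apply: cycle_id.
exists Phi; last by apply/ffunP=> u; rewrite ffunE PhiU.
apply/semiInvP; split=> // [t|c t cD].
  have [->|[u ->]] := uP t; first by rewrite oppr0.
  have -> : - uval u = uval (m * u)%g by rewrite /= mulN1r.
  have /forallP/(_ u)/eqP := eqv m mH; rewrite !PhiU => ->.
  by rewrite /chi (negPf mD) /= opprK mul1r.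
have [->|[u ->]] := uP t; first by rewrite mulr0 Phi0 mulr0.
have -> : uval c * uval u = uval (c * u)%g by [].
have /forallP/(_ u)/eqP := eqv c (subsetP DH _ cD); rewrite !PhiU => ->.
by rewrite /chi cD.
Qed.

End SemiInvariants.

(** * Burnside's lemma for the parameters *)

Section OrbitCount.
Variable p : nat.
Hypothesis p_pr : prime p.
Local Open Scope ring_scope.
Notation F := 'F_p.
Notation U := {unit 'F_p}.
Notation uval := FinRing.uval.

Definition fixedParams (s al : U) : {set {ffun F -> F}} :=
  [set Phi : {ffun F -> F} | validParam (al, Phi) && (scaleParam (al, Phi) s == (al, Phi))].

Lemma sum_card_fix (s : U) :
  #|'Fix_(validParams p | paramAction p)[s]%g| = (\sum_al #|fixedParams s al|)%N.
Proof.
rewrite -sum1_card.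
transitivity (\sum_(al : U) \sum_(Phi : {ffun F -> F} | Phi \in fixedParams s al) 1)%N.
  rewrite pair_big_dep /=; apply: eq_bigl => -[al Phi].
  by rewrite !inE sub1set inE.
by apply: eq_bigr => al _; rewrite sum1_card.
Qed.

Lemma sum_fixedParams :
  (\sum_(s : U) \sum_al #|fixedParams s al| = #|paramOrbits p| * (p - 1))%N.
Proof.
rewrite -(card_units p_pr) -(Frobenius_Cauchy (acts_validParams p)).
by apply: eq_big => [s|s _]; rewrite ?inE // sum_card_fix.
Qed.

Lemma fixedParamsP (s al : U) (Phi : {ffun F -> F}) :
  reflect [/\ forall t, Phi (- t) = Phi t,
              forall c t, c \in [set s; al] -> Phi (uval c * t) = uval c * Phi t
            & exists t, Phi t != Phi 0]
          (Phi \in fixedParams s al).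
Proof.
rewrite inE; apply: (iffP andP) => [[/validParamP[_ ev lin nc] /eqP[e]]|[ev eqv nc]].
  split=> // c t; rewrite !inE => /orP[]/eqP-> //.
  have := congr1 (fun g : {ffun _ -> _} => g (uval s * t)) e.
  by rewrite ffunE mulrA mulVf ?unitF_neq0 // mul1r.
split.
  apply/validParamP; split=> //; first exact: unitF_neq0.
  by move=> t; apply: eqv; rewrite !inE eqxx orbT.
apply/eqP; congr pair; apply/ffunP=> t; rewrite ffunE -eqv ?inE ?eqxx //.
by rewrite mulrA mulfV ?unitF_neq0 // mul1r.
Qed.

(** Equivariance under a unit other than 1 forces [Phi 0 = 0], so nonconstant means nonzero. *)
Lemma card_fixedParams (s al : U) : (s, al) != (1, 1)%g ->
  #|fixedParams s al| = (#|semiInv [set s; al]| - 1)%N.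
Proof.
move=> sal.
have nz0 : [ffun=> 0] \in semiInv [set s; al].
  by apply/semiInvP; split=> [|t|c t _]; rewrite !ffunE ?mulr0.
rewrite (cardsD1 [ffun=> 0] (semiInv _)) nz0 addKn.
apply: eq_card => Phi; rewrite [RHS]inE in_set1.
apply/fixedParamsP/andP => [[ev eqv [t nct]]|[nz /semiInvP[P0 ev eqv]]].
  have P0 : Phi 0 = 0.
    have [c cA c1] : exists2 c, c \in [set s; al] & c != 1%g.
      have [s1|s1] := eqVneq s 1%g; last by exists s; rewrite // !inE eqxx.
      by exists al; rewrite ?inE ?eqxx ?orbT //; apply: contraNneq sal => ->; rewrite s1.
    have := eqv c 0 cA; rewrite mulr0 => /eqP.
    rewrite -subr_eq0 -{1}[Phi 0]mul1r -mulrBl mulf_eq0 subr_eq0 => /orP[/eqP e|/eqP //].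
    by case/eqP: c1; apply: val_inj.
  split; last exact/semiInvP.
  by apply: contraNneq nct => ->; rewrite !ffunE.
split=> //; have [t Pt|P00] := pickP (fun t => Phi t != 0); first by exists t; rewrite P0.
by case/eqP: nz; apply/ffunP=> t; rewrite ffunE; apply/eqP; move/negbFE: (P00 t).
Qed.

(** Here [Phi 0] is arbitrary, which gives the factor p: [Phi] is a constant plus a nonzero even
    function vanishing at 0. *)
Lemma card_fixedParams1 :
  #|fixedParams 1%g 1%g| = (p * (#|semiInv (1 : {set U})%g| - 1))%N.
Proof.
have nz0 : [ffun=> 0] \in semiInv (1 : {set U})%g.
  by apply/semiInvP; split=> [|t|c t _]; rewrite !ffunE ?mulr0.
have -> : (#|semiInv (1 : {set U})%g| - 1)%N = #|semiInv (1 : {set U})%g :\ [ffun=> 0]|.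
  by rewrite [in LHS](cardsD1 [ffun=> 0]) nz0 addKn.
have := cardsX [set: F] (semiInv (1 : {set U})%g :\ [ffun=> 0]).
rewrite cardsT card_Fp // => <-.
pose shift (w : F * {ffun F -> F}) : {ffun F -> F} := [ffun t => w.1 + w.2 t].
have shift_inj : {in setX [set: F] (semiInv (1 : {set U})%g :\ [ffun=> 0]) &, injective shift}.
  move=> [c Psi] [c' Psi'] /setXP[_ /setD1P[_ /semiInvP[P0 _ _]]].
  move=> /setXP[_ /setD1P[_ /semiInvP[P0' _ _]]] e.
  have eE t : c + Psi t = c' + Psi' t.
    by have := congr1 (fun g : {ffun _ -> _} => g t) e; rewrite !ffunE.
  have cc : c = c' by have := eE 0; rewrite P0 P0' !addr0.
  congr pair => //; apply/ffunP=> t; apply: (addrI c); rewrite eE.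
  by rewrite cc.
rewrite -(card_in_imset shift_inj); apply: eq_card => Phi.
apply/fixedParamsP/imsetP => [[ev _ [t nct]]|[[c Psi]]].
  exists (Phi 0, [ffun t => Phi t - Phi 0]); last first.
    by apply/ffunP=> t'; rewrite !ffunE addrC subrK.
  apply/setXP; split=> //; apply/setD1P; split.
    apply: contraNneq nct => /(congr1 (fun g : {ffun _ -> _} => g t)) /eqP.
    by rewrite !ffunE subr_eq0.
  apply/semiInvP; split=> [|t'|c' t' /set1P ->].
  - by rewrite ffunE subrr.
  - by rewrite !ffunE ev.
  by rewrite !mul1r.
move=> /setXP[_ /setD1P[nz /semiInvP[P0 ev _]]] ->; split=> [t|c' t|].
- by rewrite !ffunE ev.
- by rewrite !inE orbb => /eqP ->; rewrite !mul1r.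
have [t Pt|P00] := pickP (fun t => Psi t != 0).
  by exists t; rewrite !ffunE (inj_eq (addrI _)) P0.
by case/eqP: nz; apply/ffunP=> t; rewrite ffunE; apply/eqP; move/negbFE: (P00 t).
Qed.

(* A subgroup of even order contains -1, and a function that is both even and
   equivariant under -1 vanishes. *)
Definition cyclicCount (e : nat) : nat :=
  if odd e then (p ^ ((p - 1) %/ (2 * e)) - 1)%N else 0%N.

Hypothesis odd_p : odd p.

Lemma card_semiInv (D : {group U}) : (#|semiInv D| - 1)%N = cyclicCount #|D|.
Proof.
rewrite /cyclicCount; case: ifP => oD; first by rewrite card_semiInv_odd.
by rewrite card_semiInv_even ?oD.
Qed.

(** The extra term arises because the pair (1, 1) contributes p times its [cyclicCount] instead of
    once. *)
Lemma sum_fixedParams_pairGen :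
  (\sum_(s : U) \sum_al #|fixedParams s al| =
   (p - 1) * cyclicCount 1 + \sum_(e <- divisors (p - 1)) psi e * cyclicCount e)%N.
Proof.
have E s al : (#|fixedParams s al| = cyclicCount #|pairGen (s, al)| +
    (if (s, al) == (1, 1)%g then (p - 1) * cyclicCount 1 else 0))%N.
  case: eqP => [[-> ->]|/eqP sal]; last first.
    by rewrite card_fixedParams // -semiInv_gen addn0 -card_semiInv.
  have -> : #|pairGen ((1, 1)%g : U * U)| = 1%N.
    rewrite /pairGen /=.
    by rewrite setUid (genGid 1%G) cards1.
  by rewrite card_fixedParams1 (card_semiInv 1%G) cards1 -mulSn subn1 prednK ?prime_gt0 //.
transitivity (\sum_(s : U) (\sum_(al : U) cyclicCount #|pairGen (s, al)| +
    \sum_(al : U) if (s, al) == (1, 1)%g then (p - 1) * cyclicCount 1 else 0))%N.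
  by apply: eq_bigr => s _; rewrite -big_split; apply: eq_bigr => al _; apply: E.
rewrite big_split /= addnC; congr (_ + _)%N.
  rewrite pair_big /= -big_mkcond /= (big_pred1 (1, 1)%g) //.
rewrite -(card_units p_pr) -(sum_pairGen (cyclic_units p)).
apply: eq_big => [s|s _]; first by rewrite inE.
by apply: eq_bigl => al; rewrite inE.
Qed.

End OrbitCount.

Section Count.
Variable p : nat.
Hypothesis p_pr : prime p.

(** Only the odd divisors of [p - 1] contribute, and these are the divisors [e] of [l]; the sum in
    the statement runs over [d = l %/ e], for which [(p - 1) / (2 e)] is [2 ^ (k - 1) * d]. *)
Lemma card_paramOrbits_odd k l : odd p -> p - 1 = 2 ^ k * l -> odd l ->
  #|paramOrbits p| = p ^ ((p - 1) %/ 2) - 1 +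
    \sum_(d <- divisors l) psi (l %/ d) * ((p ^ (2 ^ (k - 1) * d) - 1) %/ (p - 1)).
Proof.
move=> odd_p pkl odd_l; have p_gt2 := odd_prime_gt2 odd_p p_pr.
have p1_gt0 : 0 < p - 1 by lia.
have l_gt0 : 0 < l := odd_gt0 odd_l.
have k_gt0 : 0 < k.
  case: k pkl => // pkl; move: odd_l; rewrite -[l]mul1n -pkl oddB ?odd_p //.
  by rewrite prime_gt0.
have lp1 : l %| p - 1 by rewrite pkl dvdn_mull.
apply/eqP; rewrite -(eqn_pmul2r p1_gt0) -sum_fixedParams // sum_fixedParams_pairGen //.
rewrite mulnDl; apply/eqP; congr (_ + _); first by rewrite mulnC /cyclicCount /= muln1.
rewrite [RHS]big_distrl /= -(sum_divisors_rev _ l_gt0).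
transitivity (\sum_(e <- divisors (p - 1) | e %| l) psi e * cyclicCount p e).
  rewrite [RHS]big_mkcond; apply: eq_big_seq => e; rewrite -dvdn_divisors // => ep.
  case: ifP => // el; rewrite /cyclicCount; case: ifP => [odd_e|_]; last by rewrite muln0.
  by move: ep; rewrite pkl Gauss_dvdr ?el // coprimeXr // coprimen2.
rewrite -sum_divisors_dvd //; apply: eq_big_seq => e; rewrite -dvdn_divisors // => el.
have e_gt0 := dvdn_gt0 l_gt0 el.
have le_e : l %/ (l %/ e) = e by rewrite divnA // mulKn.
rewrite le_e -mulnA divnK.
  rewrite /cyclicCount (dvdn_odd el odd_l); congr (_ * (p ^ _ - 1)).
  rewrite pkl -{1}(prednK k_gt0) expnS -mulnA divnMl // -subn1.
  by rewrite muln_divA.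
by rewrite !subn1 predn_exp dvdn_mulr.
Qed.

End Count.

Section Two.
Local Open Scope ring_scope.

(** Over F_2 the only unit is 1 and every function is even, so the parameters are the 4 - 2
    nonconstant functions, each forming its own orbit. *)
Lemma card_paramOrbits_two p : prime p -> p = 2%N -> #|paramOrbits p| = 2%N.
Proof.
move=> p_pr p2.
have ev_p : ~~ odd p by rewrite p2.
have oppF (t : 'F_p) : - t = t.
  apply/eqP; rewrite -subr_eq0 -opprD oppr_eq0 -mulr2n -mulr_natl.
  by rewrite -{1}p2 pchar_Fp_0 // mul0r.
have U1 (s : {unit 'F_p}) : s = 1%g.
  by apply: val_inj; apply: F2_eq1 p_pr _ ev_p (unitF_neq0 s).
have cardsF : #|{ffun 'F_p -> 'F_p}| = 4%N.
  by rewrite card_ffun card_Fp // p2.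
have -> : #|paramOrbits p| = #|validParams p|.
  apply: card_in_imset => w w' _ _ e.
  have : w \in orbit (paramAction p) [set: {unit 'F_p}] w' by rewrite -e orbit_refl.
  by case/imsetP=> s _ ->; rewrite (U1 s) act1.
pose cst (c : 'F_p) : {unit 'F_p} * {ffun 'F_p -> 'F_p} := (1%g, [ffun=> c]).
have cst_inj : injective cst by move=> c c' [/ffunP/(_ 0)]; rewrite !ffunE.
have eC : ~: validParams p = cst @: [set: 'F_p].
  apply/setP=> -[al Phi]; rewrite !inE; apply/idP/imsetP => [nV|[c _ ->]].
    exists (Phi 0) => //; rewrite (U1 al) /cst; congr pair; apply/ffunP=> t; rewrite ffunE.
    apply/eqP; apply: contraNT nV => nc; apply/validParamP; split=> [|t'|t'|] /=.
    + exact: unitF_neq0.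
    + by rewrite oppF.
    + by rewrite (U1 al) !mul1r.
    by exists t.
  by apply/negP=> /validParamP[_ _ _ [t]]; rewrite /= !ffunE eqxx.
have oC : #|~: validParams p| = 2%N by rewrite eC card_imset // cardsT card_Fp.
have oU : #|{: {unit 'F_p}}| = 1%N by rewrite -cardsT card_units // p2.
by have /eqP := cardsC (validParams p); rewrite oC card_prod oU cardsF (eqn_add2r 2 _ 2) => /eqP.
Qed.

End Two.

Theorem mainTheorem4 :
  (forall p : nat, prime p ->
     (p = 2 -> isoClassCount (indecIrretrOfSize (p ^ 2)) 2) /\
     (odd p -> forall k l : nat, p - 1 = 2 ^ k * l -> odd l ->
        isoClassCount (indecIrretrOfSize (p ^ 2))
          (p ^ ((p - 1) %/ 2) - 1 +
           \sum_(d <- divisors l)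
              psi (l %/ d) * ((p ^ (2 ^ (k - 1) * d) - 1) %/ (p - 1))))) /\
  (forall n : nat, 0 < n ->
     psi n = \prod_(q <- primes n) ((q ^ 2 - 1) * q ^ (2 * logn q n - 2))).
Proof.
split=> [p p_pr|]; last exact: psi_prod.
have count := isoClassCount_paramOrbits p_pr.
split=> [p2|odd_p k l pkl odd_l]; first by rewrite (card_paramOrbits_two p_pr p2) in count.
by rewrite (card_paramOrbits_odd p_pr odd_p pkl odd_l) in count.
Qed.
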